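(* Let $X$ be a reflexive Banach space with $1$-symmetric basis. Then: (1) $JF_X$ is isometric to $V_X^0$. (2) $JF_X^{**}$ is isometric to $V_X$. (3) On the bounded subsets of $V_X^0$ the weak topology coincides with the topology of pointwise convergence on $[0,1]$.
   Context: $X$ is a (infinite-dimensional, real) reflexive Banach space with a $1$-symmetric basis $(e_n)_n$, i.e. $\|\sum_n \epsilon_n a_n e_{\pi(n)}\|_X=\|\sum_n a_n e_n\|_X$ for all finitely supported real $(a_n)$, signs $\epsilon_n$ and permutations $\pi$ of $\mathbb{N}$. $JF_X$ is the completion of $L^1((0,1))$ under the norm $\|f\|_{JF_X}=\sup\{\|\sum_{j=1}^m(\int_{I_j}f\,d\mu)e_j\|_X : I_1,\dots,I_m\subset(0,1)\text{ pairwise disjoint open intervals}\}$, where $\mu$ is Lebesgue measure. For $f:[0,1]\to\mathbb{R}$ and a partition $\mathcal{P}=\{0=t_0<t_1<\dots<t_n=1\}$ of $[0,1]$ put $\alpha_X(f,\mathcal{P})=\|\sum_{i=0}^{n-1}(f(t_{i+1})-f(t_i))e_i\|_X$ (where $e_0,\dots,e_{n-1}$ stands for any $n$ distinct basis vectors) and $\delta(\mathcal{P})=\max_i(t_{i+1}-t_i)$. Let $\|f\|_{V_X}=\sup_{\mathcal{P}}\alpha_X(f,\mathcal{P})$, $V_X=\{f:[0,1]\to\mathbb{R} : f(0)=0,\ \|f\|_{V_X}<\infty\}$ and $V_X^0=\{f\in V_X:\lim_{\varepsilon\to0}\sup\{\alpha_X(f,\mathcal{P}):\delta(\mathcal{P})\le\varepsilon\}=0\}$,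 both Banach spaces with norm $\|\cdot\|_{V_X}$; $V_X^0\subset C[0,1]$. *)

(* Defs.v *)
From HB Require Import structures.
From mathcomp Require Import all_boot all_order all_algebra.
From mathcomp Require Import all_classical all_reals all_analysis.
Set Implicit Arguments.
Unset Strict Implicit.
Unset Printing Implicit Defensive.
Import Order.TTheory GRing.Theory Num.Theory.
Import numFieldNormedType.Exports.

Local Open Scope classical_set_scope.
Local Open Scope ring_scope.

Section Dual.
Context {R : realType} (E : normedModType R).

Definition continuous_functional : {pred (E -> R^o)} :=
  mem [set f : E -> R^o | linear f /\ continuous f].

Record dual := Dual {
  dual_fun :> E -> R^o ;
  dual_funP : dual_fun \in continuous_functional }.

HB.instance Definition _ := [isSub for dual_fun].
HB.instance Definition _ := [Choice of dual by <:].

Lemma continuous_functional_submod_closed :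
  submod_closed continuous_functional.
Proof.
split.
  rewrite inE; split.
    by move=> a u v; rewrite -[LHS]/(0 : R^o) -[X in _ = a *: X + _]/(0 : R^o) scaler0 addr0.
  exact: (@cst_continuous _ _ (0 : R^o)).
move=> a f g; rewrite !inE => -[lf cf] [lg cg]; split.
  move=> k u v; rewrite !fctE lf lg !scalerDr !scalerA (mulrC a k).
  by rewrite -!addrA; congr (_ + _); rewrite !addrA; congr (_ + _); rewrite addrC.
by move=> x; apply: cvgD; [apply: cvgZr; exact: cf|exact: cg].
Qed.

HB.instance Definition _ := GRing.isSubmodClosed.Build _ _
  continuous_functional continuous_functional_submod_closed.
HB.instance Definition _ := [SubChoice_isSubLmodule of dual by <:].

Definition opnorm (f : E -> R^o) : R :=
  sup [set `|f x| | x in [set x | `|x| <= 1]].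

Lemma dual_linear (f : dual) : linear f.
Proof. by have := dual_funP f; rewrite inE => -[]. Qed.

Lemma dual_continuous (f : dual) : continuous f.
Proof. by have := dual_funP f; rewrite inE => -[]. Qed.

Lemma dualZ (f : dual) a x : f (a *: x) = a * f x.
Proof.
have L := dual_linear f.
have f0 : f 0 = 0 by have := L (-1) 0 0; rewrite scaleN1r oppr0 addr0 scaleN1r addNr.
by have := L a x 0; rewrite addr0 f0 addr0.
Qed.

Lemma dual_has_sup (f : dual) :
  has_sup [set `|f x| | x in [set x | `|x| <= 1]].
Proof.
split; first by exists `|f 0|; exists 0 => //=; rewrite normr0.
pose lf := GRing.isLinear.Build R E R^o *:%R f (dual_linear f).
pose F : {linear E -> R^o} := HB.pack (dual_fun f) lf.
have cF : {for 0, continuous F} by exact: (@dual_continuous f).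
have /linear_boundedP [M [_ HM]] := continuous_linear_bounded 0 cF.
have {}HM := HM _ (ltr_pwDr ltr01 (ler_norm M)).
exists (`|M| + 1) => _ [x /= x1 <-]; apply: (le_trans (HM x)).
by rewrite ler_piMr// addr_ge0.
Qed.

Lemma opnorm_ub (f : dual) x : `|x| <= 1 -> `|f x| <= opnorm f.
Proof. by move=> x1; apply: (ub_le_sup (dual_has_sup f).2); exists x. Qed.

Lemma opnorm_le (f : dual) c :
  (forall x, `|x| <= 1 -> `|f x| <= c) -> opnorm f <= c.
Proof.
move=> H; apply: ge_sup; first exact: (dual_has_sup f).1.
by move=> _ [x /= x1 <-]; exact: H.
Qed.

Lemma opnormD (f g : dual) : opnorm (f + g : dual) <= opnorm f + opnorm g.
Proof.
apply: opnorm_le => x x1; apply: (le_trans (ler_normD _ _)).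
by rewrite lerD// opnorm_ub.
Qed.

Let opnormZ_le a (f : dual) : opnorm (a *: f : dual) <= `|a| * opnorm f.
Proof.
apply: opnorm_le => x x1; rewrite -[X in `|X|]/(a * f x) normrM.
by rewrite ler_wpM2l// opnorm_ub.
Qed.

Lemma opnormZ a (f : dual) : opnorm (a *: f : dual) = `|a| * opnorm f.
Proof.
apply/eqP; rewrite eq_le opnormZ_le /=.
have [->|a0] := eqVneq a 0.
  rewrite normr0 mul0r.
  apply: (@le_trans _ _ `|(0 *: f : dual) 0|); first exact: normr_ge0.
  by apply: opnorm_ub; rewrite normr0.
rewrite -ler_pdivlMl ?normr_gt0// -normfV.
by have := opnormZ_le a^-1 (a *: f); rewrite scalerA mulVf// scale1r.
Qed.

Lemma opnorm0_eq0 (f : dual) : opnorm f = 0 -> f = 0.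
Proof.
move=> f0; apply/val_inj/funext => x /=.
have [->|x0] := eqVneq x 0; first by rewrite -(scale0r 0) dualZ mul0r.
have nx : `|x| != 0 by rewrite normr_eq0.
have /(opnorm_ub f) : `| `|x|^-1 *: x| <= 1.
  by rewrite normrZ normfV normr_id mulVf.
rewrite f0 normr_le0 dualZ mulf_eq0 invr_eq0 (negbTE nx) /=.
by move/eqP.
Qed.

HB.instance Definition _ := @Lmodule_isNormed.Build R dual
  (fun f => opnorm f) opnormD opnormZ opnorm0_eq0.

End Dual.

(* Surjectivity of the canonical embedding of E into its bidual. *)
Definition reflexive_space {R : realType} (E : normedModType R) : Prop :=
  forall Phi : dual (dual E), exists x : E, forall phi : dual E, Phi phi = phi x.

Definition isometric_spaces {R : realType} (E F : normedModType R) : Prop :=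
  exists T : {linear E -> F}, bijective T /\ forall x, `|T x| = `|x|.

(* E with its weak topology: the coarsest one making every element of the dual
   continuous. *)
Definition weak_space {R : realType} (E : normedModType R) : Type :=
  initial_topology
    ((fun x phi => phi x) : E -> {ptws dual E -> R}).
HB.instance Definition _ (R : realType) (E : normedModType R) :=
  Topological.on (weak_space E).

Section SymmetricBasis.
Context {R : realType} {X : normedModType R}.
Implicit Type e : nat -> X.

Definition schauder_basis e : Prop :=
  forall x : X, exists! a : nat -> R, series (fun k => a k *: e k) @ \oo --> x.

Definition one_symmetric e : Prop :=
  forall (n : nat) (a : nat -> R) (s : nat -> bool) (p : nat -> nat),
    bijective p ->
    `|\sum_(k < n) ((-1) ^+ s k * a k) *: e (p k)| = `|\sum_(k < n) a k *: e k|.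

End SymmetricBasis.

Record symmetric_basis {R : realType} (X : normedModType R) := SymmetricBasis {
  basis_vect :> nat -> X ;
  basis_schauder : schauder_basis basis_vect ;
  basis_symmetric : one_symmetric basis_vect }.

Section JF.
Context {R : realType} {X : normedModType R} (e : symmetric_basis X).
Local Notation mu := (@lebesgue_measure R).

(* Elements of L^1((0,1)) are represented by functions on R, of which only the
   restriction to (0,1) is relevant. *)
Definition L1 : set (R -> R) := [set f | mu.-integrable `]0, 1[ (EFin \o f)].

Definition JF_norm (f : R -> R) : \bar R :=
  ereal_sup [set r | exists (m : nat) (a b : 'I_m -> R),
    [/\ forall j, a j < b j /\ `]a j, b j[%classic `<=` `]0, 1[%classic,
        trivIset setT (fun j => `]a j, b j[%classic) &
        r = `|\sum_(j < m) (\int[mu]_(x in `]a j, b j[) f x) *: e j|%:E]].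

(* J, together with the map i, is the completion of L^1((0,1)) for JF_norm;
   isometry makes i f depend only on the a.e. class of f on (0,1). *)
Record JF_completion (J : completeNormedModType R) (i : (R -> R) -> J) : Prop :=
  JFCompletion {
    JF_linear : forall (a : R) (f g : R -> R), L1 f -> L1 g ->
      i (fun x => a * f x + g x) = a *: i f + i g ;
    JF_isometric : forall f : R -> R, L1 f -> `|i f|%:E = JF_norm f ;
    JF_dense : dense (i @` L1) }.

End JF.

Section UnitInterval.
Context {R : realType}.

Definition unit_interval : Type := {x : R | 0 <= x <= 1}.

Definition I0 : unit_interval := exist _ 0 (introT andP (conj (lexx 0) ler01)).

(* The partition t 0 < ... < t n; the values t k for k > n are irrelevant. *)
Definition is_partition (n : nat) (t : nat -> unit_interval) : Prop :=
  [/\ \val (t 0%N) = 0, \val (t n) = 1 &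
      forall k, (k < n)%N -> \val (t k) < \val (t k.+1)].

Definition mesh (n : nat) (t : nat -> unit_interval) : R :=
  \big[Num.max/0]_(k < n) (\val (t k.+1) - \val (t k)).

Lemma clampP (x : R) : 0 <= Num.min 1 `|x| <= 1.
Proof. by rewrite le_min ler01 normr_ge0 /= ge_min lexx. Qed.

Definition clamp (x : R) : unit_interval := exist _ (Num.min 1 `|x|) (clampP x).

Lemma clampE (x : R) : 0 <= x <= 1 -> \val (clamp x) = x.
Proof. by case/andP => x0 x1; rewrite /= ger0_norm// min_r. Qed.

Lemma unit_interval_ge0 (x : unit_interval) : 0 <= \val x.
Proof. by case/andP: (valP x). Qed.

Lemma unit_interval_le1 (x : unit_interval) : \val x <= 1.
Proof. by case/andP: (valP x). Qed.

Lemma fine_partition (eps : R) : 0 < eps ->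
  exists n t, is_partition n t /\ mesh n t <= eps.
Proof.
move=> e0; have [N NE] : exists N : nat, eps^-1 <= N.+1%:R.
  exists (Num.truncn eps^-1).
  by rewrite ltW// truncnS_gt// ltW// invr_gt0.
exists N.+1, (fun k => clamp (k%:R / N.+1%:R)).
have cE k : (k <= N.+1)%N ->
    \val (clamp (k%:R / N.+1%:R)) = k%:R / N.+1%:R.
  by move=> kN; rewrite clampE// divr_ge0//= ler_pdivrMr// mul1r ler_nat.
split; first split.
- by rewrite cE// mul0r.
- by rewrite cE// divff.
- move=> k kN; rewrite !cE//; last exact: ltnW.
  by rewrite ltr_pM2r ?invr_gt0// ltr_nat.
- apply: bigmax_le; first exact: ltW.
  move=> k _; rewrite !cE//; last exact: ltnW.
  rewrite -mulrBl -[k.+1]addn1 natrD addrC addKr mul1r.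
  by rewrite invf_ple// posrE.
Qed.

End UnitInterval.
Arguments unit_interval R : clear implicits.

Section Variation.
Context {R : realType} {X : normedModType R} (e : symmetric_basis X).
Implicit Types (f g : unit_interval R -> R^o) (n : nat)
  (t : nat -> unit_interval R).

Definition alpha f n t : R :=
  `|\sum_(k < n) (f (t k.+1) - f (t k)) *: e k|.

Definition V_norm f : \bar R :=
  ereal_sup [set (alpha f P.1 P.2)%:E | P in [set P | is_partition P.1 P.2]].

Definition small_variation f (eps : R) : \bar R :=
  ereal_sup [set (alpha f P.1 P.2)%:E |
    P in [set P | is_partition P.1 P.2 /\ mesh P.1 P.2 <= eps]].

Lemma alphaD f g n t : alpha (f + g) n t <= alpha f n t + alpha g n t.
Proof.
rewrite /alpha; apply: le_trans (ler_normD _ _); rewrite -big_split/=.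
rewrite le_eqVlt; apply/orP; left; apply/eqP; congr `|_|.
by apply: eq_bigr => k _; rewrite -scalerDl !fctE opprD addrACA.
Qed.

Lemma alphaZ a f n t : alpha (a *: f) n t = `|a| * alpha f n t.
Proof.
rewrite /alpha -normrZ scaler_sumr; congr `|_|.
by apply: eq_bigr => k _; rewrite scalerA mulrBr.
Qed.

Section sup_alpha.
Variable D : set (nat * (nat -> unit_interval R)).
Let S f := ereal_sup [set (alpha f P.1 P.2)%:E | P in D].

Lemma sup_alpha_ge0 f : D !=set0 -> (0 <= S f)%E.
Proof.
move=> [P DP]; apply: (@le_trans _ _ (alpha f P.1 P.2)%:E).
  by rewrite lee_fin normr_ge0.
by apply: ereal_sup_ubound; exists P.
Qed.

Lemma sup_alpha_linear a f g : D !=set0 ->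
  (S (a *: f + g)%R <= `|a|%:E * S f + S g)%E.
Proof.
move=> D0; apply: ge_ereal_sup => _ [P DP <-].
apply: (@le_trans _ _ (`|a|%:E * (alpha f P.1 P.2)%:E + (alpha g P.1 P.2)%:E)%E).
  by rewrite -EFinM -EFinD lee_fin -alphaZ alphaD.
by apply: leeD; [apply: lee_wpmul2l|]; rewrite ?lee_fin//;
  apply: ereal_sup_ubound; exists P.
Qed.

Lemma sup_alpha0 : D !=set0 -> S 0 = 0%E.
Proof.
move=> D0; apply/eqP; rewrite eq_le sup_alpha_ge0// andbT.
apply: ge_ereal_sup => _ [P DP <-].
by rewrite -[X in alpha X](scale0r (0 : unit_interval R -> R^o)) alphaZ
  normr0 mul0r.
Qed.
End sup_alpha.

Let partition_neq0 :
  ([set P | is_partition P.1 P.2] : set (nat * (nat -> unit_interval R)))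
    !=set0.
Proof. by have [n [t [Pnt _]]] := @fine_partition R 1 ltr01; exists (n, t). Qed.

Let fine_partition_neq0 (eps : R) : 0 < eps ->
  ([set P | is_partition P.1 P.2 /\ mesh P.1 P.2 <= eps]
    : set (nat * (nat -> unit_interval R))) !=set0.
Proof. by case/fine_partition => n [t nt]; exists (n, t). Qed.

Definition V_pred : {pred (unit_interval R -> R^o)} :=
  mem [set f : unit_interval R -> R^o | f I0 = 0 /\ (V_norm f < +oo)%E].

Definition V0_pred : {pred (unit_interval R -> R^o)} :=
  mem [set f : unit_interval R -> R^o |
    f \in V_pred /\ small_variation f eps @[eps --> 0^'+] --> 0%E].

Lemma V_norm_fin f : f \in V_pred -> V_norm f \is a fin_num.
Proof.
rewrite inE => -[_ foo]; rewrite ge0_fin_numE//.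
exact: sup_alpha_ge0.
Qed.

Lemma V_submod_closed : submod_closed V_pred.
Proof.
split; first by rewrite inE; split => //; rewrite [V_norm _]sup_alpha0.
move=> a f g /[dup] /V_norm_fin ff + /[dup] /V_norm_fin gf.
rewrite !inE => -[f0 _] [g0 _].
split; first by rewrite !fctE f0 g0 scaler0 addr0.
apply: le_lt_trans (sup_alpha_linear a f g partition_neq0) _.
by rewrite -ge0_fin_numE ?fin_numD ?fin_numM// adde_ge0// ?mule_ge0//
  sup_alpha_ge0.
Qed.

HB.instance Definition _ := GRing.isSubmodClosed.Build _ _
  V_pred V_submod_closed.

Lemma V0_submod_closed : submod_closed V0_pred.
Proof.
split.
  rewrite inE; split; first exact: rpred0.
  apply: cvg_near_cst; near=> eps; apply: sup_alpha0.
  exact: fine_partition_neq0.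
move=> a f g; rewrite !inE => -[Vf f0] [Vg g0].
split; first by rewrite rpredD ?rpredZ.
apply: (@squeeze_cvge _ _ _ _ (cst 0%E) _
  (fun eps => `|a|%:E * small_variation f eps + small_variation g eps)%E).
- near=> eps; have ne := @fine_partition_neq0 eps.
  by rewrite sup_alpha_ge0 ?sup_alpha_linear//; exact: ne.
- exact: cvg_cst.
- rewrite [X in _ --> X](_ : _ = `|a|%:E * 0 + 0)%E; last by rewrite mule0 adde0.
  by apply: cvgeD => //; apply: cvgeZl.
Unshelve. all: by end_near. Qed.

HB.instance Definition _ := GRing.isSubmodClosed.Build _ _
  V0_pred V0_submod_closed.

Record V_space := VSpace { V_fun :> unit_interval R -> R^o ;
  V_funP : V_fun \in V_pred }.
Record V0_space := V0Space { V0_fun :> unit_interval R -> R^o ;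
  V0_funP : V0_fun \in V0_pred }.

HB.instance Definition _ := [isSub for V_fun].
HB.instance Definition _ := [Choice of V_space by <:].
HB.instance Definition _ := [SubChoice_isSubLmodule of V_space by <:].
HB.instance Definition _ := [isSub for V0_fun].
HB.instance Definition _ := [Choice of V0_space by <:].
HB.instance Definition _ := [SubChoice_isSubLmodule of V0_space by <:].

Lemma V0_in_V (f : V0_space) : (f : _ -> _) \in V_pred.
Proof. by have := V0_funP f; rewrite inE => -[]. Qed.

Lemma fine_V_norm_linear a f g : f \in V_pred -> g \in V_pred ->
  fine (V_norm (a *: f + g)) <= `|a| * fine (V_norm f) + fine (V_norm g).
Proof.
move=> Vf Vg; have Vfg : a *: f + g \in V_pred by rewrite rpredD ?rpredZ.
rewrite -lee_fin EFinD EFinM !fineK ?V_norm_fin//.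
exact: sup_alpha_linear.
Qed.

Lemma fine_V_normD f g : f \in V_pred -> g \in V_pred ->
  fine (V_norm (f + g)) <= fine (V_norm f) + fine (V_norm g).
Proof.
by move=> Vf Vg; have := fine_V_norm_linear 1 Vf Vg; rewrite scale1r normr1 mul1r.
Qed.

Lemma fine_V_normZ a f : f \in V_pred ->
  fine (V_norm (a *: f)) = `|a| * fine (V_norm f).
Proof.
have V0 : V_norm 0 = 0%E by exact: sup_alpha0.
have H b h : h \in V_pred -> fine (V_norm (b *: h)) <= `|b| * fine (V_norm h).
  move=> Vh; have := fine_V_norm_linear b Vh (rpred0 _).
  by rewrite V0 !addr0.
move=> Vf; apply/eqP; rewrite eq_le H//=.
have [->|a0] := eqVneq a 0; first by rewrite normr0 mul0r scale0r V0.
rewrite -ler_pdivlMl ?normr_gt0// -normfV.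
have := H a^-1 _ (@rpredZ _ _ V_pred a f Vf).
by rewrite scalerA mulVf// scale1r.
Qed.

Lemma basis_free n (a : nat -> R) : \sum_(k < n) a k *: e k = 0 ->
  forall k, (k < n)%N -> a k = 0.
Proof.
move=> a0; have [b [_ bu]] := basis_schauder e 0.
have b0 : b = cst 0.
  apply: bu; rewrite (_ : series _ = cst 0); first exact: cvg_cst.
  by apply/funext => m; rewrite /series/= big1// => k _; rewrite scale0r.
have : b = (fun k => if (k < n)%N then a k else 0).
  apply: bu; apply: cvg_near_cst; near=> m.
  rewrite /series/= (big_cat_nat (n := n)) //=; last by near: m; exists n.
  rewrite [X in _ + X]big_nat_cond [X in _ + X]big1 ?addr0; last first.
    by move=> k /andP[/andP[nk _] _]; rewrite ltnNge nk scale0r.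
  by rewrite -[RHS]a0 big_mkord; apply: eq_bigr => k _; rewrite ltn_ord.
move=> bE k kn; have := congr1 (fun h => h k) bE.
by rewrite b0 kn.
Unshelve. all: by end_near. Qed.

Lemma fine_V_norm0_eq0 f : f \in V_pred -> fine (V_norm f) = 0 -> f = 0.
Proof.
move=> Vf f0.
have H n t : is_partition n t -> forall k, (k < n)%N -> f (t k.+1) = f (t k).
  move=> Pt k kn; apply/eqP; rewrite -subr_eq0; apply/eqP.
  apply: (@basis_free n (fun k => f (t k.+1) - f (t k))) => //.
  apply/eqP; rewrite -normr_le0 -[leLHS]/(alpha f n t) -lee_fin -f0.
  by rewrite fineK ?V_norm_fin//; apply: ereal_sup_ubound; exists (n, t).
have fI0 : f I0 = 0 by move: Vf; rewrite inE => -[].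
pose I1 : unit_interval R := clamp 1.
have I1E : \val I1 = 1 by rewrite clampE// ler01 lexx.
apply/funext => x; rewrite /=.
have [x0|x0] := eqVneq (\val x) 0; first by have -> : x = I0 by exact: val_inj.
have {}x0 : 0 < \val x by rewrite lt_neqAle eq_sym x0 unit_interval_ge0.
have [x1|x1] := eqVneq (\val x) 1.
  pose t k : unit_interval R := if k is 0 then I0 else x.
  have Pt : is_partition 1 t by split => // -[].
  by have /= -> := H _ _ Pt 0%N isT.
have {}x1 : \val x < 1 by rewrite lt_neqAle x1 unit_interval_le1.
pose t k : unit_interval R :=
  if k is k'.+1 then if k' is 0 then x else I1 else I0.
have Pt : is_partition 2 t by split => // -[|[|//]] _; rewrite /t ?I1E.
by have /= -> := H _ _ Pt 0%N isT.
Qed.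

Lemma V_space_norm0 (h : V_space) : fine (V_norm h) = 0 -> h = 0.
Proof. by move/(fine_V_norm0_eq0 (V_funP h)) => h0; exact: val_inj. Qed.

Lemma V0_space_norm0 (h : V0_space) : fine (V_norm h) = 0 -> h = 0.
Proof. by move/(fine_V_norm0_eq0 (V0_in_V h)) => h0; exact: val_inj. Qed.

HB.instance Definition _ := @Lmodule_isNormed.Build R V_space
  (fun f : V_space => fine (V_norm f))
  (fun f g : V_space => fine_V_normD (V_funP f) (V_funP g))
  (fun a (f : V_space) => fine_V_normZ a (V_funP f))
  V_space_norm0.

HB.instance Definition _ := @Lmodule_isNormed.Build R V0_space
  (fun f : V0_space => fine (V_norm f))
  (fun f g : V0_space => fine_V_normD (V0_in_V f) (V0_in_V g))
  (fun a (f : V0_space) => fine_V_normZ a (V0_in_V f))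
  V0_space_norm0.

(* V0_space with the topology of pointwise convergence on [0, 1]. *)
Definition V0_pointwise : Type :=
  initial_topology ((fun f : V0_space => V0_fun f) :
    V0_space -> {ptws unit_interval R -> R}).
HB.instance Definition _ := Topological.on V0_pointwise.

End Variation.

(* Main.v *)
Require Import Defs.
From HB Require Import structures.
From mathcomp Require Import all_boot all_order all_algebra.
From mathcomp Require Import all_classical all_reals all_analysis.
From mathcomp Require Import lra.
Set Implicit Arguments.
Unset Strict Implicit.
Unset Printing Implicit Defensive.
Import Order.TTheory GRing.Theory Num.Theory.
Import numFieldNormedType.Exports.
Local Open Scope classical_set_scope.
Local Open Scope ring_scope.

(** Taking f to its primitive identifies JF_X with the closure in V_X^0 of the
    primitives of L^1 functions, and the bidual of V_X^0 is identified with V_X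
    by evaluating Phi in (V_X^0)** at the point evaluations delta_t.  Both maps
    are onto, and the two topologies agree on bounded sets, because the delta_t
    span a norm-dense subspace of (V_X^0)*: every functional phi is small on the
    functions of the unit ball that vanish on a suitable finite set.

    Suppose phi violates this.  A Helly-type selection yields F_k in the unit
    ball with phi(F_k) >= delta that vanish on more and more points and converge
    pointwise to some G.  The points of vanishing include a dense set, so the
    values of G have X-norm at most 1 and, X being boundedly complete, G is
    small off a finite set; they also include the atoms of phi, so the part of G
    on that finite set can be subtracted from F_k without affecting phi(F_k)
    much.  What is left is a bounded sequence whose pointwise limit is small in
    variation.  Each norm in V_X^0 is attained by a functional of the form
    z |-> x*(sum_j z(I_j) e_j) with disjoint intervals I_j, along which, X being
    reflexive, such a sequence becomes small; Simons' inequality then makes it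
    small along phi too, a contradiction. *)

(** * Hahn-Banach *)

(** The obstacle is that V^0 is neither reflexive nor closed under pointwise limits: the limit G
    lies only in V, where phi is not defined. Hence phi is extended to V by limits along
    interpolants, and its atoms are the values of this extension on indicators of single points.
    Reflexivity of X is used through three consequences: bounded coefficient sequences define
    vectors, bounded coordinatewise null sequences are weakly null, and the norm of a sum of n basis
    vectors is o(n). The last one puts continuous functions of bounded variation into V^0, and it
    leaves only finitely many atoms above each positive level, so that countably many points catch
    all of them. Finite zero sets form an uncountable directed family; once these countably many
    points are known, a sequence of finite sets suffices for the selection. Weak compactness is
    always obtained from limits along ultrafilters, which exist for every bounded family. *)

Section HahnBanach.
Context {R : realType} {E : lmodType R}.

Definition sublinear (p : E -> R) :=
  (forall x y, p (x + y) <= p x + p y) /\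
  (forall a x, 0 <= a -> p (a *: x) = a * p x).

Lemma sublinear0 p : sublinear p -> p 0 = 0.
Proof. by move=> [_ H]; have := H 0 0 (lexx _); rewrite scaler0 mul0r. Qed.

Lemma sublinearN p x : sublinear p -> - p (- x) <= p x.
Proof.
move=> sp; have [spD _] := sp.
by have := spD x (- x); rewrite subrr (sublinear0 sp) -subr_ge0; lra.
Qed.

(** The choice t = 0 shows that it lies below [q], the choice t = 1 that its value at [- y] is at
    most [- q y]; passing to it makes [q] strictly smaller somewhere unless [q] is already additive
    along [y]. *)
Definition support_along (q : E -> R) (y x : E) : R :=
  inf [set q (x + t *: y) - t * q y | t in [set t | 0 <= t]].

Lemma support_along_has_inf q y x : sublinear q ->
  has_inf [set q (x + t *: y) - t * q y | t in [set t | 0 <= t]].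
Proof.
move=> sq; split; first by exists (q (x + 0 *: y) - 0 * q y); exists 0 => /=.
exists (- q (- x)) => _ [t /= t0 <-].
have := sq.1 (x + t *: y) (- x); rewrite addrAC subrr add0r sq.2//.
by lra.
Qed.

Lemma support_along_le q y x t : sublinear q -> 0 <= t ->
  support_along q y x <= q (x + t *: y) - t * q y.
Proof.
move=> sq t0; apply: ge_inf; first by have [] := support_along_has_inf y x sq.
by exists t.
Qed.

Lemma le_support_along q y x c : sublinear q ->
  (forall t, 0 <= t -> c <= q (x + t *: y) - t * q y) -> c <= support_along q y x.
Proof.
move=> sq H; apply: lb_le_inf; first by have [] := support_along_has_inf y x sq.
by move=> _ [t /= t0 <-]; exact: H.
Qed.

Lemma support_alongD q y x x' : sublinear q ->
  support_along q y (x + x') <= support_along q y x + support_along q y x'.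
Proof.
move=> sq; rewrite -lerBlDl; apply: le_support_along => // t t0.
rewrite lerBlDl -lerBlDr; apply: le_support_along => // s s0; rewrite lerBlDr.
have st0 : 0 <= s + t by rewrite addr_ge0.
apply: (le_trans (support_along_le y (x + x') sq st0)).
have := sq.1 (x + s *: y) (x' + t *: y).
by rewrite addrACA -scalerDl mulrDl; lra.
Qed.

Lemma support_alongZ_le q y a x : sublinear q -> 0 < a ->
  support_along q y (a *: x) <= a * support_along q y x.
Proof.
move=> sq a0; rewrite -ler_pdivrMl//; apply: le_support_along => // t t0.
rewrite ler_pdivrMl//.
have at0 : 0 <= a * t by rewrite mulr_ge0// ltW.
apply: (le_trans (support_along_le y (a *: x) sq at0)).
by rewrite -scalerA -scalerDr (sq.2 _ _ (ltW a0)) -mulrA -mulrBr.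
Qed.

Lemma sublinear_support_along q y : sublinear q -> sublinear (support_along q y).
Proof.
move=> sq; split=> [x x'|a x]; first exact: support_alongD.
rewrite le_eqVlt => /predU1P[<-|a0].
  rewrite mul0r scale0r; apply/eqP; rewrite eq_le; apply/andP; split.
    by have := support_along_le y 0 sq (lexx 0);
      rewrite scale0r addr0 mul0r subr0 (sublinear0 sq).
  apply: le_support_along => // t t0.
  by rewrite add0r sq.2// subrr.
apply/eqP; rewrite eq_le support_alongZ_le//=.
have a'0 : 0 < a^-1 by rewrite invr_gt0.
have := support_alongZ_le y (a *: x) sq a'0.
by rewrite scalerA mulVf ?gt_eqF// scale1r ler_pdivlMl.
Qed.

Lemma support_along_le_self q y x : sublinear q -> support_along q y x <= q x.
Proof.
move=> sq; have := support_along_le y x sq (lexx 0).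
by rewrite scale0r addr0 mul0r subr0.
Qed.

Lemma support_along_opp q y : sublinear q -> support_along q y (- y) <= - q y.
Proof.
move=> sq; have := support_along_le y (- y) sq ler01.
by rewrite scale1r addNr (sublinear0 sq) mul1r sub0r.
Qed.

(* Minimality forces [q] to equal each of its minorants [support_along q y], and
   this equality is additivity of [q] in the direction [y]. *)
Lemma minimal_sublinear_linear q : sublinear q ->
  (forall r, sublinear r -> (forall x, r x <= q x) -> r = q) ->
  linear (q : E -> R^o).
Proof.
move=> sq qmin.
have sE y : support_along q y = q.
  apply: qmin; first exact: sublinear_support_along.
  by move=> x; exact: support_along_le_self.
have qD x y : q (x + y) = q x + q y.
  apply/eqP; rewrite eq_le sq.1/=.
  have := support_along_le y x sq ler01.
  by rewrite sE scale1r mul1r; lra.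
have qN x : q (- x) = - q x.
  by apply/eqP; rewrite -addr_eq0 -qD addNr (sublinear0 sq).
move=> a x y; rewrite qD; congr (_ + _).
have [a0|a0] := leP 0 a; first exact: sq.2.
have := sq.2 (- a) x; rewrite oppr_ge0 => /(_ (ltW a0)).
by rewrite scaleNr qN mulNr => /oppr_inj.
Qed.

(** Zorn's lemma for the reversed pointwise order. A chain is bounded by its pointwise infimum,
    which is finite because every member is at least [- p (- x)] at [x]. *)
Lemma minimal_sublinear_exists p : sublinear p ->
  exists q, [/\ sublinear q, (forall x, q x <= p x) &
  (forall r, sublinear r -> (forall x, r x <= q x) -> r = q)].
Proof.
move=> sp.
pose T := {q : E -> R | sublinear q /\ (forall x, q x <= p x)}.
pose Rel : rel T := fun q r => `[< forall x, sval r x <= sval q x >].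
have svalI (q r : T) : sval q = sval r -> q = r.
  by case: q r => [q Hq] [r Hr] /= ?; exact: eq_exist.
have [||||[q [sq qp]] /= qmin] := @Zorn T Rel.
- by move=> t; apply/asboolP.
- move=> r s t /asboolP rs /asboolP st; apply/asboolP => x.
  exact: le_trans (st x) (rs x).
- move=> s t /asboolP st /asboolP ts; apply: svalI; apply/funext => x.
  by apply/eqP; rewrite eq_le ts st.
- move=> A Atot.
  have [[a0 Aa0]|A0] := pselect (A !=set0); last first.
    by exists (exist _ p (conj sp (fun x => lexx _))) => s As; exfalso; apply: A0; exists s.
  pose S x := [set sval s x | s in A].
  have Sinf x : has_inf (S x).
    split; first by exists (sval a0 x); exists a0.
    exists (- p (- x)) => _ [[s [ss sle]] As <-] /=.
    by apply: (le_trans _ (sublinearN x ss)); rewrite lerN2.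
  have Sle x s : A s -> inf (S x) <= sval s x.
    by move=> As; apply: ge_inf; [have [] := Sinf x|exists s].
  have leS x c : (forall s, A s -> c <= sval s x) -> c <= inf (S x).
    move=> H; apply: lb_le_inf; first by have [] := Sinf x.
    by move=> _ [s As <-]; exact: H.
  (* Subadditivity needs the chain: of two members used at [x] and at [y], the smaller one can serve
     at both points. *)
  have sS : sublinear (fun x => inf (S x)).
    split=> [x y|a x a_ge0].
      rewrite -lerBlDl; apply: (leS) => s As.
      rewrite lerBlDl -lerBlDr; apply: leS => t At; rewrite lerBlDr.
      have [/asboolP st|/asboolP ts] := Atot _ _ As At.
        apply: (le_trans (Sle _ _ At)).
        by apply: (le_trans ((svalP t).1.1 x y)); rewrite lerD// st.
      apply: (le_trans (Sle _ _ As)).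
      by apply: (le_trans ((svalP s).1.1 x y)); rewrite lerD// ts.
    have [->|an0] := eqVneq a 0.
      rewrite scale0r mul0r; apply/eqP; rewrite eq_le; apply/andP; split.
        by apply: (le_trans (Sle _ _ Aa0)); rewrite (sublinear0 (svalP a0).1).
      by apply: (leS) => s As; rewrite (sublinear0 (svalP s).1).
    have a_gt0 : 0 < a by rewrite lt_neqAle eq_sym an0.
    apply/eqP; rewrite eq_le; apply/andP; split.
      rewrite -ler_pdivrMl//; apply: (leS) => s As.
      by rewrite ler_pdivrMl// -(svalP s).1.2//; exact: Sle.
    apply: (leS) => s As; rewrite (svalP s).1.2//.
    by rewrite ler_wpM2l//; exact: Sle.
  have Sp x : inf (S x) <= p x.
    by apply: (le_trans (Sle x _ Aa0)); exact: (svalP a0).2.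
  exists (exist _ (fun x => inf (S x)) (conj sS Sp)) => s As.
  by apply/asboolP => x /=; exact: Sle.
exists q; split => // r sr rq.
have rp x : r x <= p x by exact: le_trans (rq x) (qp x).
have := qmin (exist _ r (conj sr rp)).
by move=> /(_ _)/(congr1 sval) /= -> //; apply/asboolP.
Qed.

(** The minimal functional is taken below [support_along p x0] rather than below [p]: its value at
    [- x0] is then at most [- p x0], and linearity turns this into attainment at [x0]. *)
Lemma hahn_banach_sublinear p x0 : sublinear p ->
  exists f : E -> R^o, [/\ linear f, (forall x, f x <= p x) & f x0 = p x0].
Proof.
move=> sp.
have [q [sq qp qmin]] := minimal_sublinear_exists (sublinear_support_along x0 sp).
have lq := minimal_sublinear_linear sq qmin.
have qlep x : q x <= p x.
  by apply: (le_trans (qp x)); exact: support_along_le_self.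
exists q; split => //; apply/eqP; rewrite eq_le qlep/=.
have := le_trans (qp (- x0)) (support_along_opp x0 sp).
have := lq (-1) x0 0; rewrite (sublinear0 sq) !addr0 !scaleN1r => ->.
by rewrite lerN2.
Qed.

End HahnBanach.

(** * Norms of finite sequences in a symmetric basis *)

Section SeqNorm.
Context {R : realType} {X : normedModType R} (e : symmetric_basis X).

Definition fnorm (n : nat) (a : nat -> R) : R := `|\sum_(k < n) a k *: e k|.

Lemma eq_fnorm n a b : (forall k, (k < n)%N -> a k = b k) -> fnorm n a = fnorm n b.
Proof. by move=> ab; congr `|_|; apply: eq_bigr => k _; rewrite ab. Qed.

Lemma fnorm_sign n a (s : nat -> bool) : fnorm n (fun k => (-1) ^+ s k * a k) = fnorm n a.
Proof. by apply: (@basis_symmetric _ _ e n a s id); exists id. Qed.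

(** The new vector is a convex combination of the old one and of the old one with the sign of its
    j-th coefficient flipped, and the flip preserves the norm. *)
Lemma fnorm_update n b j x : (j < n)%N -> `|x| <= `|b j| ->
  fnorm n (fun k => if k == j then x else b k) <= fnorm n b.
Proof.
move=> jn xb.
have [b0|b0] := eqVneq (b j) 0.
  have x0 : x = 0 by apply/eqP; rewrite -normr_le0 (le_trans xb)// b0 normr0.
  rewrite le_eqVlt; apply/orP; left; apply/eqP/eq_fnorm => k _.
  by case: eqP => // ->; rewrite x0 b0.
pose l := (1 + x / b j) / 2.
have /andP[xb1 xb2] : -1 <= x / b j <= 1.
  by rewrite -ler_norml normrM normfV ler_pdivrMr ?normr_gt0// mul1r.
have l0 : 0 <= l by rewrite /l; lra.
have l1 : 0 <= 1 - l by rewrite /l; lra.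
have lE : x = l * b j - (1 - l) * b j.
  rewrite -mulrBl (_ : l - (1 - l) = x / b j) ?mulfVK//.
  by rewrite /l; lra.
clearbody l.
have -> : fnorm n (fun k => if k == j then x else b k) =
  `|l *: (\sum_(k < n) b k *: e k) +
    (1 - l) *: (\sum_(k < n) ((-1) ^+ (k == j :> nat) * b k) *: e k)|.
  rewrite !scaler_sumr -big_split/=; congr `|_|; apply: eq_bigr => k _.
  rewrite !scalerA -scalerDl; case: eqP => [->|_].
    by rewrite {1}lE expr1 mulN1r mulrN.
  by rewrite expr0 mul1r -mulrDl addrC subrK mul1r.
apply: (le_trans (ler_normD _ _)).
have := fnorm_sign n b (fun k => k == j); rewrite /fnorm !normrZ => ->.
by rewrite (ger0_norm l0) (ger0_norm l1) -mulrDl addrC subrK mul1r.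
Qed.

Lemma ler_fnorm n a b : (forall k, (k < n)%N -> `|a k| <= `|b k|) ->
  fnorm n a <= fnorm n b.
Proof.
move=> ab.
suff H m : (m <= n)%N -> fnorm n (fun k => if (k < m)%N then a k else b k) <= fnorm n b.
  apply: le_trans (H n (leqnn n)); rewrite le_eqVlt; apply/orP; left; apply/eqP.
  by apply: eq_fnorm => k ->.
elim: m => [_|m IH mn]; first by [].
apply: le_trans (IH (ltnW mn)).
have -> : fnorm n (fun k => if (k < m.+1)%N then a k else b k) =
  fnorm n (fun k => if k == m then a m else (if (k < m)%N then a k else b k)).
  apply: eq_fnorm => k _; rewrite ltnS leq_eqVlt.
  by case: eqP => // ->.
by apply: fnorm_update => //; rewrite ltnn ab.
Qed.

Lemma fnorm_widen n m a : (n <= m)%N -> (forall k, (n <= k)%N -> a k = 0) ->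
  fnorm m a = fnorm n a.
Proof.
move=> nm a0; congr `|_|.
rewrite -(big_mkord xpredT (fun k => a k *: e k)) (big_cat_nat (n := n))//=.
rewrite big_mkord [X in _ + X]big_nat_cond [X in _ + X]big1 ?addr0//.
by move=> k /andP[/andP[nk _] _]; rewrite a0// scale0r.
Qed.

Lemma fnormD n a b : fnorm n (fun k => a k + b k) <= fnorm n a + fnorm n b.
Proof.
apply: le_trans (ler_normD _ _); rewrite -big_split/= le_eqVlt; apply/orP; left.
by apply/eqP; congr `|_|; apply: eq_bigr => k _; rewrite scalerDl.
Qed.

Lemma fnormZ n a c : fnorm n (fun k => c * a k) = `|c| * fnorm n a.
Proof.
rewrite -normrZ scaler_sumr; congr `|_|; apply: eq_bigr => k _.
by rewrite scalerA.
Qed.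

(* Finite lists of coefficients instead of functions on an index set: by symmetry
   only the multiset of entries matters, so increments over intervals may be
   listed in any order. *)
Definition snorm (s : seq R) : R := fnorm (size s) (nth 0 s).

Lemma snorm_ge0 s : 0 <= snorm s. Proof. exact: normr_ge0. Qed.

Lemma snorm_nil : snorm [::] = 0.
Proof. by rewrite /snorm /fnorm big_ord0 normr0. Qed.

Lemma snorm_mkseq a n : snorm (mkseq a n) = fnorm n a.
Proof.
by rewrite /snorm size_mkseq; apply: eq_fnorm => k kn; rewrite nth_mkseq.
Qed.

Lemma snorm_perm s t : perm_eq s t -> snorm s = snorm t.
Proof.
move=> st; have /(perm_iotaP 0)[Is pIs sE] := st.
have sz : size s = size t by exact: perm_size.
have szI : size Is = size t by rewrite (perm_size pIs) size_iota.
have uI : uniq Is by rewrite (perm_uniq pIs) iota_uniq.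
have memI i : (i \in Is) = (i < size t)%N by rewrite (perm_mem pIs) mem_iota.
(* [one_symmetric] asks for a bijection of all natural numbers, so the permutation of the positions
   is extended by the identity. *)
pose p i := if (i < size t)%N then nth 0%N Is i else i.
pose q i := if (i < size t)%N then index i Is else i.
have pq : bijective p.
  exists q => i; rewrite /p /q.
    have [it|it] := ltnP i (size t); last by rewrite ltnNge it.
    by rewrite -memI mem_nth ?szI// index_uniq// szI.
  have [it|it] := ltnP i (size t); last by rewrite ltnNge it.
  by rewrite -{1}szI index_mem memI it nth_index// memI.
have := @basis_symmetric _ _ e (size t) (nth 0 s) (fun=> false) p pq.
rewrite /snorm /fnorm sz => <-; congr `|_|.
under eq_bigr => k _ do rewrite expr0 mul1r.
have -> : \sum_(k < size t) t`_k *: e k = \sum_(k <- Is) t`_k *: e k.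
  by rewrite (perm_big _ pIs)/= -(big_mkord xpredT (fun k => t`_k *: e k)) /index_iota subn0.
rewrite (big_nth 0%N) szI big_mkord; apply: eq_bigr => k _.
by rewrite /p ltn_ord sE (nth_map 0%N)// szI.
Qed.

Lemma snorm_cat0 s n : snorm (s ++ nseq n 0) = snorm s.
Proof.
rewrite /snorm size_cat (@fnorm_widen (size s))//.
- by apply: eq_fnorm => k ks; rewrite nth_cat ks.
- exact: leq_addr.
- move=> k sk; rewrite nth_cat ltnNge sk/=.
  by rewrite nth_nseq; case: ifP.
Qed.

Lemma snorm_catl s t : snorm s <= snorm (s ++ t).
Proof.
rewrite -(snorm_cat0 s (size t)) /snorm !size_cat size_nseq.
apply: ler_fnorm => k _; rewrite !nth_cat; case: ifP => // _.
by rewrite nth_nseq; case: ifP; rewrite normr0 normr_ge0.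
Qed.

Lemma snorm_subseq s t : subseq s t -> snorm s <= snorm t.
Proof. by case/perm_to_subseq => r /snorm_perm ->; exact: snorm_catl. Qed.

Lemma snorm_map_le (T : eqType) (l : seq T) f g :
  (forall x, x \in l -> `|f x| <= `|g x|) ->
  snorm (map f l) <= snorm (map g l).
Proof.
case: l => [|x0 l] fg; first by [].
rewrite /snorm !size_map; apply: ler_fnorm => k kl.
by rewrite !(nth_map x0)// fg// mem_nth.
Qed.

Lemma snorm_mapD (T : Type) (l : seq T) f g :
  snorm (map (fun x => f x + g x) l) <= snorm (map f l) + snorm (map g l).
Proof.
case: l => [|x0 l]; first by rewrite snorm_nil addr0.
rewrite /snorm !size_map; apply: le_trans (fnormD _ _ _).
rewrite le_eqVlt; apply/orP; left; apply/eqP; apply: eq_fnorm => k kl.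
by rewrite !(nth_map x0).
Qed.

Lemma snorm_mapZ (T : Type) (l : seq T) c f :
  snorm (map (fun x => c * f x) l) = `|c| * snorm (map f l).
Proof.
case: l => [|x0 l]; first by rewrite snorm_nil mulr0.
rewrite /snorm !size_map -fnormZ; apply: eq_fnorm => k kl.
by rewrite !(nth_map x0).
Qed.

Lemma snorm_mapN (T : Type) (l : seq T) f :
  snorm (map (fun x => - f x) l) = snorm (map f l).
Proof.
rewrite -[RHS]mul1r -[in RHS](normr1 R) -normrN -snorm_mapZ.
by congr snorm; apply: eq_map => x; rewrite mulN1r.
Qed.

Lemma snorm_mapB (T : Type) (l : seq T) f g :
  snorm (map (fun x => f x - g x) l) <= snorm (map f l) + snorm (map g l).
Proof. by rewrite -(snorm_mapN l g); exact: snorm_mapD. Qed.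

Lemma snorm_uniq_sub (T : eqType) (g : T -> R) (s u : seq T) :
  uniq s -> {subset s <= u} -> snorm (map g s) <= snorm (map g u).
Proof.
move=> us su.
have /(perm_map g)/snorm_perm -> : perm_eq s (seq.filter (mem s) (undup u)).
  apply: uniq_perm => //; first by rewrite filter_uniq// undup_uniq.
  move=> x; rewrite mem_filter/= mem_undup.
  by case xs: (x \in s) => //=; rewrite (su _ xs).
apply/snorm_subseq/map_subseq/(subseq_trans _ (undup_subseq u)).
exact: seq.filter_subseq.
Qed.

Lemma snorm_map_filter (T : eqType) (P : pred T) (g : T -> R) (s : seq T) :
  (forall x, x \in s -> ~~ P x -> g x = 0) ->
  snorm (map g (seq.filter P s)) = snorm (map g s).
Proof.
move=> g0; have /(perm_map g)/snorm_perm <- : perm_eq (seq.filter P s ++ seq.filter (predC P) s) s.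
  by rewrite perm_filterC.
rewrite map_cat; rewrite (_ : map g (seq.filter (predC P) s) = nseq (size (seq.filter (predC P) s)) 0).
  by rewrite snorm_cat0.
rewrite -(size_map g); apply/all_pred1P/allP => y /mapP[x].
by rewrite mem_filter => /andP[Px xs] ->; apply/eqP/g0.
Qed.

Lemma basis_neq0 : e 0%N != 0.
Proof.
apply/eqP => e0.
have := @Defs.basis_free _ _ e 1 (fun=> 1); rewrite big_ord1 e0 scaler0 => /(_ erefl 0%N isT).
by apply/eqP; exact: oner_neq0.
Qed.

Lemma basis_norm_gt0 : 0 < `|e 0%N|. Proof. by rewrite normr_gt0 basis_neq0. Qed.

Lemma snorm1 x : snorm [:: x] = `|x| * `|e 0%N|.
Proof. by rewrite /snorm /fnorm big_ord1/= normrZ. Qed.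

Lemma snorm_basis k : `|e k| = `|e 0%N|.
Proof.
have := snorm1 1; rewrite normr1 mul1r => <-.
rewrite -(snorm_cat0 [:: 1] k) cat1s.
have /snorm_perm <- : perm_eq (rcons (nseq k (0 : R)) 1) (1 :: nseq k 0) by rewrite perm_rcons.
rewrite /snorm size_rcons size_nseq /fnorm big_ord_recr/= big1 ?add0r.
  by rewrite nth_rcons size_nseq ltnn eqxx scale1r.
move=> i _; rewrite nth_rcons size_nseq ltn_ord nth_nseq.
by case: ifP; rewrite scale0r.
Qed.

Lemma fnorm_coord n a k : (k < n)%N -> `|a k| * `|e 0%N| <= fnorm n a.
Proof.
move=> kn; rewrite -snorm1 -snorm_mkseq; apply: snorm_subseq.
by rewrite sub1seq; apply/mapP; exists k; rewrite ?mem_iota.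
Qed.

Lemma snorm_le_sum s : snorm s <= (\sum_(x <- s) `|x|) * `|e 0%N|.
Proof.
rewrite mulr_suml (big_nth 0) big_mkord; apply: (le_trans (ler_norm_sum _ _ _)).
by apply: ler_sum => k _; rewrite normrZ snorm_basis.
Qed.

Lemma snorm_cat s t : snorm (s ++ t) <= snorm s + snorm t.
Proof.
(* Tags separate the entries of [s] from those of [t]: the concatenation becomes a sum of two
   vectors over one index list, each of them one of the lists padded by zeros. *)
pose l := [seq (x, true) | x <- s] ++ [seq (x, false) | x <- t].
pose f (p : R * bool) := if p.2 then p.1 else 0.
pose g (p : R * bool) := if p.2 then 0 else p.1.
have E : s ++ t = map (fun p => f p + g p) l.
  rewrite map_cat -!map_comp.
  rewrite [X in _ = X ++ _](_ : _ = s); last first.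
    by rewrite -[RHS]map_id; apply: eq_map => x; rewrite /= addr0.
  by rewrite [X in _ = _ ++ X](_ : _ = t)// -[RHS]map_id; apply: eq_map => x; rewrite /= add0r.
rewrite E; apply: (le_trans (snorm_mapD _ _ _)).
have sz (u : seq R) : [seq 0 | x <- u] = nseq (size u) (0 : R).
  by elim: u => //= x u ->.
apply: lerD.
  rewrite map_cat -!map_comp (_ : map (f \o _) t = nseq (size t) 0); last exact: sz.
  by rewrite snorm_cat0 (_ : map _ s = s)// -[RHS]map_id; apply: eq_map.
rewrite map_cat -!map_comp.
rewrite (_ : map (g \o _) s = nseq (size s) 0); last exact: sz.
have /snorm_perm -> : perm_eq (nseq (size s) 0 ++ [seq (g \o pair^~ false) i | i <- t])
   ([seq (g \o pair^~ false) i | i <- t] ++ nseq (size s) 0) by rewrite perm_catC.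
by rewrite snorm_cat0 (_ : map _ t = t)// -[RHS]map_id; apply: eq_map.
Qed.

End SeqNorm.

(** * Dual spaces: norming functionals and ultrafilter limits in the bidual *)

Section DualBasics.
Context {R : realType}.
Implicit Types E F : normedModType R.

Lemma dualD E (f : dual E) x y : f (x + y) = f x + f y.
Proof. by have := dual_linear f 1 x y; rewrite !scale1r. Qed.

Lemma dual0 E (f : dual E) : f 0 = 0.
Proof. by have := dualZ f 0 0; rewrite scaler0 mul0r. Qed.

Lemma dualN E (f : dual E) x : f (- x) = - f x.
Proof. by rewrite -scaleN1r dualZ mulN1r. Qed.

Lemma dualB E (f : dual E) x y : f (x - y) = f x - f y.
Proof. by rewrite dualD dualN. Qed.

Lemma dual_sum E (f : dual E) (I : Type) (r : seq I) (P : pred I) (x : I -> E) :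
  f (\sum_(i <- r | P i) x i) = \sum_(i <- r | P i) f (x i).
Proof.
elim/big_rec2: _ => [|i a b _ <-]; first exact: dual0.
by rewrite dualD.
Qed.

Lemma dual_norm_le E (f : dual E) x : `|f x| <= `|f| * `|x|.
Proof.
have [->|x0] := eqVneq x 0; first by rewrite dual0 !normr0 mulr0.
have nx : 0 < `|x| by rewrite normr_gt0.
rewrite -ler_pdivrMr// -[`|x|]normr_id -normfV -normrM mulrC -dualZ.
by apply: opnorm_ub; rewrite normrZ normfV normr_id mulVf// gt_eqF.
Qed.

Lemma le_dual_norm E (f : dual E) C : 0 <= C ->
  (forall x, `|f x| <= C * `|x|) -> `|f| <= C.
Proof.
move=> C0 H; apply: opnorm_le => x x1; apply: (le_trans (H x)).
by rewrite ler_piMr.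
Qed.

Lemma bounded_linear_dual E (f : E -> R^o) C : linear f ->
  (forall x, `|f x| <= C * `|x|) -> f \in @continuous_functional R E.
Proof.
move=> lf fC; rewrite inE; split => //.
pose lf' := GRing.isLinear.Build R E R^o *:%R f lf.
pose F : {linear E -> R^o} := HB.pack f lf'.
apply: (@bounded_linear_continuous _ _ _ F); apply/linear_boundedP.
exists C; split; first exact: num_real.
by move=> r /ltW Cr x; apply: (le_trans (fC x)); rewrite ler_wpM2r.
Qed.

Lemma dual_ext E (f g : dual E) : (forall x, f x = g x) -> f = g.
Proof. by move=> fg; apply/val_inj/funext => x; exact: fg. Qed.

Lemma dual_addE E (f g : dual E) x : (f + g) x = f x + g x. Proof. by []. Qed.
Lemma dual_scaleE E a (f : dual E) x : (a *: f) x = a * f x. Proof. by []. Qed.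

Lemma dual_sumE E (I : Type) (r : seq I) (P : pred I) (f : I -> dual E) x :
  (\sum_(i <- r | P i) f i) x = \sum_(i <- r | P i) f i x.
Proof. by elim/big_rec2: _ => [|i a b _ <-]. Qed.

Lemma sublinear_functional E (p : E -> R) x0 C : sublinear p ->
  (forall x, p x <= C * `|x|) ->
  exists f : dual E, (forall x, f x <= p x) /\ f x0 = p x0.
Proof.
move=> sp pC; have [f [lf fp fx0]] := hahn_banach_sublinear x0 sp.
have fN x : f (- x) = - f x.
  have f0 : f 0 = 0 by have := lf (-1) 0 0; rewrite scaleN1r oppr0 addr0 scaleN1r addNr.
  by have := lf (-1) x 0; rewrite f0 !addr0 !scaleN1r.
have fC x : `|f x| <= C * `|x|.
  rewrite ler_norml (le_trans (fp x) (pC x)) andbT lerNl -fN -(normrN x).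
  exact: le_trans (fp _) (pC _).
by exists (Dual (bounded_linear_dual lf fC)).
Qed.

Lemma norming_functional E (x0 : E) : exists f : dual E, `|f| <= 1 /\ f x0 = `|x0|.
Proof.
have sp : sublinear (fun x : E => `|x|).
  by split=> [x y|a x a0]; [exact: ler_normD|rewrite normrZ ger0_norm].
have [|f [fp fx]] := @sublinear_functional E _ x0 1 sp; first by move=> x; rewrite mul1r.
exists f; split => //; apply: le_dual_norm => // x.
by rewrite mul1r ler_norml fp andbT lerNl -dualN (le_trans (fp _))// normrN.
Qed.

Lemma ultra_bounded_cvg (I : Type) (U : set_system I) (f : I -> R) (M : R) :
  UltraFilter U -> (forall i, `|f i| <= M) -> exists l : R, f i @[i --> U] --> l.
Proof.
move=> UU fM; have PU : ProperFilter U by exact: ultra_proper.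
have /(_ (f @ U) _) : compact `[- M, M] by exact: segment_compact.
move=> [|l [_ lcl]].
- rewrite /fmap /=; apply: (@filterE _ U) => i.
  by rewrite /preimage /= in_itv/= -ler_norml.
exists l => V nV.
have [//|] := in_ultra_setVsetC (f @^-1` V) UU => UV.
have [x []] := lcl (~` V) V UV nV.
by [].
Qed.

(** The values of a functional on the family stay in a compact interval, hence converge along [U];
    linearity and the bound pass to the limit. This is Banach-Alaoglu in the form needed, both for X
    and for V^0. *)
Lemma ultra_bidual E (I : Type) (U : set_system I) (y : I -> E) (M : R) :
  UltraFilter U -> (forall i, `|y i| <= M) ->
  exists Phi : dual (dual E), `|Phi| <= M /\
    forall psi : dual E, psi (y i) @[i --> U] --> Phi psi.
Proof.
move=> UU yM; have PU : ProperFilter U by exact: ultra_proper.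
have [i0 _] := filter_ex (@filterT _ U _).
have M0 : 0 <= M by exact: le_trans (yM i0).
have bnd (psi : dual E) i : `|psi (y i)| <= M * `|psi|.
  by rewrite mulrC (le_trans (dual_norm_le _ _))// ler_wpM2l.
have /choice[L HL] : forall psi : dual E, exists l : R, psi (y i) @[i --> U] --> l.
  by move=> psi; exact: ultra_bounded_cvg (bnd psi).
have linL : linear (L : dual E -> R^o).
  move=> a f g; apply: (@cvg_unique _ (@Rhausdorff R) (( (a *: f + g) (y i) : R)@[i --> U])).
    exact: HL.
  by apply: cvgD; [apply: cvgZr; exact: HL|exact: HL].
have boundL (psi : dual E) : `|L psi| <= M * `|psi|.
  apply: (cvgr_to_le (cvg_norm (HL psi))).
  by apply: nearW => i; exact: bnd.
exists (Dual (bounded_linear_dual linL boundL)); split; last by [].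
exact: le_dual_norm.
Qed.

End DualBasics.

(** * Coordinates, weak limits and bounded completeness in X *)

Section Coordinates.
Context {R : realType} {X : normedModType R} (e : symmetric_basis X).

Definition bcoord (x : X) : nat -> R := sval (cid (basis_schauder e x)).

Definition psum (a : nat -> R) (n : nat) : X := \sum_(k < n) a k *: e k.

Lemma psumE a : psum a = series (fun k => a k *: e k).
Proof. by apply/funext => n; rewrite /psum /series/= big_mkord. Qed.

Lemma bcoord_cvg x : psum (bcoord x) @ \oo --> x.
Proof. by rewrite psumE; have [] := svalP (cid (basis_schauder e x)). Qed.

Lemma bcoord_unique x a : psum a @ \oo --> x -> bcoord x = a.
Proof. by rewrite psumE => ax; have [_] := svalP (cid (basis_schauder e x)); apply. Qed.

Lemma bcoord_linear a x y k : bcoord (a *: x + y) k = a * bcoord x k + bcoord y k.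
Proof.
rewrite (@bcoord_unique (a *: x + y) (fun k => a * bcoord x k + bcoord y k))//.
have -> : psum (fun k => a * bcoord x k + bcoord y k) =
    (fun n => a *: psum (bcoord x) n + psum (bcoord y) n).
  apply/funext => n; rewrite /psum scaler_sumr -big_split/=.
  by apply: eq_bigr => i _; rewrite scalerDl scalerA.
by apply: cvgD; [apply: cvgZr; exact: bcoord_cvg|exact: bcoord_cvg].
Qed.

(** Symmetry of the basis makes a single term dominated in norm by every partial sum containing it,
    so the coordinates are continuous without the open mapping theorem. *)
Lemma bcoord_bound x k : `|bcoord x k| * `|e 0%N| <= `|x|.
Proof.
apply: (cvgr_to_ge (cvg_norm (@bcoord_cvg x))); near=> n.
apply: (fnorm_coord e (bcoord x)); near: n; exact: nbhs_infty_gt.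
Unshelve. all: by end_near. Qed.

Lemma bcoord_functional_subproof k :
  (fun x => bcoord x k : R^o) \in @continuous_functional R X.
Proof.
apply: (@bounded_linear_dual _ _ _ (`|e 0%N|^-1)).
  by move=> a x y; exact: bcoord_linear.
move=> x; have := bcoord_bound x k.
by rewrite ler_pdivlMl ?basis_norm_gt0// mulrC.
Qed.

Definition bcoord_functional k : dual X := Dual (bcoord_functional_subproof k).

Lemma bcoord_psum a n k : bcoord (psum a n) k = if (k < n)%N then a k else 0.
Proof.
rewrite (@bcoord_unique _ (fun k => if (k < n)%N then a k else 0))//.
apply: cvg_near_cst; near=> m.
have nm : (n <= m)%N by near: m; exact: nbhs_infty_ge.
rewrite /psum -(big_mkord xpredT (fun k => (if (k < n)%N then a k else 0) *: e k)).
rewrite (big_cat_nat (n := n))//=.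
rewrite [X in _ + X]big_nat_cond [X in _ + X]big1 ?addr0; last first.
  by move=> j /andP[/andP[nj _] _]; rewrite ltnNge nj scale0r.
by rewrite big_mkord; apply: eq_bigr => i _; rewrite ltn_ord.
Unshelve. all: by end_near. Qed.

Lemma bcoord_eq0 x : (forall k, bcoord x k = 0) -> x = 0.
Proof.
move=> x0; have := @bcoord_cvg x.
have -> : psum (bcoord x) = cst 0.
  by apply/funext => n; rewrite /psum big1// => i _; rewrite x0 scale0r.
move=> c0; apply: (norm_cvg_unique c0); exact: cvg_cst.
Qed.

Hypothesis HX : reflexive_space X.

Lemma reflexive_ultra (I : Type) (U : set_system I) (y : I -> X) (M : R) :
  UltraFilter U -> (forall i, `|y i| <= M) ->
  exists x, forall psi : dual X, psi (y i) @[i --> U] --> psi x.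
Proof.
move=> UU yM; have [Phi [_ HPhi]] := ultra_bidual UU yM.
by have [x Hx] := HX Phi; exists x => psi; rewrite -Hx.
Qed.

(** Serves to prove convergence of a sequence by contradiction: the ultrafilter sits on the bad
    indices, still refines [\oo], and limits of bounded quantities along it exist. *)
Lemma not_near_infty_frequently (P : nat -> Prop) : ~ (\forall n \near \oo, P n) ->
  exists U : set_system nat, [/\ UltraFilter U, U [set n | ~ P n] &
    forall A, (\forall n \near \oo, A n) -> U A].
Proof.
move=> nP.
have PF : ProperFilter (within [set n | ~ P n] \oo).
  apply: Build_ProperFilter_ex => A; rewrite /within /= => nA.
  apply: contrapT => /forallNP AN; apply: nP.
  near=> n; apply: contrapT => Pn; apply: (AN n).
  by move: Pn; near: n.
have [U [UU FU]] := ultraFilterLemma PF.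
exists U; split => //; first by apply: FU; rewrite /within /=; exact: nearW.
by move=> A nA; apply: FU; apply: filterS nA => n An _.
Unshelve. all: by end_near. Qed.

Lemma infty_ultrafilter : exists U : set_system nat, UltraFilter U /\
  forall A, (\forall n \near \oo, A n) -> U A.
Proof. by have [U [UU FU]] := ultraFilterLemma eventually_filter; exists U. Qed.

(** By reflexivity a weak limit exists along any ultrafilter; its coordinates are limits of
    coordinates, hence 0. *)
Lemma weakly_null (y : nat -> X) (M : R) (psi : dual X) : (forall n, `|y n| <= M) ->
  (forall k, bcoord (y n) k @[n --> \oo] --> (0 : R)) -> psi (y n) @[n --> \oo] --> (0 : R).
Proof.
move=> yM y0; apply/cvgrPdist_le => eps eps0.
apply: contrapT => /not_near_infty_frequently[U [UU Ubad Uoo]].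
have PU : ProperFilter U by exact: ultra_proper.
have [x Hx] := reflexive_ultra UU yM.
have x0 : x = 0.
  apply: bcoord_eq0 => k.
  have ck := Hx (bcoord_functional k).
  apply: (@cvg_unique _ (@Rhausdorff R) ((bcoord (y n) k : R)@[n --> U])); first exact: ck.
  by move=> V /(y0 k) nV; exact: Uoo.
have := Hx psi; rewrite x0 dual0 => /cvgrPdist_le/(_ _ eps0) Ugood.
by have [n []] := filter_ex (filterI Ubad Ugood).
Qed.

(** The partial sums have a weak limit along an ultrafilter. Its coordinates must be [a], so its own
    basis expansion, which converges in norm, is the given series. *)
Lemma boundedly_complete (a : nat -> R) (M : R) : (forall n, fnorm e n a <= M) ->
  exists x, bcoord x = a /\ psum a @ \oo --> x.
Proof.
move=> aM; have [U [UU Uoo]] := infty_ultrafilter.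
have PU : ProperFilter U by exact: ultra_proper.
have [x Hx] := reflexive_ultra (y := psum a) UU aM.
have cx : bcoord x = a.
  apply/funext => k; have ck := Hx (bcoord_functional k).
  apply: (@cvg_unique _ (@Rhausdorff R) ((bcoord (psum a n) k : R)@[n --> U])); first exact: ck.
  apply: cvg_near_cst; apply: Uoo; near=> n.
  rewrite bcoord_psum ifT//; near: n; exact: nbhs_infty_gt.
by exists x; split => //; rewrite -cx; exact: bcoord_cvg.
Unshelve. all: by end_near. Qed.

(** Otherwise the series of all basis vectors would converge, although its terms have constant
    nonzero norm. *)
Lemma fnorm_ones_unbounded (M : R) : exists n, M < fnorm e n (fun=> 1).
Proof.
apply: contrapT => /forallNP H.
have [|x [cx sx]] := @boundedly_complete (fun=> 1) M.
  by move=> n; rewrite leNgt; apply/negP; exact: H.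
have sx1 : [sequence psum (fun=> 1) n.+1]_n @ \oo --> x by rewrite cvg_shiftS.
have : psum (fun=> 1) n.+1 - psum (fun=> 1) n @[n --> \oo] --> x - x.
  by apply: (cvgB sx1 sx).
rewrite subrr => /cvgrPdist_lt/(_ _ (basis_norm_gt0 e)) [N _ /(_ N (leqnn N))] /=.
rewrite /psum big_ord_recr/= sub0r normrN addrAC subrr add0r scale1r.
by rewrite snorm_basis ltxx.
Qed.

End Coordinates.

(** * Growth of the fundamental function *)

Section Ones.
Context {R : realType} {X : normedModType R} (e : symmetric_basis X).

(** The fundamental function of the basis. *)
Definition ones (n : nat) : R := snorm e (nseq n 1).

Lemma ones_fnorm n : ones n = fnorm e n (fun=> 1).
Proof.
by rewrite /ones /snorm size_nseq; apply: eq_fnorm => k kn; rewrite nth_nseq kn.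
Qed.

Lemma ones_le m n : (m <= n)%N -> ones m <= ones n.
Proof.
by move=> mn; rewrite /ones -(subnKC mn) nseqD; exact: snorm_catl.
Qed.

Lemma onesD m n : ones (m + n) <= ones m + ones n.
Proof. by rewrite /ones nseqD; exact: snorm_cat. Qed.

Lemma fnorm_psum_le n x : fnorm e n (bcoord e x) <= `|x|.
Proof.
apply: (cvgr_to_ge (cvg_norm (@bcoord_cvg _ _ e x))); near=> m.
have nm : (n <= m)%N by near: m; exact: nbhs_infty_ge.
rewrite -/(fnorm e m (bcoord e x)) -!snorm_mkseq /mkseq -(subnKC nm) iotaD map_cat.
exact: snorm_catl.
Unshelve. all: by end_near. Qed.

Lemma fnorm_enum n (a : nat -> R) :
  fnorm e n a = snorm e [seq a (val i) | i <- enum 'I_n].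
Proof. by rewrite -snorm_mkseq /mkseq -val_enum_ord -map_comp. Qed.

Lemma fnorm_rotate n (a : nat -> R) (i : 'I_n.+1) :
  snorm e [seq a (val (i + k)) | k <- enum 'I_n.+1] = fnorm e n.+1 a.
Proof.
rewrite fnorm_enum.
rewrite (map_comp (fun k : 'I_n.+1 => a (val k)) (fun k => i + k)).
apply/snorm_perm/perm_map/uniq_perm; last 1 first.
- move=> k; rewrite mem_enum; apply/mapP; exists (k - i); first by rewrite mem_enum.
  by rewrite addrC subrK.
- by rewrite map_inj_uniq ?enum_uniq//; exact: addrI.
- exact: enum_uniq.
Qed.

(* Averaging [a] over all cyclic shifts gives the constant vector of the same sum. *)
Lemma sum_ones_le n (a : nat -> R) :
  `|\sum_(k < n.+1) a k| * ones n.+1 <= n.+1%:R * fnorm e n.+1 a.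
Proof.
set s := \sum_(k < n.+1) a k.
have -> : `|s| * ones n.+1 = `|\sum_(i < n.+1) \sum_(k < n.+1) a (val (i + k)) *: e k|.
  rewrite ones_fnorm -fnormZ /fnorm exchange_big/=; congr `|_|.
  apply: eq_bigr => k _; rewrite -scaler_suml mulr1; congr (_ *: _).
  by rewrite /s (reindex_inj (addIr k)).
apply: (le_trans (ler_norm_sum _ _ _)).
rewrite (eq_bigr (fun=> fnorm e n.+1 a)).
  by rewrite sumr_const card_ord mulr_natl.
move=> i _; rewrite -(fnorm_rotate a i).
rewrite /snorm size_map size_enum_ord /fnorm; congr `|_|; apply: eq_bigr => k _.
by rewrite (nth_map k) ?size_enum_ord// nth_ord_enum.
Qed.

Hypothesis HX : reflexive_space X.

(* Otherwise the sum of the coordinates would be a bounded functional with value 1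
   on every [e n], whereas [e n] tends weakly to 0 by reflexivity. *)
Lemma ones_not_linear (eps : R) : 0 < eps -> exists2 n, (0 < n)%N & ones n <= eps * n%:R.
Proof.
move=> eps0; apply: contrapT => H.
have one n : eps * n.+1%:R < ones n.+1.
  by rewrite ltNge; apply/negP => H1; apply: H; exists n.+1.
have sum_le n (a : nat -> R) : `|\sum_(k < n) a k| <= eps^-1 * fnorm e n a.
  case: n => [|n]; first by rewrite /fnorm !big_ord0 !normr0 mulr0.
  rewrite ler_pdivlMl// -(ler_pM2r (ltr0Sn R n)).
  rewrite [leRHS]mulrC; apply: le_trans (sum_ones_le n a).
  by rewrite mulrAC mulrC ler_wpM2l// ltW.
have [U [UU Uoo]] := infty_ultrafilter.
have PU : ProperFilter U by exact: ultra_proper.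
have bnd x n : `|\sum_(k < n) bcoord e x k| <= eps^-1 * `|x|.
  apply: (le_trans (sum_le _ _)); rewrite ler_wpM2l ?invr_ge0 ?(ltW eps0)//.
  exact: fnorm_psum_le.
have /choice[L HL] : forall x : X, exists l : R, \sum_(k < n) bcoord e x k @[n --> U] --> l.
  by move=> x; exact: ultra_bounded_cvg (bnd x).
have linL : linear (L : X -> R^o).
  move=> a x y; have Haxy : \sum_(k < n) bcoord e (a *: x + y) k @[n --> U] --> a * L x + L y.
    rewrite [X in X @ _](_ : _ = fun n => a * (\sum_(k < n) bcoord e x k) + \sum_(k < n) bcoord e y k).
      by apply: cvgD; [apply: cvgMr; exact: HL|exact: HL].
    apply/funext => n; under eq_bigr do rewrite bcoord_linear.
    by rewrite big_split/= -mulr_sumr.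
  exact: (cvg_unique (@Rhausdorff R) (HL _) Haxy).
have boundL x : `|L x| <= eps^-1 * `|x|.
  by apply: (cvgr_to_le (cvg_norm (HL x))); apply: nearW => n; exact: bnd.
pose psi : dual X := Dual (bounded_linear_dual linL boundL).
have ce n k : bcoord e (e n) k = (k == n)%:R.
  rewrite (@bcoord_unique _ _ _ _ (fun k => (k == n)%:R))//.
  apply: cvg_near_cst; near=> m.
  have nm : (n < m)%N by near: m; exact: nbhs_infty_gt.
  rewrite /psum (bigD1 (Ordinal nm))//= eqxx scale1r big1 ?addr0// => i.
  by rewrite -val_eqE/= => /negbTE ->; rewrite scale0r.
have : psi (e n) @[n --> \oo] --> (0 : R).
  apply: (@weakly_null _ _ e HX _ `|e 0%N|) => [n|k]; first by rewrite snorm_basis.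
  apply: cvg_near_cst; near=> n; rewrite ce.
  suff -> : (k == n) = false by [].
  by apply/negbTE; rewrite neq_ltn; apply/orP; left; near: n; exact: nbhs_infty_gt.
have psi1 n : psi (e n) = 1.
  apply: (@cvg_unique _ (@Rhausdorff R) ((\sum_(k < m) bcoord e (e n) k : R)@[m --> U])).
    exact: HL.
  apply: cvg_near_cst; apply: Uoo; near=> m.
  have nm : (n < m)%N by near: m; exact: nbhs_infty_gt.
  rewrite (bigD1 (Ordinal nm))//= ce eqxx big1 ?addr0// => i.
  by rewrite -val_eqE/= ce => /negbTE ->.
move=> h; have : psi (e n) @[n --> \oo] --> (1 : R).
  by apply: cvg_near_cst; apply: nearW => n; exact: psi1.
move=> /(cvg_unique (@Rhausdorff R) h)/eqP.
by rewrite eq_sym oner_eq0.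
Unshelve. all: by end_near. Qed.

(** Subadditivity propagates one good value [n0] to its multiples; the constant [ones n0] pays for
    the remainder of the division by [n0]. *)
Lemma ones_sublinear (eps : R) : 0 < eps -> exists2 C, 0 <= C & forall n, ones n <= C + eps * n%:R.
Proof.
move=> eps0; have [n0 n0_gt0 Hn0] := ones_not_linear eps0.
exists (ones n0); first exact: snorm_ge0.
elim/ltn_ind => n IH.
have [nn0|n0n] := ltnP n n0.
  by rewrite ler_wpDr ?mulr_ge0 ?(ltW eps0)// ones_le// ltnW.
rewrite -{1}(subnKC n0n); apply: (le_trans (onesD _ _)).
have := IH (n - n0)%N; rewrite ltn_subrL n0_gt0 (leq_trans n0_gt0 n0n) => /(_ isT).
by rewrite natrB// mulrBr; move: Hn0; lra.
Qed.

Lemma seq_min (s : seq R) : s != [::] -> exists2 m, m \in s & forall x, x \in s -> m <= x.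
Proof.
elim: s => // x [|y s] IH _.
  by exists x; rewrite ?mem_head// => z; rewrite inE => /eqP ->.
have [//|m ms Hm] := IH; have [xm|mx] := leP x m.
  exists x; rewrite ?mem_head// => z; rewrite inE => /predU1P[->//|zs].
  exact: le_trans xm (Hm _ zs).
exists m; first by rewrite inE ms orbT.
by move=> z; rewrite inE => /predU1P[->|/Hm//]; exact: ltW.
Qed.

(* Layer-cake decomposition of [s]: peel off the smallest entry as a multiple of
   the constant vector. *)
Lemma snorm_small (eps C kappa : R) (s : seq R) :
  (forall n, ones n <= C + eps * n%:R) ->
  0 <= kappa -> (forall x, x \in s -> `|x| <= kappa) ->
  snorm e s <= C * kappa + eps * \sum_(x <- s) `|x|.
Proof.
move=> HC kappa0 sk.
have C0 : 0 <= C by have := HC 0%N; rewrite /ones snorm_nil mulr0 addr0.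
suff H n (t : seq R) (k : R) : size t = n -> 0 <= k -> (forall x, x \in t -> 0 <= x <= k) ->
    snorm e t <= C * k + eps * \sum_(x <- t) x.
  have : snorm e s <= snorm e (map Num.norm s).
    by rewrite -{1}(map_id s); apply: snorm_map_le => x _; rewrite normr_id.
  move/le_trans; apply.
  have := H _ (map Num.norm s) kappa erefl kappa0.
  rewrite big_map; apply => y /mapP[x xs ->].
  by rewrite normr_ge0 sk.
elim: n t k => [|n IH] t k.
  by move/size0nil => -> k0 _; rewrite snorm_nil big_nil mulr0 addr0 mulr_ge0.
move=> st k0 tk.
have [|m mt Hm] := @seq_min t; first by rewrite -size_eq0 st.
have pt := perm_to_rem mt.
have /andP[m0 mk] := tk _ mt.
have sr : size (rem m t) = n by rewrite size_rem// st.
have rt x : x \in rem m t -> x \in t by exact: mem_rem.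
have := IH [seq x - m | x <- rem m t] (k - m).
rewrite size_map sr subr_ge0 mk big_map => /(_ erefl isT).
have -> : \sum_(x <- rem m t) (x - m) = \sum_(x <- t) x - m * n.+1%:R.
  rewrite (perm_big _ pt)/= big_cons sumrB.
  have -> : \sum_(x <- rem m t) m = m * n%:R.
    by rewrite big_const_seq count_predT sr iter_addr addr0 mulr_natr.
  by rewrite -natr1 mulrDr mulr1; lra.
move=> /(_ _)/[!mulrBr] => H1.
have {}H1 : snorm e [seq x - m | x <- rem m t] <=
    C * k - C * m + (eps * \sum_(x <- t) x - eps * (m * n.+1%:R)).
  apply: H1 => y /mapP[x xr ->]; rewrite subr_ge0 (Hm _ (rt _ xr))/= lerB//.
  by have /andP[] := tk _ (rt _ xr).
rewrite (snorm_perm e pt).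
have E : m :: rem m t = [seq m * p.1 + p.2 | p <- (1, 0) :: [seq (1, x - m) | x <- rem m t]].
  rewrite /= mulr1 addr0 -map_comp; congr (_ :: _).
  rewrite -[LHS]map_id; apply: eq_map => x /=; by rewrite mulr1 addrC subrK.
rewrite E; apply: (le_trans (snorm_mapD _ _ _ _)); rewrite snorm_mapZ ger0_norm//.
have -> : snorm e [seq p.1 | p <- (1, 0) :: [seq (1, x - m) | x <- rem m t]] = ones n.+1.
  congr snorm; rewrite /= -map_comp; congr (_ :: _).
  by rewrite -sr; elim: (rem m t) => //= x l ->.
have -> : snorm e [seq p.2 | p <- (1 : R, 0) :: [seq (1, x - m) | x <- rem m t]] =
    snorm e [seq x - m | x <- rem m t].
  rewrite /= -map_comp -(snorm_cat0 _ [seq x - m | x <- rem m t] 1).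
  by apply: snorm_perm; rewrite perm_sym perm_catC.
(* The peeled layer costs at most [m] times [C + eps * n.+1]; the rest has cap [k - m] and a sum
   smaller by [m * n.+1], so the two bounds add up exactly to the claim. *)
have := ler_wpM2l m0 (HC n.+1); rewrite mulrDr.
by move: H1; rewrite (mulrCA m) (mulrC m C); lra.
Qed.

End Ones.

Section Tail.
Context {R : realType} {X : normedModType R} (e : symmetric_basis X).
Hypothesis HX : reflexive_space X.

(** The lists [f n] are initial pieces of one infinite sequence with bounded partial norms, whose
    series converges by bounded completeness; the blocks [q n] are then Cauchy differences. Blocks
    of norm above [eta] are nonempty, which makes the lists exhaust the sequence. *)
Lemma small_block (f q : nat -> seq R) (M eta : R) : 0 < eta ->
  (forall n, f n.+1 = f n ++ q n) -> (forall n, snorm e (f n) <= M) ->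
  exists n, snorm e (q n) <= eta.
Proof.
move=> eta0 fq fM; apply: contrapT => /forallNP H.
have {}H n : eta < snorm e (q n) by rewrite ltNge; apply/negP/H.
have q0 n : (0 < size (q n))%N.
  case: (q n) (H n) => //; rewrite snorm_nil => /(lt_trans eta0).
  by rewrite ltxx.
have szf n : (n <= size (f n))%N.
  elim: n => // n IH; rewrite fq size_cat.
  by rewrite -addn1 leq_add.
have fD n m : exists r, f (n + m)%N = f n ++ r.
  elim: m => [|m [r IH]]; first by exists [::]; rewrite addn0 cats0.
  by exists (r ++ q (n + m)%N); rewrite addnS fq IH catA.
have fpre n m k : (n <= m)%N -> (k < size (f n))%N -> nth 0 (f m) k = nth 0 (f n) k.
  by move=> nm kn; have [r] := fD n (m - n)%N; rewrite subnKC// => ->; rewrite nth_cat kn.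
pose a k := nth 0 (f k.+1) k.
have fa n k : (k < size (f n))%N -> nth 0 (f n) k = a k.
  move=> kn; rewrite /a; have [nk|kn'] := leqP n k.+1; first by rewrite (fpre n k.+1).
  by apply: fpre; [exact: ltnW|exact: szf].
have [|x [_ ax]] := @boundedly_complete _ _ e HX a M.
  move=> m; apply: le_trans (fM m).
  rewrite (@eq_fnorm _ _ e m a (nth 0 (f m))); last first.
    by move=> k km; rewrite fa// (leq_trans km).
  rewrite -snorm_mkseq; apply: snorm_subseq.
  by rewrite (_ : mkseq _ _ = take m (f m)) ?take_subseq// /mkseq map_nth_iota0// szf.
have ax1 : psum e a (size (f n)) @[n --> \oo] --> x.
  apply: cvg_comp ax => A [N _ NA]; exists N => // n /= Nn.
  by apply: NA; exact: leq_trans Nn (szf n).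
have ax2 : psum e a (size (f n.+1)) @[n --> \oo] --> x.
  by move: (ax1); rewrite -(cvg_shiftS (fun n => psum e a (size (f n)))).
have : psum e a (size (f n.+1)) - psum e a (size (f n)) @[n --> \oo] --> x - x.
  exact: (cvgB ax2 ax1).
rewrite subrr => /cvgrPdist_lt/(_ _ eta0)[N _ /(_ N (leqnn N))] /=.
rewrite sub0r normrN; apply/negP; rewrite -leNgt.
have -> : psum e a (size (f N.+1)) - psum e a (size (f N)) =
    \sum_(k < size (f N.+1)) nth 0 (nseq (size (f N)) 0 ++ q N) k *: e k.
  have le : (size (f N) <= size (f N.+1))%N by rewrite fq size_cat leq_addr.
  rewrite /psum -!(big_mkord xpredT (fun k => a k *: e k)) -(big_mkord xpredT (fun k =>
    nth 0 (nseq (size (f N)) 0 ++ q N) k *: e k)).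
  rewrite [X in X - _](big_cat_nat (n := size (f N)))//= addrAC subrr add0r.
  rewrite [RHS](big_cat_nat (n := size (f N)))//=.
  rewrite [X in _ = X + _]big_nat_cond [X in _ = X + _]big1 ?add0r; last first.
    by move=> k /andP[/andP[_ kN] _]; rewrite nth_cat size_nseq kN nth_nseq kN scale0r.
  apply: eq_big_nat => k /andP[Nk kN].
  by rewrite nth_cat size_nseq ltnNge Nk/= -(fa N.+1)// fq nth_cat ltnNge Nk /=.
have -> : size (f N.+1) = size (nseq (size (f N)) (0 : R) ++ q N) by rewrite fq !size_cat size_nseq.
rewrite -/(fnorm e _ _) -/(snorm e _).
have /snorm_perm -> : perm_eq (nseq (size (f N)) 0 ++ q N) (q N ++ nseq (size (f N)) 0).
  by rewrite perm_catC.
by rewrite snorm_cat0 ltW.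
Qed.

(** If every finite [l0] left a disjoint list of norm above [eta], appending such lists again and
    again would contradict [small_block]. *)
Lemma summable_tail (P : R -> Prop) (g : R -> R) (M eta : R) : 0 < eta ->
  (forall l, uniq l -> (forall x, x \in l -> P x) -> snorm e (map g l) <= M) ->
  exists l0, [/\ uniq l0, (forall x, x \in l0 -> P x) &
    forall l, uniq l -> (forall x, x \in l -> P x /\ x \notin l0) ->
      snorm e (map g l) <= eta].
Proof.
move=> eta0 gM; apply: contrapT => /forallNP H.
pose good l := uniq l /\ forall x, x \in l -> P x.
have H' (l0 : {l | good l}) : exists l, [/\ uniq l,
    (forall x, x \in l -> P x /\ x \notin sval l0) & ~ snorm e (map g l) <= eta].
  have [u0 P0] := svalP l0.
  apply: contrapT => /forallNP K; apply: (H (sval l0)); split => // l ul Pl.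
  by apply: contrapT => nl; apply: (K l).
have [pick Hp] := choice H'.
have gnext l0 : good (sval l0 ++ pick l0).
  have [up Pp _] := Hp l0; have [u0 P0] := svalP l0; split.
    rewrite cat_uniq u0 up andbT /=; apply/hasPn => x xp.
    by have [_] := Pp x xp.
  by move=> x; rewrite mem_cat => /orP[/P0|/Pp[]].
have g0 : good [::] by split.
pose L := fix L n := if n is n'.+1 then exist good _ (gnext (L n')) else exist good _ g0.
have [|n|n] := @small_block (fun n => map g (sval (L n))) (fun n => map g (pick (L n))) M eta eta0.
- by move=> n; rewrite /= map_cat.
- by have [u Pl] := svalP (L n); exact: gM.
- by have [_ _] := Hp (L n).
Qed.

End Tail.

(** * Variation of functions on the unit interval *)

Section Families.
Context {R : realType}.
Implicit Types (L : seq (R * R)) (p q : R * R) (F : R -> R).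

Definition itv01 p := [&& 0 <= p.1, p.1 <= p.2 & p.2 <= 1].

Definition nonoverlap p q := (p.2 <= q.1) || (q.2 <= p.1).

Definition itv_family L := all itv01 L && pairwise nonoverlap L.

Definition incr F p := F p.2 - F p.1.

Lemma nonoverlapC p q : nonoverlap p q = nonoverlap q p.
Proof. by rewrite /nonoverlap orbC. Qed.

Lemma family_subseq L L' : subseq L L' -> itv_family L' -> itv_family L.
Proof.
move=> LL' /andP[a p]; rewrite /itv_family (subseq_pairwise LL' p) andbT.
by apply/allP => x /(mem_subseq LL') xL'; exact: (allP a).
Qed.

Lemma family_nonoverlap L p q : itv_family L -> p \in L -> q \in L -> p != q -> nonoverlap p q.
Proof.
move=> /andP[_ /(pairwiseP p) H] pL qL pq.
have := H (index p L) (index q L); have := H (index q L) (index p L).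
rewrite !inE !index_mem !nth_index// => /(_ qL pL) H1 /(_ pL qL) H2.
have [/H2//|/H1|e] := ltngtP (index p L) (index q L); first by rewrite nonoverlapC.
by move: pq; rewrite -(nth_index p pL) e nth_index// eqxx.
Qed.

Lemma family_itv01 L p : itv_family L -> p \in L -> [/\ 0 <= p.1, p.1 <= p.2 & p.2 <= 1].
Proof. by move=> /andP[/allP H _] /H /and3P. Qed.

Lemma nondegenerate_uniq L : itv_family L -> uniq [seq p <- L | p.1 < p.2].
Proof.
move=> /andP[_]; elim: L => //= p L IH /andP[/allP np /IH uL].
case: ifPn => //= p12; rewrite uL andbT mem_filter p12/=.
by apply/negP => /np; rewrite /nonoverlap orbb leNgt p12.
Qed.

Lemma incr_degenerate F L p : itv_family L -> p \in L -> ~~ (p.1 < p.2) -> incr F p = 0.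
Proof.
move=> fL pL; have [_ p12 _] := family_itv01 fL pL.
by rewrite -leNgt /incr => p21; rewrite (_ : p.2 = p.1) ?subrr//; apply/eqP; rewrite eq_le p21.
Qed.

Fixpoint pairs (x : R) (t : seq R) : seq (R * R) :=
  if t is y :: t' then (x, y) :: pairs y t' else [::].

Lemma pairs_cat x t u : pairs x (t ++ u) = pairs x t ++ pairs (last x t) u.
Proof. by elim: t x => //= y t IH x; rewrite IH. Qed.

Lemma size_pairs x t : size (pairs x t) = size t.
Proof. by elim: t x => //= y t IH x; rewrite IH. Qed.

Lemma nth_pairs x t k : (k < size t)%N ->
  nth (0, 0) (pairs x t) k = (nth 1 (x :: t) k, nth 1 t k).
Proof. by elim: t x k => // y t IH x [|k] //= kt; rewrite IH. Qed.

Definition short (eps : R) : rel R := fun x y => (x < y) && (y - x <= eps).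

Lemma path_short_le eps x t : path (short eps) x t ->
  forall y, y \in x :: t -> x <= y <= last x t.
Proof.
elim: t x => [|z t IH] x /=; first by move=> _ y; rewrite inE => /eqP ->; rewrite lexx.
move=> /andP[/andP[xz _] /IH H] y; rewrite inE => /predU1P[->|/H/andP[zy ->]].
  by have /andP[_ zl] := H z (mem_head _ _); rewrite lexx (le_trans (ltW xz)).
by rewrite andbT (le_trans (ltW xz)).
Qed.

Lemma fill_short eps x y : 0 < eps -> x <= y ->
  exists t, path (short eps) x t /\ last x t = y.
Proof.
move=> eps0; have [n] : exists n : nat, y - x <= n%:R * eps.
  exists (Num.truncn ((y - x) / eps)).+1.
  by rewrite -ler_pdivrMr// ltW// truncnS_gt.
elim: n x => [|n IH] x H xy.
  by exists [::]; split => //=; apply/eqP; rewrite eq_le xy/=; move: H; rewrite mul0r; lra.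
have [yx|yx] := leP (y - x) eps.
  have [->|nxy] := eqVneq x y; first by exists [::].
  by exists [:: y]; rewrite /= /short yx lt_neqAle nxy xy.
have [||t [tp tl]] := IH (x + eps).
- by move: H; rewrite -natr1 mulrDl mul1r; lra.
- by lra.
exists (x + eps :: t); rewrite /= tp tl /short; split => //; apply/andP; split => //.
by apply/andP; split; lra.
Qed.

(** Only the gaps between consecutive intervals are cut into short steps, so the given intervals
    remain among the steps of the completed partition. *)
Lemma chain_short eps x L : 0 < eps -> x <= 1 ->
  path (fun p q => p.2 <= q.1) (x, x) L ->
  (forall p, p \in L -> [/\ p.1 < p.2, p.2 - p.1 <= eps & p.2 <= 1]) ->
  exists t, [/\ path (short eps) x t, last x t = 1 & subseq L (pairs x t)].
Proof.
move=> eps0; elim: L x => [|[a b] L IH] x x1 /=.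
  by move=> _ _; have [t [tp tl]] := fill_short eps0 x1; exists t; rewrite sub0seq.
move=> /andP[/= xa pL] HL.
have [/= ab abe b1] := HL _ (mem_head _ _).
have [t [tp tl]] := fill_short eps0 xa.
have [//| | |u [up ul su]] := IH b.
- by case: L pL {IH HL} => //= q L.
- by move=> p pL'; apply: HL; rewrite inE pL' orbT.
exists (t ++ b :: u); split.
- by rewrite cat_path tp tl/= /short ab abe.
- by rewrite last_cat.
- rewrite pairs_cat tl /= -[(a, b) :: L]cat0s; apply: cat_subseq; first exact: sub0seq.
  by rewrite /= eqxx.
Qed.

Lemma pairs_family x t : 0 <= x -> last x t <= 1 -> path <=%R x t -> itv_family (pairs x t).
Proof.
elim: t x => // y t IH x x0 l1 /= /andP[xy pt].
have [y0 yl] : 0 <= y /\ last y t <= 1 by split => //; exact: le_trans xy.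
have /andP[a p] := IH y y0 yl pt.
have yt z : z \in t -> y <= z.
  by move=> zt; move: pt; rewrite (path_sortedE le_trans) => /andP[/allP/(_ _ zt)].
rewrite /itv_family /= a p /itv01 x0 xy !andbT /=.
have -> : y <= 1.
  by apply: le_trans yl; have := mem_last y t; rewrite inE => /predU1P[->|/yt].
have ge1 z u : path <=%R z u -> all (fun q => z <= q.1) (pairs z u).
  elim: u z => //= w u IHu z /andP[zw /IHu/allP H]; rewrite lexx/=.
  by apply/allP => q /H; exact: le_trans.
by apply/allP => q /(allP (ge1 y t pt)) yq; rewrite /nonoverlap /= yq.
Qed.

Lemma family_path eps L : 0 < eps -> itv_family L ->
  (forall p, p \in L -> p.2 - p.1 <= eps) ->
  exists t L', [/\ path (short eps) 0 t, last 0 t = 1,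
    perm_eq [seq p <- L | p.1 < p.2] L' & subseq L' (pairs 0 t)].
Proof.
move=> eps0 fL Le.
pose L1 := [seq p <- L | p.1 < p.2].
have fL1 : itv_family L1 by apply: family_subseq fL; exact: seq.filter_subseq.
have nd p : p \in L1 -> p.1 < p.2 by rewrite mem_filter => /andP[].
have uL1 : uniq L1 := nondegenerate_uniq fL.
pose L2 := sort (fun p q => p.1 <= q.1) L1.
have mL2 : L2 =i L1 by move=> p; rewrite mem_sort.
have tr : transitive (fun p q : R * R => p.1 <= q.1) by move=> a b c; exact: le_trans.
have sL2 : sorted (fun p q => p.1 <= q.1) L2.
  by apply: sort_sorted => p q; exact: le_total.
have pL2 : pairwise (fun p q => p.2 <= q.1) L2.
  have := sL2; rewrite (sorted_pairwise tr) => H1.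
  have H2 : pairwise (fun p q => p != q) L2 by rewrite -uniq_pairwise sort_uniq.
  have := pairwise_relI (fun p q : R * R => p.1 <= q.1) (fun p q => p != q) L2.
  rewrite H1 H2 /=.
  apply: (@sub_in_pairwise _ (mem L2)); last by apply/allP.
  move=> p q; rewrite /= !mL2 => pL qL /andP[pq1 pq].
  have /orP[//|qp] := family_nonoverlap fL1 pL qL pq.
  by have := nd _ qL; rewrite ltNge (le_trans qp pq1).
have pathL2 : path (fun p q => p.2 <= q.1) (0, 0) L2.
  have := pairwise_sorted pL2; case E : L2 => [//|p s] /= ->; rewrite andbT.
  have : p \in L by have := mem_head p s; rewrite -E mL2 mem_filter => /andP[].
  by move=> /(allP (andP fL).1)/and3P[].
have HL2 p : p \in L2 -> [/\ p.1 < p.2, p.2 - p.1 <= eps & p.2 <= 1].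
  rewrite mL2 mem_filter => /andP[p12 pL]; split => //; first exact: Le.
  by have /and3P[] := allP (andP fL).1 _ pL.
have [t [tp tl ts]] := chain_short eps0 (@ler01 R) pathL2 HL2.
by exists t, L2; split => //; rewrite perm_sym perm_sort.
Qed.

(* Variation is studied for total functions [R -> R], restricted to [0, 1]; [ext]
   and (below) [res] translate from and to functions on the subtype. *)
Definition ext (f : unit_interval R -> R) : R -> R := fun x => f (clamp x).

Lemma clampK (x : unit_interval R) : clamp (\val x) = x.
Proof. by apply/val_inj; rewrite clampE// unit_interval_ge0 unit_interval_le1. Qed.

End Families.

Section Variation.
Context {R : realType} {X : normedModType R} (e : symmetric_basis X).
Implicit Types (L : seq (R * R)) (F : R -> R).

Lemma snorm_incr_nondegenerate F L : itv_family L ->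
  snorm e (map (incr F) [seq p <- L | p.1 < p.2]) = snorm e (map (incr F) L).
Proof. by move=> fL; apply: snorm_map_filter => p pL; exact: incr_degenerate pL. Qed.

(** One half of the agreement of suprema over families with suprema over partitions: a family
    extends to a partition with the same bound on the mesh, and discarding increments does not
    increase the norm. *)
Lemma family_partition eps L : 0 < eps -> itv_family L ->
  (forall p, p \in L -> p.2 - p.1 <= eps) ->
  exists n t, [/\ is_partition n t, mesh n t <= eps &
    forall f : unit_interval R -> R^o, snorm e (map (incr (ext f)) L) <= alpha e f n t].
Proof.
move=> eps0 fL Le.
have [t [L' [tp tl pL' sL']]] := family_path eps0 fL Le.
have t01 k : 0 <= nth 1 (0 :: t) k <= 1.
  have [kt|kt] := ltnP k (size (0 :: t)); last by rewrite nth_default// ler01 lexx.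
  by rewrite -tl; apply: (path_short_le tp); exact: mem_nth.
pose tt k := clamp (nth 1 (0 :: t) k).
have ttE k : \val (tt k) = nth 1 (0 :: t) k by rewrite clampE.
have step k : (k < size t)%N -> short eps (nth 1 (0 :: t) k) (nth 1 t k).
  by move=> kt; exact: (pathP 1 tp).
exists (size t), tt; split.
- split; first by rewrite ttE.
    by rewrite ttE -(last_nth 1) tl.
  by move=> k kt; rewrite !ttE /=; have /andP[] := step k kt.
- apply: bigmax_le; first exact: ltW.
  by move=> k _; rewrite !ttE /=; have /andP[] := step k (ltn_ord k).
move=> f.
have <- : snorm e (map (incr (ext f)) (pairs 0 t)) = alpha e f (size t) tt.
  rewrite /snorm size_map size_pairs /fnorm /alpha; congr `|_|.
  apply: eq_bigr => k _; rewrite (nth_map (0, 0)) ?size_pairs// nth_pairs//.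
rewrite -snorm_incr_nondegenerate//.
rewrite (snorm_perm e (perm_map _ pL')); exact/snorm_subseq/map_subseq.
Qed.

Lemma alpha_pairs f n (t : nat -> unit_interval R) : is_partition n t ->
  exists L, [/\ itv_family L, alpha e f n t = snorm e (map (incr (ext f)) L) &
    forall p, p \in L -> p.2 - p.1 <= mesh n t].
Proof.
move=> [t0 tn tk].
exists [seq (\val (t k), \val (t k.+1)) | k <- iota 0 n]; split.
- have tmono : forall i j, (i <= j <= n)%N -> \val (t i) <= \val (t j).
    move=> i; elim=> [|j IH]; first by rewrite leqn0 => /andP[/eqP ->].
    rewrite leq_eqVlt => /andP[/predU1P[->//|ij] jn].
    by apply: le_trans (ltW (tk j jn)); apply: IH; rewrite -ltnS ij ltnW.
  apply/andP; split.
    apply/allP => p /mapP[k]; rewrite mem_iota => /andP[_ kn] ->.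
    by rewrite /itv01 /= unit_interval_ge0 unit_interval_le1 andbT ltW// tk.
  rewrite pairwise_map; have := iota_ltn_sorted 0 n; rewrite (sorted_pairwise ltn_trans).
  apply: (@sub_in_pairwise _ (mem (iota 0 n))); last by apply/allP.
  move=> i j; rewrite /= !mem_iota /= add0n => ni nj ij.
  by rewrite /nonoverlap /= tmono// ij ltnW.
- rewrite /alpha /snorm !size_map size_iota; congr `|_|; apply: eq_bigr => k _.
  by rewrite (nth_map (0, 0)) ?size_map ?size_iota// (nth_map 0%N) ?size_iota//
    nth_iota// /incr /ext /= !clampK.
- move=> p /mapP[k]; rewrite mem_iota => /andP[_ kn] ->.
  by rewrite /mesh; apply: (le_bigmax_seq _ (Ordinal kn)) => //; rewrite mem_index_enum.
Qed.

(** Families replace partitions: the supremum is the same by [Vle_norm], but a family can be sorted,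
    cut down and transported without covering [0, 1]. [Vsmall] treats the condition defining V^0
    likewise. *)
Definition Vle F C := forall L, itv_family L -> snorm e (map (incr F) L) <= C.

Definition Vsmall F := forall eta, 0 < eta -> exists2 eps, 0 < eps &
  forall L, itv_family L -> (forall p, p \in L -> p.2 - p.1 <= eps) ->
    snorm e (map (incr F) L) <= eta.

Lemma Vle_norm f C : Vle (ext f) C <-> (V_norm e f <= C%:E)%E.
Proof.
split=> [H|H L fL].
  apply: ge_ereal_sup => _ [[n t] /= nt <-]; rewrite lee_fin.
  by have [L [fL -> _]] := alpha_pairs f nt; exact: H.
have [|n [t [nt _ Ht]]] := @family_partition 1 L ltr01 fL.
  move=> p /(allP (andP fL).1)/and3P[]; lra.
apply: (le_trans (Ht f)); rewrite -lee_fin; apply: le_trans H.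
by apply: ereal_sup_ubound; exists (n, t).
Qed.

Lemma V_predP (f : unit_interval R -> R^o) :
  (f \in V_pred e) <-> f I0 = 0 /\ exists C, Vle (ext f) C.
Proof.
split=> [Vf|[f0 [C HC]]]; last first.
  rewrite inE; split => //; have /Vle_norm := HC; move/le_lt_trans; apply.
  exact: ltry.
have fin := V_norm_fin Vf; move: Vf; rewrite inE => -[f0 _]; split => //.
by exists (fine (V_norm e f)); apply/Vle_norm; rewrite fineK.
Qed.

Lemma V0_predP (f : unit_interval R -> R^o) :
  (f \in V0_pred e) <-> f \in V_pred e /\ Vsmall (ext f).
Proof.
split.
  rewrite inE => -[Vf /fine_cvgP[fin /cvgrPdist_lt Hf]]; split => // eta eta0.
  have H : \forall eps \near (0 : R)^'+, [/\ 0 < eps, small_variation e f eps \is a fin_num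
     & `|0 - (fine \o small_variation e f) eps| < eta].
    near=> eps; split; first by near: eps; exact: nbhs_right_gt.
      by near: eps; exact: fin.
    by near: eps; exact: Hf.
  have [eps [eps0 feps Heps]] := filter_ex H.
  exists eps => // L fL Le.
  have [n [t [nt mt Ht]]] := family_partition eps0 fL Le.
  apply: (le_trans (Ht f)); rewrite ltW//.
  move: Heps; rewrite sub0r normrN; apply: le_lt_trans.
  apply: le_trans (ler_norm _); rewrite -lee_fin fineK//.
  by apply: ereal_sup_ubound; exists (n, t).
move=> [Vf sf]; rewrite inE; split => //.
have small eta : 0 < eta -> exists2 eps, 0 < eps & forall d, d <= eps ->
    (small_variation e f d <= eta%:E)%E.
  move=> /sf[eps eps0 Heps]; exists eps => // d de.
  apply: ge_ereal_sup => _ [[n t] /= [nt mt] <-]; rewrite lee_fin.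
  have [L [fL -> HL]] := alpha_pairs f nt; apply: Heps => // p pL.
  by apply: (le_trans (HL _ pL)); exact: le_trans de.
have ge0 d : 0 < d -> (0 <= small_variation e f d)%E.
  move=> d0; apply: sup_alpha_ge0; have [n [t nt]] := @fine_partition R d d0.
  by exists (n, t).
apply/fine_cvgP; split.
  have [eps eps0 H] := small 1 ltr01; near=> d.
  rewrite ge0_fin_numE; last by apply: ge0; near: d; exact: nbhs_right_gt.
  apply: le_lt_trans (ltry 1); apply: H; near: d; exact: nbhs_right_le.
apply/cvgrPdist_le => eta eta0; have [eps eps0 H] := small _ eta0.
near=> d.
have d0 : 0 < d by near: d; exact: nbhs_right_gt.
have He : (small_variation e f d <= eta%:E)%E by apply: H; near: d; exact: nbhs_right_le.
rewrite sub0r normrN /= ger0_norm ?fine_ge0// ?ge0//.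
rewrite -lee_fin fineK// ge0_fin_numE ?ge0//.
exact: le_lt_trans He (ltry _).
Unshelve. all: by end_near. Qed.

End Variation.

(** * Calculus of the variation bounds *)

Section VleTheory.
Context {R : realType} {X : normedModType R} (e : symmetric_basis X).
Implicit Types (L : seq (R * R)) (F G : R -> R).

Lemma family_nil : @itv_family R [::]. Proof. by []. Qed.

Lemma family1 (x y : R) : 0 <= x -> x <= y -> y <= 1 -> itv_family [:: (x, y)].
Proof. by move=> x0 xy y1; rewrite /itv_family /= /itv01 x0 xy y1. Qed.

Lemma Vle_ge0 F C : Vle e F C -> 0 <= C.
Proof. by move=> /(_ [::] family_nil); rewrite snorm_nil. Qed.

Lemma Vle_trans F C D : C <= D -> Vle e F C -> Vle e F D.
Proof. by move=> CD H L fL; exact: le_trans (H L fL) CD. Qed.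

Lemma eq_Vle F G C : (forall x, 0 <= x <= 1 -> F x = G x) -> Vle e F C -> Vle e G C.
Proof.
move=> FG H L fL; rewrite (_ : map _ L = map (incr F) L); first exact: H.
apply/eq_in_map => p /(family_itv01 fL)[p0 p12 p1].
by rewrite /incr !FG// ?p0 ?p1 ?(le_trans p0 p12) ?(le_trans p12 p1).
Qed.

Lemma eq_Vsmall F G : (forall x, 0 <= x <= 1 -> F x = G x) -> Vsmall e F -> Vsmall e G.
Proof.
move=> FG H eta /H[eps eps0 Heps]; exists eps => // L fL Le.
rewrite (_ : map _ L = map (incr F) L); first exact: Heps.
apply/eq_in_map => p /(family_itv01 fL)[p0 p12 p1].
by rewrite /incr !FG// ?p0 ?p1 ?(le_trans p0 p12) ?(le_trans p12 p1).
Qed.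

Lemma VleD F G C D : Vle e F C -> Vle e G D -> Vle e (fun x => F x + G x) (C + D).
Proof.
move=> HF HG L fL; apply: le_trans (lerD (HF L fL) (HG L fL)).
apply: le_trans (snorm_mapD _ _ _ _).
by rewrite le_eqVlt; apply/orP; left; apply/eqP; congr snorm; apply: eq_map => p;
  rewrite /incr opprD addrACA.
Qed.

Lemma VleZ a F C : Vle e F C -> Vle e (fun x => a * F x) (`|a| * C).
Proof.
move=> HF L fL; apply: le_trans (ler_wpM2l (normr_ge0 a) (HF L fL)).
rewrite -snorm_mapZ le_eqVlt; apply/orP; left; apply/eqP; congr snorm; apply: eq_map => p.
by rewrite /incr mulrBr.
Qed.

Lemma Vle_cst c : Vle e (fun=> c) 0.
Proof.
move=> L fL; apply: (le_trans (snorm_le_sum _ _)).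
by rewrite big_map big1 ?mul0r// => p _; rewrite /incr subrr normr0.
Qed.

Lemma Vle_sum (I : Type) (r : seq I) (F : I -> R -> R) (C : I -> R) :
  (forall i, Vle e (F i) (C i)) ->
  Vle e (fun x => \sum_(i <- r) F i x) (\sum_(i <- r) C i).
Proof.
move=> H; elim: r => [|i r IH].
  rewrite big_nil; apply: eq_Vle (Vle_cst 0) => x _; by rewrite big_nil.
rewrite big_cons; apply: eq_Vle (VleD (H i) IH) => x _.
by rewrite big_cons.
Qed.

Lemma Vle_comp F C (rho : R -> R) :
  (forall x, 0 <= x <= 1 -> 0 <= rho x <= 1) ->
  (forall x y, 0 <= x -> x <= y -> y <= 1 -> rho x <= rho y) ->
  Vle e F C -> Vle e (F \o rho) C.
Proof.
move=> r01 rle H L fL.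
have := H [seq (rho p.1, rho p.2) | p <- L]; rewrite -map_comp; apply.
apply/andP; split.
  apply/allP => q /mapP[p /(family_itv01 fL)[p0 p12 p1] ->]; rewrite /itv01/=.
  have /andP[-> _] : 0 <= rho p.1 <= 1 by rewrite r01// p0 (le_trans p12 p1).
  have /andP[_ ->] : 0 <= rho p.2 <= 1 by rewrite r01// p1 (le_trans p0 p12).
  by rewrite rle.
rewrite pairwise_map; have /andP[_] := fL.
apply: (@sub_in_pairwise _ (mem L)); last by apply/allP.
move=> p q /= /(family_itv01 fL)[p0 p12 p1] /(family_itv01 fL)[q0 q12 q1].
move=> /orP[pq|qp]; apply/orP; [left|right].
  by apply: rle => //; [exact: le_trans p0 p12|exact: le_trans q12 q1].
by apply: rle => //; [exact: le_trans q0 q12|exact: le_trans p12 p1].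
Qed.

Lemma cvg_snorm_map (I : Type) (U : set_system I) (T : eqType) (L : seq T)
    (F : I -> T -> R) (G : T -> R) : ProperFilter U ->
  (forall p, p \in L -> F i p @[i --> U] --> G p) ->
  snorm e (map (F i) L) @[i --> U] --> snorm e (map G L).
Proof.
move=> PU FG; rewrite /snorm /fnorm.
have E (H : T -> R) : `|\sum_(k < size (map H L)) nth 0 (map H L) k *: e k| =
    `|\sum_(k < size L) nth 0 (map H L) k *: e k| by rewrite size_map.
under eq_fun do rewrite E.
rewrite E; apply: cvg_norm.
suff H n : (n <= size L)%N -> \sum_(k < n) nth 0 (map (F i) L) k *: e k @[i --> U] -->
  \sum_(k < n) nth 0 (map G L) k *: e k by exact: H.
elim: n => [_|n IH nL].
  rewrite big_ord0 (_ : (fun i : I => _) = cst 0); first exact: cvg_cst.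
  by apply/funext => i; rewrite big_ord0.
rewrite big_ord_recr/= (_ : (fun i : I => _) = (fun i => \sum_(k < n) nth 0 (map (F i) L) k *: e k +
   nth 0 (map (F i) L) n *: e n)); last first.
  by apply/funext => i; rewrite big_ord_recr.
apply: cvgD; first exact/IH/ltnW.
apply: cvgZl; case: L nL {IH E} FG => // x0 L nL FG.
rewrite (nth_map x0)// (_ : (fun i : I => _) = (fun i => F i (nth x0 (x0 :: L) n))).
  by apply: FG; exact: mem_nth.
by apply/funext => i; rewrite (nth_map x0).
Qed.

Lemma cvg_incr (I : Type) (U : set_system I) (F : I -> R -> R) G L : ProperFilter U ->
  itv_family L -> (forall x, 0 <= x <= 1 -> F i x @[i --> U] --> G x) ->
  snorm e (map (incr (F i)) L) @[i --> U] --> snorm e (map (incr G) L).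
Proof.
move=> PU fL FG; apply: cvg_snorm_map => p /(family_itv01 fL)[p0 p12 p1].
apply: cvgB; apply: FG; first by rewrite p1 (le_trans p0 p12).
by rewrite p0 (le_trans p12 p1).
Qed.

(** Lower semicontinuity of the variation: each family sees only finitely many values. *)
Lemma Vle_lim (I : Type) (U : set_system I) (F : I -> R -> R) G C : ProperFilter U ->
  (forall x, 0 <= x <= 1 -> F i x @[i --> U] --> G x) ->
  (\forall i \near U, Vle e (F i) C) -> Vle e G C.
Proof.
move=> PU FG H L fL; apply: (cvgr_to_le (cvg_incr PU fL FG)).
by apply: filterS H => i; apply.
Qed.

Lemma Vle_point F C x y : Vle e F C -> 0 <= x -> x <= y -> y <= 1 ->
  `|F y - F x| * `|e 0%N| <= C.
Proof. by move=> H x0 xy y1; have := H _ (family1 x0 xy y1); rewrite /= snorm1. Qed.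

Lemma VsmallD F G : Vsmall e F -> Vsmall e G -> Vsmall e (fun x => F x + G x).
Proof.
move=> HF HG eta eta0; have eta2 : 0 < eta / 2 by rewrite divr_gt0.
have [d1 d10 H1] := HF _ eta2; have [d2 d20 H2] := HG _ eta2.
exists (Num.min d1 d2); first by rewrite lt_min d10.
move=> L fL Le; rewrite (splitr eta).
apply: le_trans (lerD (H1 L fL _) (H2 L fL _)); last 2 first.
- by move=> p /Le; rewrite le_min => /andP[].
- by move=> p /Le; rewrite le_min => /andP[].
apply: le_trans (snorm_mapD _ _ _ _).
by rewrite le_eqVlt; apply/orP; left; apply/eqP; congr snorm; apply: eq_map => p;
  rewrite /incr opprD addrACA.
Qed.

Lemma VsmallZ a F : Vsmall e F -> Vsmall e (fun x => a * F x).
Proof.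
move=> HF eta eta0; have na : 0 < `|a| + 1 by rewrite ltr_wpDl.
have [d d0 H] := HF (eta / (`|a| + 1)) (divr_gt0 eta0 na).
exists d => // L fL Le; have := H L fL Le; rewrite ler_pdivlMr// => H1.
rewrite (_ : map _ L = map (fun p => a * incr F p) L); last first.
  by apply: eq_map => p; rewrite /incr mulrBr.
rewrite snorm_mapZ; apply: le_trans H1; rewrite mulrC ler_wpM2l ?snorm_ge0//.
by rewrite ler_wpDr.
Qed.

Lemma Vsmall_cst c : Vsmall e (fun=> c).
Proof.
by move=> eta eta0; exists 1 => // L fL _; apply: le_trans (ltW eta0); exact: Vle_cst.
Qed.

Lemma Vsmall_closed F :
  (forall eta, 0 < eta -> exists2 G, Vsmall e G & Vle e (fun x => F x - G x) eta) ->
  Vsmall e F.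
Proof.
move=> H eta eta0; have eta2 : 0 < eta / 2 by rewrite divr_gt0.
have [G sG FG] := H _ eta2; have [d d0 Hd] := sG _ eta2.
exists d => // L fL Le; rewrite (splitr eta).
apply: le_trans (lerD (FG L fL) (Hd L fL Le)).
apply: le_trans (snorm_mapD _ _ _ _).
by rewrite le_eqVlt; apply/orP; left; apply/eqP; congr snorm; apply: eq_map => p;
  rewrite /incr; lra.
Qed.

Lemma Vsmall_continuous F : Vsmall e F -> forall eta, 0 < eta -> exists2 eps, 0 < eps &
  forall x y, 0 <= x <= 1 -> 0 <= y <= 1 -> `|x - y| <= eps -> `|F x - F y| <= eta.
Proof.
move=> sF eta eta0.
have [eps eps0 H] := sF _ (mulr_gt0 eta0 (basis_norm_gt0 e)).
exists eps => //.
have main x y : 0 <= x -> x <= y -> y <= 1 -> y - x <= eps -> `|F y - F x| <= eta.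
  move=> x0 xy y1 yx; rewrite -(ler_pM2r (basis_norm_gt0 e)) -(snorm1 e).
  by have := H _ (family1 x0 xy y1); apply => p; rewrite inE => /eqP ->.
move=> x y /andP[x0 x1] /andP[y0 y1] H1; have [xy|/ltW yx] := leP x y.
  by rewrite distrC main//; move: H1; rewrite distrC ger0_norm ?subr_ge0.
by rewrite main//; move: H1; rewrite ger0_norm ?subr_ge0.
Qed.

Lemma family_sum_le F L : (forall x y, 0 <= x -> x <= y -> y <= 1 -> F x <= F y) ->
  itv_family L -> \sum_(p <- L) incr F p <= F 1 - F 0.
Proof.
move=> mF fL.
(* The length bound 1 is no restriction inside [0, 1]. The family becomes part of a partition, whose
   increments are nonnegative and telescope. *)
have [|t [L' [tp tl pL sL]]] := @family_path R 1 L ltr01 fL.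
  by move=> p /(family_itv01 fL)[]; lra.
have -> : \sum_(p <- L) incr F p = \sum_(p <- L') incr F p.
  rewrite -(perm_big _ pL)/= big_filter [RHS]big_mkcond/= [LHS]big_seq [RHS]big_seq.
  by apply: eq_bigr => p pL1; case: ifPn => // /(incr_degenerate F fL pL1).
have ge0 (s : seq (R * R)) : {subset s <= pairs 0 t} -> 0 <= \sum_(p <- s) incr F p.
  move=> st; rewrite big_seq; apply: sumr_ge0 => p /st pt; rewrite subr_ge0.
  have fP : itv_family (pairs 0 t).
    apply: pairs_family => //; first by rewrite tl.
    by apply: sub_path tp => x y /andP[/ltW].
  by have [] := family_itv01 fP pt; exact: mF.
have [r pr] := perm_to_subseq sL.
have tele u x : \sum_(p <- pairs x u) incr F p = F (last x u) - F x.
  elim: u x => [|y u IH] x /=; first by rewrite big_nil subrr.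
  by rewrite big_cons IH /incr /=; lra.
have := tele t 0; rewrite tl => <-.
rewrite (perm_big _ pr)/= big_cat/= lerDl ge0// => p pr'.
by rewrite (perm_mem pr) mem_cat pr' orbT.
Qed.

Lemma monotone_variation F L : (forall x y, 0 <= x -> x <= y -> y <= 1 -> F x <= F y) ->
  itv_family L -> \sum_(p <- L) `|incr F p| <= F 1 - F 0.
Proof.
move=> mF fL; apply: le_trans (family_sum_le mF fL).
rewrite big_seq [leRHS]big_seq; apply: ler_sum => p /(family_itv01 fL)[p0 p12 p1].
by rewrite ger0_norm// subr_ge0 mF.
Qed.

Hypothesis HX : reflexive_space X.

(** Increments that are uniformly small and absolutely summable are the situation of [snorm_small]:
    the slope is fixed first, against the variation [M], then the size of the increments, against
    the resulting constant [C]. *)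
Lemma Vsmall_bounded_variation F M :
  (forall eta, 0 < eta -> exists2 eps, 0 < eps &
    forall x y, 0 <= x -> x <= y -> y <= 1 -> y - x <= eps -> `|F y - F x| <= eta) ->
  (forall L, itv_family L -> \sum_(p <- L) `|incr F p| <= M) -> Vsmall e F.
Proof.
move=> cF bF eta eta0.
have aux (u K : R) : u * (2 * (K + 1)) = eta -> 0 <= u -> K * u <= eta / 2.
  by move=> <- u0; lra.
have M0 : 0 <= M by have := bF _ family_nil; rewrite big_nil.
have M1 : 0 < 2 * (M + 1) by rewrite mulr_gt0// ltr_wpDl.
have [C C0 HC] := ones_sublinear e HX (divr_gt0 eta0 M1).
have C1 : 0 < 2 * (C + 1) by rewrite mulr_gt0// ltr_wpDl.
have [eps eps0 Heps] := cF _ (divr_gt0 eta0 C1).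
exists eps => // L fL Le.
have k0 : 0 <= eta / (2 * (C + 1)) by rewrite ltW// divr_gt0.
have small x : x \in map (incr F) L -> `|x| <= eta / (2 * (C + 1)).
  move=> /mapP[p pL ->]; have [p0 p12 p1] := family_itv01 fL pL.
  by apply: Heps => //; exact: Le.
apply: (le_trans (snorm_small HC k0 small)); rewrite big_map [leRHS]splitr; apply: lerD.
  have E : eta / (2 * (C + 1)) * (2 * (C + 1)) = eta by rewrite divfK// gt_eqF.
  exact: (aux _ _ E k0).
have E : eta / (2 * (M + 1)) * (2 * (M + 1)) = eta by rewrite divfK// gt_eqF.
have w0 : 0 <= eta / (2 * (M + 1)) by rewrite ltW// divr_gt0.
apply: (le_trans (ler_wpM2l w0 (bF L fL))).
by rewrite mulrC; exact: (aux _ _ E w0).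
Qed.

Lemma Vle_bounded_variation F M :
  (forall L, itv_family L -> \sum_(p <- L) `|incr F p| <= M) -> Vle e F (M * `|e 0%N|).
Proof.
move=> bF L fL; apply: (le_trans (snorm_le_sum _ _)).
by rewrite big_map ler_wpM2r// bF.
Qed.

End VleTheory.

Arguments pairs : simpl never.

Lemma pairs_cons (R : realType) (x y : R) (t : seq R) : pairs x (y :: t) = (x, y) :: pairs y t.
Proof. by []. Qed.

(** * Piecewise linear interpolation *)

Section Interpolation.
Context {R : realType}.
Implicit Types (F G : R -> R) (x y : R) (t : seq R).

Definition ramp (p q s : R) : R := Num.min 1 (Num.max 0 ((s - p) / (q - p))).

Lemma ramp_itv p q s : 0 <= ramp p q s <= 1.
Proof. by rewrite /ramp ge_min lexx le_min ler01 le_max lexx. Qed.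

Lemma ramp_left p q s : p < q -> s <= p -> ramp p q s = 0.
Proof.
move=> pq sp; rewrite /ramp max_l ?min_r//.
by rewrite pmulr_lle0 ?subr_le0// invr_gt0 subr_gt0.
Qed.

Lemma ramp_right p q s : p < q -> q <= s -> ramp p q s = 1.
Proof.
move=> pq qs; have h : 1 <= (s - p) / (q - p).
  by rewrite ler_pdivlMr ?subr_gt0// mul1r lerD2r.
by rewrite /ramp max_r ?min_l// (le_trans ler01).
Qed.

Lemma ramp_mid p q s : p < q -> p <= s <= q -> ramp p q s = (s - p) / (q - p).
Proof.
move=> pq /andP[ps sq]; have qp : 0 < q - p by rewrite subr_gt0.
rewrite /ramp max_r ?min_r//; first by rewrite ler_pdivrMr// mul1r lerD2r.
by rewrite divr_ge0 ?subr_ge0// ltW.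
Qed.

Lemma ramp_le p q s u : p < q -> s <= u -> ramp p q s <= ramp p q u.
Proof.
move=> pq su; have : (s - p) / (q - p) <= (u - p) / (q - p).
  by rewrite ler_wpM2r ?invr_ge0 ?subr_ge0 ?(ltW pq)// lerD2r.
rewrite /ramp; set a := (s - p) / (q - p); set b := (u - p) / (q - p) => ab.
by rewrite le_min !ge_min lexx/= le_max !ge_max; case: (leP b 0) => b0;
  rewrite ?ab ?orbT//; apply/orP; right; rewrite ?(ltW b0)//; lra.
Qed.

Lemma ramp_lipschitz p q s u : p < q -> s <= u ->
  ramp p q u - ramp p q s <= (u - s) / (q - p).
Proof.
move=> pq su; have qp : 0 < q - p by rewrite subr_gt0.
have mono c : c / (q - p) = c * (q - p)^-1 by [].
have us0 : 0 <= (u - s) / (q - p) by rewrite divr_ge0 ?subr_ge0// ltW.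
have E : (u - p) / (q - p) = (s - p) / (q - p) + (u - s) / (q - p).
  by rewrite -mulrDl; congr (_ / _); lra.
rewrite /ramp E; move: us0; set a := (s - p) / (q - p); set b := (u - s) / (q - p) => b0.
rewrite /Num.min /Num.max; case: ifPn; case: ifPn; case: ifPn; case: ifPn; rewrite -?leNgt => *; lra.
Qed.

(** Piecewise linear interpolation at the nodes, constant beyond the first and the last one. The sum
    of ramps makes it visibly linear in [G] and, up to the constant [G x], a primitive of a step
    function. *)
Definition interp G x t (s : R) : R :=
  G x + \sum_(p <- pairs x t) incr G p * ramp p.1 p.2 s.

Lemma interp_nil G x s : interp G x [::] s = G x.
Proof. by rewrite /interp big_nil addr0. Qed.

Lemma path_lt_le x t y : path <%R x t -> y \in t -> x < y.
Proof. by rewrite (path_sortedE lt_trans) => /andP[/allP H _ /H]. Qed.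

Lemma path_lt_last x t y : path <%R x t -> y \in x :: t -> y <= last x t.
Proof.
elim: t x y => [|z t IH] x y /=; first by move=> _; rewrite inE => /eqP ->.
move=> /andP[xz pz]; rewrite inE => /predU1P[->|]; last exact: IH.
by apply: (le_trans (ltW xz)); exact: (IH z z pz (mem_head _ _)).
Qed.

Lemma pairs_mem x t p : path <%R x t -> p \in pairs x t ->
  [/\ x <= p.1, p.1 < p.2, p.1 \in x :: t & p.2 \in t].
Proof.
elim: t x => //= y t IH x /andP[xy pt]; rewrite pairs_cons inE => /predU1P[->|/(IH _ pt)[yp p12 p1 p2]].
  by rewrite /= lexx xy !mem_head.
by rewrite (le_trans (ltW xy) yp) p12 !inE -in_cons p1 p2 !orbT.
Qed.

Lemma interp_left G x t s : path <%R x t -> s <= x -> interp G x t s = G x.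
Proof.
move=> pt sx; rewrite /interp big_seq big1 ?addr0// => p /(pairs_mem pt)[xp p12 _ _].
by rewrite ramp_left ?mulr0// (le_trans sx).
Qed.

Lemma interp_cons_left G x y t s : path <%R x (y :: t) -> s <= y ->
  interp G x (y :: t) s = G x + (G y - G x) * ramp x y s.
Proof.
move=> /= /andP[xy pt] sy; rewrite /interp pairs_cons big_cons /=.
rewrite [X in _ + (_ + X)]big_seq big1 ?addr0// => p /(pairs_mem pt)[xp p12 _ _].
by rewrite ramp_left ?mulr0// (le_trans sy).
Qed.

Lemma interp_cons_right G x y t s : x < y -> y <= s ->
  interp G x (y :: t) s = interp G y t s.
Proof.
move=> xy ys; rewrite /interp pairs_cons big_cons /= ramp_right// mulr1 addrA; congr (_ + _).
by rewrite /incr /= addrC subrK.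
Qed.

Lemma interp_node G x t y : path <%R x t -> y \in x :: t -> interp G x t y = G y.
Proof.
elim: t x => [|z t IH] x; first by rewrite inE => _ /eqP ->; rewrite interp_nil.
move=> pt; rewrite inE => /predU1P[->|yz]; first by rewrite interp_left.
move: (pt) => /= /andP[xz pz].
have zy : z <= y by move: yz; rewrite inE => /predU1P[->//|/(path_lt_le pz)/ltW].
by rewrite interp_cons_right// IH.
Qed.

Lemma interp_local x t s : path <%R x t -> x < s <= last x t ->
  exists p, [/\ p \in pairs x t, p.1 <= s <= p.2 & forall G,
    interp G x t s = G p.1 + (G p.2 - G p.1) * ramp p.1 p.2 s].
Proof.
elim: t x => [|y t IH] x pt /=; first by move=> /andP[xs /(lt_le_trans xs)]; rewrite ltxx.
move=> /andP[xs sl]; have [sy|ys] := leP s y.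
  exists (x, y); rewrite pairs_cons mem_head (ltW xs) sy; split => // G.
  exact: interp_cons_left.
move: (pt) => /= /andP[xy pt'].
have [|p [pp ps pG]] := IH y pt'; first by rewrite ys sl.
exists p; rewrite pairs_cons inE pp orbT; split => // G.
by rewrite interp_cons_right ?(ltW ys).
Qed.

(* For fixed [th] a monotone map from [x, last x t] to the nodes; averaging
   [G \o snap th x t] over [th] in (0, 1] gives [interp G x t], which is how
   interpolation is seen not to increase the variation. *)
Fixpoint snap (th : R) x t (s : R) : R :=
  if t is y :: t' then (if ramp x y s < th then x else snap th y t' s) else x.

Lemma snap_mem th x t s : snap th x t s \in x :: t.
Proof.
elim: t x => [|y t IH] x /=; first exact: mem_head.
by case: ifP => _; rewrite ?mem_head// inE IH orbT.
Qed.

Lemma snap_ge th x t s : path <%R x t -> x <= snap th x t s.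
Proof.
move=> pt; have := snap_mem th x t s; rewrite inE => /predU1P[->//|/(path_lt_le pt)].
exact: ltW.
Qed.

Lemma snap_le th x t s u : path <%R x t -> s <= u -> snap th x t s <= snap th x t u.
Proof.
move=> + su; elim: t x => [|y t IH] x //= /andP[xy pt].
case: ifPn => [_|nx]; first by case: ifPn => // _; rewrite (le_trans (ltW xy))// snap_ge.
rewrite ifN ?IH//; apply: contra nx => ru; apply: le_lt_trans ru.
exact: ramp_le.
Qed.

Lemma snapE th G x t s : 0 < th <= 1 -> path <%R x t ->
  G (snap th x t s) = G x + \sum_(p <- pairs x t) incr G p * (th <= ramp p.1 p.2 s)%R%:R.
Proof.
move=> /andP[th0 th1]; elim: t x => [|y t IH] x; first by rewrite /= big_nil addr0.
move=> /= /andP[xy pt]; rewrite pairs_cons big_cons/=; case: ifPn => [rx|].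
  rewrite leNgt rx mulr0 add0r big_seq big1 ?addr0// => p /(pairs_mem pt)[yp p12 _ _].
  rewrite ramp_left//; first by rewrite leNgt th0 mulr0.
  apply: le_trans yp; rewrite leNgt; apply/negP => ys.
  by move: rx; rewrite ramp_right ?(ltW ys)// ltNge th1.
rewrite -leNgt => rx; rewrite rx mulr1 IH// addrA; congr (_ + _).
by rewrite /incr /= addrC subrK.
Qed.

(** A Riemann sum for [r], seen as the measure of the thresholds in (0, 1] not exceeding [r]; the
    number of such grid thresholds is the integer part of [r * m.+1]. *)
Lemma threshold_count (m : nat) (r : R) : 0 <= r <= 1 ->
  `|r - \sum_(j < m.+1) m.+1%:R^-1 * (j.+1%:R / m.+1%:R <= r)%R%:R| <= m.+1%:R^-1.
Proof.
move=> /andP[r0 r1]; have m0 : 0 < (m.+1%:R : R) by rewrite ltr0n.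
have mr0 : 0 <= r * m.+1%:R by rewrite mulr_ge0// ltW.
set k := Num.truncn (r * m.+1%:R).
have km : (k <= m.+1)%N.
  rewrite -(ler_nat R); apply: le_trans (_ : r * m.+1%:R <= _).
    by have /andP[] := truncn_itv mr0.
  by rewrite -[leRHS]mul1r ler_wpM2r// ltW.
have -> : \sum_(j < m.+1) m.+1%:R^-1 * (j.+1%:R / m.+1%:R <= r)%R%:R = k%:R / m.+1%:R :> R.
  rewrite -mulr_sumr mulrC; congr (_ / _).
  rewrite (eq_bigr (fun j : 'I_m.+1 => (j < k)%N%:R)); last first.
    by move=> j _; rewrite ler_pdivrMr// /k truncn_gt_nat.
  rewrite -natr_sum; congr (_%:R).
  rewrite -(big_mkord xpredT (fun j => nat_of_bool (j < k)%N)) (big_cat_nat (n := k))//=.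
  rewrite (eq_big_nat _ _ (F2 := fun=> 1%N)); last by move=> i /andP[_ ->].
  rewrite [X in (_ + X)%N](eq_big_nat _ _ (F2 := fun=> 0%N)); last by move=> i /andP[ki _]; rewrite ltnNge ki.
  by rewrite !sum_nat_const_nat muln1 subn0 muln0 addn0.
have /andP[k1 k2] := truncn_itv mr0.
have -> : r - k%:R / m.+1%:R = (r * m.+1%:R - k%:R) / m.+1%:R.
  by rewrite mulrBl mulfK// gt_eqF.
rewrite normrM ger0_norm ?subr_ge0// gtr0_norm ?invr_gt0//.
rewrite ler_pdivrMr// mulVf ?gt_eqF//.
by move: k2; rewrite -[(Num.truncn _).+1%:R]natr1 -/k; lra.
Qed.

Lemma interp_snap_cvg G x t s : path <%R x t ->
  \sum_(j < m.+1) m.+1%:R^-1 * G (snap (j.+1%:R / m.+1%:R) x t s) @[m --> \oo]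
    --> interp G x t s.
Proof.
move=> pt.
have inv_cvg : (m.+1%:R^-1 : R) @[m --> \oo] --> 0 by exact: cvg_harmonic.
pose A (m : nat) (r : R) : R := \sum_(j < m.+1) m.+1%:R^-1 * (j.+1%:R / m.+1%:R <= r)%R%:R.
have A_cvg (r : R) : 0 <= r <= 1 -> A m r @[m --> \oo] --> r.
  move=> r01; apply/cvgrPdist_le => eta eta0; near=> m.
  apply: (le_trans (threshold_count m r01)).
  near: m; move/cvgrPdist_le: inv_cvg => /(_ _ eta0); apply: filterS => m.
  by rewrite sub0r normrN ger0_norm.
have -> : (fun m => \sum_(j < m.+1) m.+1%:R^-1 * G (snap (j.+1%:R / m.+1%:R) x t s)) =
    (fun m => G x + \sum_(p <- pairs x t) incr G p * A m (ramp p.1 p.2 s)).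
  apply/funext => m.
  have m0 : 0 < (m.+1%:R : R) by rewrite ltr0n.
  rewrite (eq_bigr (fun j : 'I_m.+1 => m.+1%:R^-1 * G x + \sum_(p <- pairs x t)
     incr G p * (m.+1%:R^-1 * (j.+1%:R / m.+1%:R <= ramp p.1 p.2 s)%R%:R))); last first.
    move=> j _; rewrite (@snapE _ G)//; last first.
      by rewrite divr_gt0//= ler_pdivrMr// mul1r ler_nat.
    rewrite mulrDr mulr_sumr; congr (_ + _); apply: eq_bigr => p _.
    by rewrite mulrCA.
  rewrite big_split/= sumr_const card_ord -mulrnAl -mulr_natr mulVf ?gt_eqF// mul1r.
  congr (_ + _); rewrite exchange_big/=; apply: eq_bigr => p _.
  by rewrite -mulr_sumr.
rewrite /interp; apply: cvgD; first exact: cvg_cst.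
elim: (pairs x t) => [|p s' IH].
  rewrite big_nil (_ : (fun m => _) = cst 0); first exact: cvg_cst.
  by apply/funext => m; rewrite big_nil.
rewrite big_cons (_ : (fun m => _) = (fun m => incr G p * A m (ramp p.1 p.2 s) +
  \sum_(p <- s') incr G p * A m (ramp p.1 p.2 s))); last first.
  by apply/funext => m; rewrite big_cons.
apply: cvgD IH; apply: cvgMr; apply: A_cvg; exact: ramp_itv.
Unshelve. all: by end_near. Qed.

End Interpolation.

Section InterpolationNorm.
Context {R : realType} {X : normedModType R} (e : symmetric_basis X).
Implicit Types (F G : R -> R) (x y : R) (t : seq R).

Lemma Vle_interp G t C : path <%R 0 t -> last 0 t <= 1 -> Vle e G C ->
  Vle e (interp G 0 t) C.
Proof.
move=> pt tl HG; have C0 := Vle_ge0 HG.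
apply: (@Vle_lim _ _ _ nat \oo (fun m s =>
  \sum_(j < m.+1) m.+1%:R^-1 * G (snap (j.+1%:R / m.+1%:R) 0 t s))).
  by move=> s _; exact: interp_snap_cvg.
apply: nearW => m.
have m0 : 0 < (m.+1%:R : R) by rewrite ltr0n.
have := @Vle_sum _ _ e _ (index_enum 'I_m.+1)
  (fun j s => m.+1%:R^-1 * G (snap (j.+1%:R / m.+1%:R) 0 t s)) (fun j => `|m.+1%:R^-1| * C).
have -> : \sum_(j < m.+1) `|m.+1%:R^-1| * C = C.
  by rewrite sumr_const card_ord ger0_norm// -[LHS]mulr_natl mulrA mulfV ?gt_eqF// mul1r.
apply => j; apply: VleZ.
apply: (@Vle_comp _ _ _ G C (snap (j.+1%:R / m.+1%:R) 0 t)) => // [s _|s u _ su _].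
  rewrite snap_ge//=; apply: le_trans tl.
  have := snap_mem (j.+1%:R / m.+1%:R) 0 t s.
  exact: path_lt_last.
exact: snap_le.
Qed.

Lemma ramp_variation p q (L : seq (R * R)) : p < q -> itv_family L ->
  \sum_(r <- L) `|incr (ramp p q) r| <= 1.
Proof.
move=> pq fL; apply: le_trans (monotone_variation _ fL) _.
  by move=> x y _ xy _; exact: ramp_le.
by have /andP[_ H1] := ramp_itv p q 1; have /andP[H2 _] := ramp_itv p q 0; lra.
Qed.

Hypothesis HX : reflexive_space X.

Lemma Vsmall_ramp p q : p < q -> Vsmall e (ramp p q).
Proof.
move=> pq; have qp : 0 < q - p by rewrite subr_gt0.
apply: (@Vsmall_bounded_variation _ _ e HX _ 1).
  move=> eta eta0; exists (eta * (q - p)); first by rewrite mulr_gt0.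
  move=> x y _ xy _ yx; rewrite ger0_norm ?subr_ge0 ?ramp_le//.
  by apply: (le_trans (ramp_lipschitz pq xy)); rewrite ler_pdivrMr.
by move=> L; exact: ramp_variation.
Qed.

Lemma Vsmall_interp G x t : path <%R x t -> Vsmall e (interp G x t).
Proof.
move=> pt; apply: VsmallD; first exact: Vsmall_cst.
elim: t x pt => [|y t IH] x.
  by move=> _; apply: eq_Vsmall (Vsmall_cst e 0) => s _; rewrite big_nil.
move=> /= /andP[xy /IH H].
apply: (@eq_Vsmall _ _ e (fun s => incr G (x, y) * ramp x y s +
  \sum_(p <- pairs y t) incr G p * ramp p.1 p.2 s)).
  by move=> s _; rewrite pairs_cons big_cons.
by apply: VsmallD => //; apply: VsmallZ; exact: Vsmall_ramp.
Qed.

(** Left endpoints of nondegenerate non-overlapping intervals are distinct, and so are right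
    endpoints; each of the two lists contributes [C]. *)
Lemma Vle_points (g : R -> R) C :
  (forall s, uniq s -> (forall x, x \in s -> 0 <= x <= 1) -> snorm e (map g s) <= C) ->
  Vle e g (2 * C).
Proof.
move=> gC L fL.
rewrite -snorm_incr_nondegenerate//.
set L1 := [seq p <- L | p.1 < p.2].
have fL1 : itv_family L1 by apply: family_subseq fL; exact: seq.filter_subseq.
have [u1 u2] : uniq (map fst L1) /\ uniq (map snd L1).
  have : pairwise (@nonoverlap R) L1 := (andP fL1).2.
  have nd : all (fun p => p.1 < p.2) L1 by apply/allP => p; rewrite mem_filter => /andP[].
  elim: L1 nd {fL1} => //= p s IH /andP[p12 nd] /andP[/allP np /(IH nd)[-> ->]].
  rewrite !andbT; split; apply/mapP => -[q qs E]; have := np _ qs;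
    have q12 := allP nd _ qs; rewrite /nonoverlap E => /orP[]; move: p12 q12; rewrite ?E; lra.
rewrite mulr2n mulrDl mul1r; apply: (le_trans (snorm_mapB _ _ _ _)).
rewrite (map_comp g snd) (map_comp g fst).
apply: lerD; apply: gC => // x /mapP[p /(family_itv01 fL1)[p0 p12 p1] ->].
  by rewrite p1 (le_trans p0).
by rewrite p0 (le_trans p12).
Qed.

Lemma Vle_finite_support (g : R -> R) (S : seq R) : uniq S ->
  (forall x, x \notin S -> g x = 0) -> Vle e g (2 * snorm e (map g S)).
Proof.
move=> uS gS; apply: Vle_points => s us _.
rewrite -(@snorm_map_filter _ _ e _ (mem S)); last by move=> x _ /gS.
apply: snorm_uniq_sub; first exact: filter_uniq.
by move=> x; rewrite mem_filter => /andP[].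
Qed.

(** Each value is an increment from a zero of [F] lying between the point and its predecessor, or
    from 0 for the first point; the resulting intervals do not overlap. *)
Lemma snorm_separated F C l : F 0 = 0 -> Vle e F C -> uniq l ->
  (forall x, x \in l -> 0 <= x <= 1) ->
  (forall x y, x \in l -> y \in l -> x < y -> exists2 d, x <= d <= y & F d = 0) ->
  snorm e (map F l) <= C.
Proof.
move=> F0 HF ul l01 sep.
pose t := sort <=%R l.
have pt : perm_eq l t by rewrite perm_sym perm_sort.
rewrite (snorm_perm e (perm_map F pt)).
have st : sorted <%R t by rewrite lt_sorted_uniq_le sort_uniq ul sort_le_sorted.
have mt : t =i l by move=> x; rewrite mem_sort.
have {}l01 x : x \in t -> 0 <= x <= 1 by rewrite mt; exact: l01.
have {}sep x y : x \in t -> y \in t -> x < y -> exists2 d, x <= d <= y & F d = 0.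
  by rewrite !mt; exact: sep.
suff H (u : seq R) z : F z = 0 -> 0 <= z -> sorted <%R u ->
    (forall x, x \in u -> 0 <= x <= 1) ->
    (forall x y, x \in u -> y \in u -> x < y -> exists2 d, x <= d <= y & F d = 0) ->
    all (fun y => z <= y) u ->
    exists L, [/\ itv_family L, map (incr F) L = map F u & all (fun q => z <= q.1) L].
  have t0 : all (fun y => 0 <= y) t by apply/allP => y /l01/andP[].
  by have [L [fL EL _]] := H t 0 F0 (lexx _) st l01 sep t0; rewrite -EL; exact: HF.
elim: u z {t pt st mt l01 sep} => [|a t IH] z Fz z0 st l01 sep zt.
  by exists [::].
have /= /andP[za _] := zt; have /andP[a0 a1] := l01 _ (mem_head _ _).
case: t IH st l01 sep {zt} => [|b t] IH st l01 sep.
  exists [:: (z, a)]; split; [exact: family1|by rewrite /= /incr/= Fz subr0|by rewrite /= lexx].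
have /= /andP[ab pbt] := st.
have [||d /andP[ad db] Fd] := sep a b _ _ ab; rewrite ?inE ?eqxx ?orbT//.
have [|||||L [fL EL dL]] := IH d Fd.
- exact: le_trans ad.
- by [].
- by move=> x xt; apply: l01; rewrite inE xt orbT.
- by move=> x y xt yt; apply: sep; rewrite inE ?xt ?yt orbT.
- apply/allP => y; rewrite inE => /predU1P[->//|yt].
  by apply: (le_trans db); apply/ltW; exact: path_lt_le yt.
exists ((z, a) :: L); split.
- have /andP[aL pL] := fL; rewrite /itv_family /= aL pL /itv01 /= z0 za a1 !andbT /=.
  by apply/allP => q /(allP dL) dq; rewrite /nonoverlap /= (le_trans ad).
- by rewrite /= EL /incr /= Fz subr0.
- rewrite /= lexx /=; apply/allP => q /(allP dL); apply: le_trans.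
  exact: le_trans ad.
Qed.

End InterpolationNorm.

(** * The spaces V and V^0, point evaluations and interpolation operators *)

Section Spaces.
Context {R : realType} {X : normedModType R} (e : symmetric_basis X).

Definition res (F : R -> R) : unit_interval R -> R^o := fun x => F (\val x).

Lemma ext_res F x : 0 <= x <= 1 -> ext (res F) x = F x.
Proof. by move=> x01; rewrite /ext /res clampE. Qed.

Lemma clamp0 : clamp (0 : R) = I0.
Proof. by apply/val_inj; rewrite clampE// lexx ler01. Qed.

Lemma ext_val (f : unit_interval R -> R) x : ext f (\val x) = f x.
Proof. by rewrite /ext clampK. Qed.

Lemma V_Vle (f : V_space e) : Vle e (ext f) `|f|.
Proof.
by apply/Vle_norm; rewrite -[`|f|]/(fine (V_norm e f)) fineK// V_norm_fin// V_funP.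
Qed.

Lemma V_norm_le (f : V_space e) C : Vle e (ext f) C -> `|f| <= C.
Proof.
move=> /Vle_norm H; rewrite -lee_fin -[`|f|]/(fine (V_norm e f)) fineK//.
exact/V_norm_fin/V_funP.
Qed.

Lemma V0_Vle (f : V0_space e) : Vle e (ext f) `|f|.
Proof.
apply/Vle_norm; rewrite -[`|f|]/(fine (V_norm e f)) fineK// V_norm_fin//.
exact: V0_in_V.
Qed.

Lemma V0_norm_le (f : V0_space e) C : Vle e (ext f) C -> `|f| <= C.
Proof.
move=> /Vle_norm H; rewrite -lee_fin -[`|f|]/(fine (V_norm e f)) fineK//.
exact/V_norm_fin/V0_in_V.
Qed.

Lemma V0_small (f : V0_space e) : Vsmall e (ext f).
Proof. by have /V0_predP[] := V0_funP f. Qed.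

Lemma V_at0 (f : V_space e) : ext f 0 = 0.
Proof. by rewrite /ext clamp0; have /V_predP[] := V_funP f. Qed.

Lemma V0_at0 (f : V0_space e) : ext f 0 = 0.
Proof. by rewrite /ext clamp0; have /V_predP[] := V0_in_V f. Qed.

Lemma V_predI F C : F 0 = 0 -> Vle e F C -> res F \in V_pred e.
Proof.
move=> F0 HF; apply/V_predP; split; first by rewrite /res /=.
by exists C; apply: eq_Vle HF => x x01; rewrite ext_res.
Qed.

Lemma V0_predI F C : F 0 = 0 -> Vle e F C -> Vsmall e F -> res F \in V0_pred e.
Proof.
move=> F0 HF sF; apply/V0_predP; split; first exact: V_predI HF.
by apply: eq_Vsmall sF => x x01; rewrite ext_res.
Qed.

Definition V0_to_V (f : V0_space e) : V_space e := VSpace (V0_in_V f).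

Lemma delta_subproof (t : unit_interval R) :
  (fun f : V0_space e => f t : R^o) \in @continuous_functional R (V0_space e).
Proof.
apply: (@bounded_linear_dual _ _ _ (`|e 0%N|^-1)); first by move=> a f g.
move=> f; rewrite ler_pdivlMl ?basis_norm_gt0// mulrC.
have := Vle_point (V0_Vle f) (lexx 0) (unit_interval_ge0 t) (unit_interval_le1 t).
by rewrite V0_at0 subr0 ext_val.
Qed.

Definition delta (t : unit_interval R) : dual (V0_space e) := Dual (delta_subproof t).

(** The point 0 is left out because it heads every path [0 :: grid D]; 1 is added so that the
    partition always reaches the right end. *)
Definition grid (D : seq R) : seq R :=
  sort <=%R (undup [seq x <- 1 :: D | 0 < x <= 1]).

Lemma mem_grid D x : (x \in grid D) = (0 < x <= 1) && ((x == 1) || (x \in D)).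
Proof. by rewrite mem_sort mem_undup mem_filter inE. Qed.

Lemma grid_path D : path <%R 0 (grid D).
Proof.
rewrite (path_sortedE lt_trans); apply/andP; split.
  by apply/allP => x; rewrite mem_grid => /andP[/andP[]].
by rewrite lt_sorted_uniq_le sort_uniq undup_uniq sort_le_sorted.
Qed.

Lemma grid_last D : last 0 (grid D) = 1.
Proof.
apply/eqP; rewrite eq_le; apply/andP; split.
  have := mem_last 0 (grid D); rewrite inE => /predU1P[->//|].
  by rewrite mem_grid => /andP[/andP[]].
apply: (path_lt_last (grid_path D)).
by rewrite inE mem_grid ltr01 lexx eqxx orbT.
Qed.

Hypothesis HX : reflexive_space X.

Lemma interpV0_subproof D (G : V_space e) :
  res (interp (ext G) 0 (grid D)) \in V0_pred e.
Proof.
have pg := grid_path D.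
apply: (@V0_predI _ `|G|).
- by rewrite interp_left// V_at0.
- by apply: Vle_interp => //; [rewrite grid_last|exact: V_Vle].
- exact: Vsmall_interp.
Qed.

Definition interpV0 D (G : V_space e) : V0_space e := V0Space (interpV0_subproof D G).

Lemma ext_interpV0 D G x : 0 <= x <= 1 ->
  ext (interpV0 D G) x = interp (ext G) 0 (grid D) x.
Proof. exact: ext_res. Qed.

Lemma interpV0_norm D G : `|interpV0 D G| <= `|G|.
Proof.
apply: V0_norm_le; apply: (@eq_Vle _ _ _ (interp (ext G) 0 (grid D))).
  by move=> x x01; rewrite ext_interpV0.
by apply: Vle_interp; [exact: grid_path|rewrite grid_last|exact: V_Vle].
Qed.

Lemma interpV0_node D G (t : unit_interval R) : \val t \in D -> interpV0 D G t = G t.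
Proof.
move=> tD; have /andP[t0 t1] := valP t.
rewrite -[LHS]ext_val ext_interpV0 ?t0//.
rewrite -(ext_val G); move: t0; rewrite le_eqVlt => /predU1P[<-|t0].
  by rewrite interp_left// grid_path.
by rewrite interp_node ?grid_path// inE mem_grid t0 t1 tD orbT orbT.
Qed.

Lemma interpV0_linear D a (G H : V_space e) :
  interpV0 D (a *: G + H) = a *: interpV0 D G + interpV0 D H.
Proof.
apply/val_inj/funext => x; rewrite /= /res /interp (V_at0 (a *: G + H)) add0r.
rewrite -[RHS]/(a * (ext G 0 + \sum_(p <- pairs 0 (grid D)) incr (ext G) p * ramp p.1 p.2 (\val x)) +
  (ext H 0 + \sum_(p <- pairs 0 (grid D)) incr (ext H) p * ramp p.1 p.2 (\val x))).
rewrite !V_at0 !add0r mulr_sumr -big_split/=; apply: eq_bigr => p _.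
have E y : ext (a *: G + H) y = a * ext G y + ext H y by [].
by rewrite /incr !E; lra.
Qed.

(* Meant for [0 <= p.1 < p.2]: for [p.1 < 0] the ramp need not vanish at 0, and this is
   the junk value 0. *)
Definition rampV0 p : V0_space e := insubd (0 : V0_space e) (res (ramp p.1 p.2)).

Lemma rampV0E p x : 0 <= p.1 -> p.1 < p.2 -> rampV0 p x = ramp p.1 p.2 (\val x).
Proof.
move=> p0 p12; rewrite /rampV0 -[LHS]/(\val (insubd _ _) x) val_insubd ifT//.
apply: (@V0_predI _ (1 * `|e 0%N|)).
- by rewrite ramp_left.
- by apply: Vle_bounded_variation => L; exact: ramp_variation.
- exact: Vsmall_ramp.
Qed.

Lemma interpV0E D (G : V_space e) :
  interpV0 D G = \sum_(p <- pairs 0 (grid D)) incr (ext G) p *: rampV0 p.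
Proof.
apply/val_inj/funext => x.
have sumE (r : seq (R * R)) (f : R * R -> V0_space e) :
   \val (\sum_(p <- r) f p) x = \sum_(p <- r) f p x.
  by elim: r => [|p r IH]; rewrite ?big_nil// !big_cons -IH.
rewrite sumE /= /res /interp V_at0 add0r big_seq [RHS]big_seq; apply: eq_bigr => p pp.
have [p0 p12 _ _] := pairs_mem (grid_path D) pp.
by rewrite -[RHS]/(incr (ext G) p * rampV0 p x) rampV0E.
Qed.

(** The adjoint of the interpolation operator, which turns any functional into a finite combination
    of point evaluations. *)
Definition interp_dual D (phi : dual (V0_space e)) : dual (V0_space e) :=
  \sum_(p <- pairs 0 (grid D)) phi (rampV0 p) *: (delta (clamp p.2) - delta (clamp p.1)).

Lemma interp_dualE D phi f : interp_dual D phi f = phi (interpV0 D (V0_to_V f)).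
Proof.
rewrite interpV0E dual_sum dual_sumE; apply: eq_bigr => p _.
by rewrite dualZ mulrC.
Qed.

(** The norm dominates every point evaluation, so a pointwise limit exists; lower semicontinuity of
    the variation then gives convergence in norm and membership in V^0. Simons' argument needs this
    completeness to sum its series. *)
Lemma V0_cauchy_cvg (F : set_system (V0_space e)) : ProperFilter F -> cauchy F -> cvg F.
Proof.
move=> PF /cauchy_ballP cF.
have near_ball eps : 0 < eps -> exists2 f0 : V0_space e, True & F [set f | `|f0 - f| <= eps].
  move=> eps0; have [[A B] [FA FB] AB] := cF _ eps0.
  have [f0 Af0] := filter_ex FA; exists f0 => //.
  apply: filterS FB => f Bf; have := AB (f0, f) (conj Af0 Bf).
  by rewrite /= -ball_normE => /ltW.
have c0 := basis_norm_gt0 e.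
have pt (f g : V0_space e) t : `|f t - g t| * `|e 0%N| <= `|f - g|.
  have := Vle_point (V0_Vle (f - g)) (lexx 0) (unit_interval_ge0 t) (unit_interval_le1 t).
  by rewrite V0_at0 subr0 ext_val.
have /choice[L HL] : forall t : unit_interval R, exists l : R, (f : V0_space e) t @[f --> F] --> l.
  move=> t; apply/cvg_ex; apply: cauchy_cvg; apply/cauchy_exP => eps eps0.
  have [f0 _ Ff0] := near_ball _ (mulr_gt0 (divr_gt0 eps0 (ltr0Sn R 1)) c0).
  exists (f0 t); suff : F [set f : V0_space e | `|f0 t - f t| < eps] by [].
  apply: filterS Ff0 => f /= Hf.
  have := le_trans (pt f0 f t) Hf; rewrite ler_pM2r// => /le_lt_trans; apply.
  by rewrite ltr_pdivrMr// mulr_natr mulr2n ltrDl.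
have close eps : 0 < eps -> exists2 f0 : V0_space e,
    F [set f | `|f0 - f| <= eps] & Vle e (fun x => ext L x - ext f0 x) eps.
  move=> /near_ball[f0 _ Ff0]; exists f0 => //.
  apply: (@Vle_lim _ _ _ _ F (fun (f : V0_space e) x => ext f x - ext f0 x)).
    by move=> x _; apply: cvgB; [exact: HL|exact: cvg_cst].
  apply: filterS Ff0 => f /= Hf.
  apply: (@Vle_trans _ _ _ _ `|f - f0|); first by rewrite distrC.
  exact: (V0_Vle (f - f0)).
have LV0 : (L : unit_interval R -> R^o) \in V0_pred e.
  apply/V0_predP; split; last first.
    by apply: Vsmall_closed => eta /close[f0 _ Hf0]; exists (ext f0) => //; exact: V0_small.
  apply/V_predP; split.
    apply: (cvg_unique (@Rhausdorff R) (HL I0)).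
    by apply: cvg_near_cst; apply: nearW => f; rewrite -clamp0; exact: V0_at0.
  have [f0 _ Hf0] := close 1 ltr01; exists (1 + `|f0|).
  by apply: eq_Vle (VleD Hf0 (V0_Vle f0)) => x _; rewrite subrK.
apply/cvg_ex; exists (V0Space LV0); apply/(@cvgrPdist_le _ _ _ F _ idfun) => eps eps0.
have [f0 Ff0 Hf0] := close _ (divr_gt0 eps0 (ltr0Sn R 1)).
apply: filterS Ff0 => f /= Hf; rewrite (splitr eps).
rewrite -(subrK f0 (V0Space LV0)) -addrA; apply: (le_trans (ler_normD _ _)).
by apply: lerD Hf; exact: V0_norm_le.
Qed.

HB.instance Definition _ := Uniform_isComplete.Build (V0_space e) V0_cauchy_cvg.


End Spaces.

(** * Norm attainment on sequences of intervals *)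

Section Attain.
Context {R : realType} {X : normedModType R} (e : symmetric_basis X).

Lemma cvg_le_filter (I : Type) (U : set_system I) (f g : I -> R) (a b : R) : ProperFilter U ->
  f i @[i --> U] --> a -> g i @[i --> U] --> b -> U [set i | f i <= g i] -> a <= b.
Proof.
move=> PU fa gb H; rewrite -subr_ge0; apply: (cvgr_to_ge (cvgB gb fa)).
by apply: filterS H => i /=; rewrite subr_ge0.
Qed.

Lemma pairwise_uniq_nonoverlap (L : seq (R * R)) : uniq L ->
  (forall p q, p \in L -> q \in L -> p != q -> nonoverlap p q) -> pairwise (@nonoverlap R) L.
Proof.
elim: L => //= p L IH /andP[pL uL] H; rewrite IH//; last first.
  by move=> q r qL rL; apply: H; rewrite inE ?qL ?rL orbT.
rewrite andbT; apply/allP => q qL; apply: H; rewrite ?inE ?eqxx ?qL ?orbT//.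
by apply: contraNneq pL => ->.
Qed.

Definition len (p : R * R) := p.2 - p.1.

Lemma sorted_family F L : itv_family L -> exists S : seq (R * R),
  [/\ itv_family S, sorted (fun p q => len q <= len p) S &
      snorm e (map (incr F) L) = snorm e (map (incr F) S)].
Proof.
move=> fL; pose L1 := [seq p <- L | p.1 < p.2].
have fL1 : itv_family L1 by apply: family_subseq fL; exact: seq.filter_subseq.
have uL1 : uniq L1 := nondegenerate_uniq fL.
exists (sort (fun p q => len q <= len p) L1); split.
- have /andP[aL _] := fL1; apply/andP; split.
    by apply/allP => p; rewrite mem_sort; exact: (allP aL).
  apply: pairwise_uniq_nonoverlap; first by rewrite sort_uniq.
  by move=> p q; rewrite !mem_sort; exact: family_nonoverlap.
- by apply: sort_sorted => p q; exact: le_total.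
- have /(perm_map (incr F))/snorm_perm -> :
      perm_eq (sort (fun p q => len q <= len p) L1) L1 by rewrite perm_sort.
  by rewrite snorm_incr_nondegenerate.
Qed.

(** The first J intervals together with [p] are [J.+1] non-overlapping intervals in [0, 1], each at
    least as long as [p]. *)
Lemma sorted_family_len (S : seq (R * R)) p J : itv_family S ->
  sorted (fun p q => len q <= len p) S -> p \in drop J S -> len p <= J.+1%:R^-1.
Proof.
move=> fS sS pS; have tr : transitive (fun p q : R * R => len q <= len p).
  by move=> a b c /= ab bc; exact: le_trans bc ab.
have sub : subseq (rcons (take J S) p) S.
  by rewrite -[X in subseq _ X](cat_take_drop J) -cats1; apply: cat_subseq; rewrite ?sub1seq.
have JS : (J < size S)%N.
  by rewrite ltnNge; apply/negP => SJ; move: pS; rewrite drop_oversize.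
have H : \sum_(q <- rcons (take J S) p) incr id q <= 1.
  have := @family_sum_le R id (rcons (take J S) p); rewrite subr0; apply => //.
  exact: family_subseq sub fS.
rewrite -[leRHS]mul1r ler_pdivlMr//; apply: le_trans H.
have ps : all (fun q => len p <= len q) (rcons (take J S) p).
  rewrite all_rcons lexx/=; have := subseq_sorted tr sub sS.
  rewrite (sorted_pairwise tr) pairwise_rcons => /andP[/allP H _].
  by apply/allP => q /H.
rewrite mulr_natr -[J.+1](_ : size (rcons (take J S) p) = _); last first.
  by rewrite size_rcons size_take JS.
elim: (rcons _ _) ps => [|q s IH] /=; first by rewrite big_nil mulr0n.
by move=> /andP[pq /IH H]; rewrite big_cons mulrS lerD.
Qed.

Hypothesis HX : reflexive_space X.

(* Order nearly optimal families by decreasing length and let the j-th intervals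
   converge: the j-th one has length at most 1/(j+1), so smallness of [z] on short
   intervals keeps the variation from escaping to infinity. *)
Lemma optimal_intervals (z : V0_space e) : exists I : nat -> R * R,
  (forall J, itv_family (mkseq I J)) /\
  forall eta, 0 < eta -> exists J, `|z| - eta <= fnorm e J (fun j => incr (ext z) (I j)).
Proof.
have step1 n : exists S : seq (R * R), [/\ itv_family S, sorted (fun p q => len q <= len p) S &
    `|z| - n.+1%:R^-1 <= snorm e (map (incr (ext z)) S)].
  apply: contrapT => /forallNP H.
  have : `|z| <= `|z| - n.+1%:R^-1.
    apply: V0_norm_le => L fL; rewrite leNgt; apply/negP => /ltW Hz.
    by have [S [fS sS E]] := sorted_family (ext z) fL; apply: (H S); rewrite -E.
  by rewrite -[leLHS]addr0 lerD2l oppr_ge0 leNgt invr_gt0 ltr0n.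
have [S HS] := choice step1.
have [U [UU Uoo]] := infty_ultrafilter.
have PU : ProperFilter U by exact: ultra_proper.
have in01 n j : [/\ 0 <= (nth (0, 0) (S n) j).1, (nth (0, 0) (S n) j).1 <= (nth (0, 0) (S n) j).2
    & (nth (0, 0) (S n) j).2 <= 1].
  have [fS _ _] := HS n; have [jS|jS] := ltnP j (size (S n)).
    exact: family_itv01 fS (mem_nth _ jS).
  by rewrite nth_default//= lexx ler01.
have /choice[A HA] : forall j, exists l : R, (nth (0, 0) (S n) j).1 @[n --> U] --> l.
  move=> j; apply: (@ultra_bounded_cvg _ _ _ _ 1) => n.
  by have [a0 ab b1] := in01 n j; rewrite ger0_norm// (le_trans ab).
have /choice[B HB] : forall j, exists l : R, (nth (0, 0) (S n) j).2 @[n --> U] --> l.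
  move=> j; apply: (@ultra_bounded_cvg _ _ _ _ 1) => n.
  by have [a0 ab b1] := in01 n j; rewrite ger0_norm// (le_trans a0).
have nov n i j : (i < j)%N -> nonoverlap (nth (0, 0) (S n) i) (nth (0, 0) (S n) j).
  move=> ij; have [/andP[_ pS] _ _] := HS n; have [jS|jS] := ltnP j (size (S n)).
    by apply: (pairwiseP (0, 0) pS) => //; rewrite inE (ltn_trans ij).
  rewrite [X in nonoverlap _ X]nth_default// /nonoverlap /=.
  by have [-> _ _] := in01 n i; rewrite orbT.
have AB j : [/\ 0 <= A j, A j <= B j & B j <= 1].
  split.
  - by apply: (cvgr_to_ge (HA j)); apply: nearW => n; have [] := in01 n j.
  - by apply: (cvg_le_filter PU (HA j) (HB j)); apply: nearW => n; have [] := in01 n j.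
  - by apply: (cvgr_to_le (HB j)); apply: nearW => n; have [] := in01 n j.
exists (fun j => (A j, B j)); split=> [J|eta eta0].
  apply/andP; split.
    by apply/allP => p /mapP[j _ ->]; have [a ab b] := AB j; rewrite /itv01 a ab b.
  rewrite pairwise_map; have := iota_ltn_sorted 0 J; rewrite (sorted_pairwise ltn_trans).
  apply: sub_pairwise => i j ij; rewrite /nonoverlap /=.
  (* The ultrafilter decides which of the two intervals lies on the left for almost all n, and this
     order passes to the limit. *)
  have [UA|UA] := in_ultra_setVsetC
    [set n | (nth (0, 0) (S n) i).2 <= (nth (0, 0) (S n) j).1] UU.
    by rewrite (cvg_le_filter PU (HB i) (HA j)).
  rewrite (cvg_le_filter PU (HB j) (HA i)) ?orbT//; apply: filterS UA => n /= nle.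
  by have /orP[] := nov n i j ij.
have eta2 : 0 < eta / 2 by rewrite divr_gt0.
have [eps eps0 Heps] := V0_small z eta2.
(* From index J on all intervals are short enough for [z]: half of [eta] pays for them, the other
   half for the defect of the nearly optimal family [S n]. *)
have [J HJ] : exists J : nat, J.+1%:R^-1 <= eps.
  exists (Num.truncn eps^-1); rewrite invf_ple ?posrE// ltW// truncnS_gt//.
exists J; rewrite -snorm_mkseq.
have cz x y : 0 <= y <= 1 -> (forall n, 0 <= x n <= 1) -> x n @[n --> U] --> (y : R) ->
    ext z (x n) @[n --> U] --> ext z y.
  move=> y01 x01 xy; apply/cvgrPdist_le => d d0.
  have [d' d'0 Hd] := Vsmall_continuous (V0_small z) d0.
  move/cvgrPdist_le : xy => /(_ _ d'0); apply: filterS => n Hn.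
  exact: Hd.
have cvgS : snorm e (map (fun j => incr (ext z) (nth (0, 0) (S n) j)) (iota 0 J)) @[n --> U] -->
    snorm e (mkseq (fun j => incr (ext z) (A j, B j)) J).
  apply: cvg_snorm_map => j _; apply: cvgB.
    apply: cz (HB j); first by have [a ab ->] := AB j; rewrite (le_trans a ab).
    by move=> n; have [a ab ->] := in01 n j; rewrite (le_trans a ab).
  apply: cz (HA j); first by have [-> ab b] := AB j; rewrite (le_trans ab b).
  by move=> n; have [-> ab b] := in01 n j; rewrite (le_trans ab b).
apply: (cvgr_to_ge cvgS).
have : U [set n | n.+1%:R^-1 <= eta / 2].
  apply: Uoo; have : ((n.+1%:R^-1 : R) @[n --> \oo] --> (0 : R)) by exact: cvg_harmonic.
  move=> /cvgrPdist_le/(_ _ eta2); apply: filterS => n.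
  by rewrite sub0r normrN ger0_norm.
apply: filterS => n /= Hn; have [fS sS Hz] := HS n.
have fdrop : itv_family (drop J (S n)) by apply: family_subseq fS; exact: drop_subseq.
have tail : snorm e (map (incr (ext z)) (drop J (S n))) <= eta / 2.
  apply: Heps => // p pS; apply: le_trans HJ; exact: sorted_family_len sS pS.
have : snorm e (map (incr (ext z)) (S n)) <= snorm e (map (incr (ext z)) (take J (S n))) +
    snorm e (map (incr (ext z)) (drop J (S n))).
  by rewrite -{1}(cat_take_drop J (S n)) map_cat; exact: snorm_cat.
have : snorm e (map (incr (ext z)) (take J (S n))) <=
    snorm e (map (fun j => incr (ext z) (nth (0, 0) (S n) j)) (iota 0 J)).
  rewrite (map_comp (incr (ext z)) (nth (0, 0) (S n))); apply/snorm_subseq/map_subseq.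
  have [JS|SJ] := leqP J (size (S n)); first by rewrite map_nth_iota0.
  rewrite take_oversize ?(ltnW SJ)// -(subnKC (ltnW SJ)) iotaD map_cat.
  by rewrite map_nth_iota0// take_size; exact: prefix_subseq.
have aux (v i a t d b h : R) : v - i <= a -> i <= h / 2 -> d <= h / 2 -> t <= b -> a <= t + d ->
    v - h <= b by lra.
by move=> H1 H2; exact: aux Hz Hn tail H1 H2.
Qed.

(** T sends f to the vector whose coordinates are the increments of f over the optimal intervals,
    and b is T followed by a norming functional of T z; optimality makes T z as long as z. The
    pointwise limit [K] need not lie in V^0: its own vector of increments exists by bounded
    completeness, has norm at most [eta], and is the weak limit of the vectors of [y n]. *)
Lemma attaining_functional (z : V0_space e) : exists b : dual (V0_space e),
  [/\ b z = `|z|, forall f, b f <= `|f| & forall (y : nat -> V0_space e) (K : R -> R) (M eta : R), (forall n, `|y n| <= M) ->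
    (forall x, 0 <= x <= 1 -> ext (y n) x @[n --> \oo] --> K x) -> Vle e K eta ->
    forall eps, 0 < eps -> \forall n \near \oo, b (y n) <= eta + eps].
Proof.
have [I [fI HI]] := optimal_intervals z.
have fn F C J : Vle e F C -> fnorm e J (fun j => incr F (I j)) <= C.
  by move=> HF; rewrite -snorm_mkseq /mkseq map_comp; apply: HF; exact: fI.
have ex F C : Vle e F C -> exists x : X, bcoord e x = (fun j => incr F (I j)) /\ `|x| <= C.
  move=> HF; have [x [cx sx]] := boundedly_complete HX (fun n => fn F C n HF).
  exists x; split => //; apply: (cvgr_to_le (cvg_norm sx)).
  by apply: nearW => n; exact: fn.
have /choice[T HT] : forall f : V0_space e, exists x : X,
    bcoord e x = (fun j => incr (ext f) (I j)) /\ `|x| <= `|f|.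
  by move=> f; apply: ex; exact: V0_Vle.
have coord_inj x y : bcoord e x = bcoord e y -> x = y.
  move=> xy; apply/eqP; rewrite -subr_eq0; apply/eqP/(@bcoord_eq0 _ _ e) => k.
  by rewrite addrC -scaleN1r bcoord_linear xy mulN1r addNr.
have [psi [psi1 psiz]] := norming_functional (T z).
have lT a f g : T (a *: f + g) = a *: T f + T g.
  apply: coord_inj; apply/funext => k; rewrite bcoord_linear.
  have [-> _] := HT (a *: f + g); have [-> _] := HT f; have [-> _] := HT g.
  have E y : ext (a *: f + g) y = a * ext f y + ext g y by [].
  by rewrite /incr !E; lra.
have psiE x : `|psi x| <= `|x|.
  by apply: (le_trans (dual_norm_le _ _)); rewrite ler_piMl.
have lb : linear (fun f => psi (T f) : R^o).
  by move=> a f g; rewrite lT dualD dualZ.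
have bb f : `|psi (T f)| <= 1 * `|f|.
  by rewrite mul1r; apply: (le_trans (psiE _)); have [] := HT f.
exists (Dual (bounded_linear_dual lb bb)); split => /=.
  rewrite psiz; apply/eqP; rewrite eq_le (HT z).2/=.
  apply/ler_addgt0Pr => eta eta0; have [J HJ] := HI _ eta0.
  rewrite -lerBlDr; apply: (le_trans HJ); rewrite -(HT z).1; exact: fnorm_psum_le.
  by move=> f; apply: (le_trans (ler_norm _)); rewrite -[leRHS]mul1r; exact: bb.
move=> y K M eta yM yK HK eps eps0.
have [xK [cK nK]] := ex _ _ HK.
have : psi (T (y n) - xK) @[n --> \oo] --> (0 : R).
  apply: (weakly_null (M := M + eta) HX) => [n|k].
    apply: (le_trans (ler_normB _ _)); apply: lerD => //.
    by apply: le_trans (yM n); have [] := HT (y n).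
  have E n : bcoord e (T (y n) - xK) k = incr (ext (y n)) (I k) - incr K (I k).
    rewrite addrC -scaleN1r bcoord_linear.
    by rewrite cK (HT (y n)).1; lra.
  have [a ab b] : [/\ 0 <= (I k).1, (I k).1 <= (I k).2 & (I k).2 <= 1].
    apply: (family_itv01 (fI k.+1)); apply/mapP; exists k => //.
    by rewrite mem_iota /= add0n ltnSn.
  rewrite (_ : (fun n => _) = fun n => incr (ext (y n)) (I k) - incr K (I k)); last first.
    by apply/funext => n; exact: E.
  rewrite -(subrr (incr K (I k))); apply: cvgB; last exact: cvg_cst.
  by apply: cvgB; apply: yK; rewrite ?a ?b ?(le_trans a ab) ?(le_trans ab b).
move=> /cvgrPdist_le/(_ _ eps0); apply: filterS => n; rewrite sub0r normrN dualB => Hn.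
have : psi xK <= eta by apply: le_trans nK; apply: le_trans (psiE _); exact: ler_norm.
by have := le_trans (ler_norm _) Hn; lra.
Qed.

End Attain.

Lemma dual_cvg (R : realType) (E : normedModType R) (I : Type) (F : set_system I) (FF : Filter F)
    (f : dual E) (y : I -> E) (x : E) :
  y i @[i --> F] --> x -> f (y i) @[i --> F] --> (f x : R).
Proof.
move=> yx; have cf : f @ nbhs x --> f x by exact: dual_continuous.
exact: (cvg_comp _ _ yx cf).
Qed.

(** * Functionals and pointwise convergence *)

Section Simons.
Context {R : realType} (E : completeNormedModType R).

(* Simons' argument.  [C k] consists of the bounded points that any functional
   sees as convex combinations of [y n], [n >= k], with [phi >= delta]; it is stable
   under infinite convex combinations.  With [w k] in [C k] nearly minimising
   [`|z k + 2^-(k+1) *: w|], the sum [zz] of the [2^-(k+1) *: w k] lies in [C 0], and a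
   functional attaining [`|zz|] is at least [`|zz| - eps] on the normalised remainders
   [v k] in [C k], so that [`|zz| <= eta + 2 * eps]. *)
Lemma simons (y : nat -> E) (M delta eta : R) (phi : dual E) :
  (forall n, `|y n| <= M) -> (forall n, delta <= phi (y n)) ->
  (forall z : E, exists b : dual E, [/\ b z = `|z|, forall x, b x <= `|x| &
    forall eps, 0 < eps -> \forall n \near \oo, b (y n) <= eta + eps]) ->
  delta <= `|phi| * eta.
Proof.
move=> yM ydelta attain.
suff H eps : 0 < eps -> delta <= `|phi| * (eta + 2 * eps).
  apply/ler_addgt0Pr => d d0.
  have p1 : 0 < `|phi| + 1 by rewrite ltr_wpDl.
  have p2 : 0 < 2 * (`|phi| + 1) by rewrite mulr_gt0.
  have aux (p u : R) : u * (2 * (p + 1)) = d -> 0 <= u -> p * (2 * u) <= d.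
    by move=> <- u0; lra.
  apply: (le_trans (H _ (divr_gt0 d0 p2))); rewrite mulrDr lerD2l; apply: aux.
    by rewrite divfK// gt_eqF.
  by rewrite ltW// divr_gt0.
move=> eps0.
have M0 : 0 <= M by exact: le_trans (yM 0%N).
pose h k : R := 2^-1 ^+ k.
have h0 k : 0 < h k by rewrite exprn_gt0// invr_gt0.
have hS k : h k.+1 = h k / 2 by rewrite /h exprSr.
pose C k w := [/\ `|w| <= M, delta <= phi w &
  forall (b : dual E) r, (forall n, (k <= n)%N -> b (y n) <= r) -> b w <= r].
have Cy k : C k (y k) by split => // b r; apply.
have Cmono k l w : (k <= l)%N -> C l w -> C k w.
  by move=> kl [a b c]; split => // b' r H; apply: c => n ln; apply: H; exact: leq_trans ln.
(* The tolerance is quadratic in the weight, so that after division by the weight the accumulated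
   errors still sum to less than [eps]. *)
have /choice[pick0 Hpick0] : forall p : nat * E, exists w, C p.1 w /\
    forall w', C p.1 w' -> `|p.2 + h p.1.+1 *: w| <= `|p.2 + h p.1.+1 *: w'| + eps * h p.1.+1 * h p.1.+1.
  move=> [k z] /=; pose S := [set `|z + h k.+1 *: w| | w in C k].
  have hS' : has_inf S.
    split; first by exists `|z + h k.+1 *: y k|; exists (y k).
    by exists 0 => _ [w _ <-].
  have e0 : 0 < eps * h k.+1 * h k.+1 by rewrite !mulr_gt0.
  have [_ [w Cw <-] Hw] := inf_adherent e0 hS'.
  exists w; split => // w' Cw'; apply: (le_trans (ltW Hw)); rewrite lerD2r.
  by apply: ge_inf; [exact: hS'.2|exists w'].
pose pick k z := pick0 (k, z).
have pickC k z : C k (pick k z) by have [] := Hpick0 (k, z).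
have pick_min k z w' : C k w' -> `|z + h k.+1 *: pick k z| <= `|z + h k.+1 *: w'| + eps * h k.+1 * h k.+1.
  by have [_ /(_ w')] := Hpick0 (k, z).
pose z := fix z k := if k is k'.+1 then z k' + h k'.+1 *: pick k' (z k') else 0.
pose w k := pick k (z k).
have zS k : z k.+1 = z k + h k.+1 *: w k by [].
have zE : z = series (fun k => h k.+1 *: w k).
  apply/funext => k; elim: k => [|k IH]; first by rewrite seriesEnat/= big_geq.
  by rewrite zS IH seriesSr.
have : cvg (series (fun k => h k.+1 *: w k) @ \oo).
  apply: normed_cvg.
  apply: (@series_le_cvg _ _ (fun k => M / 2 * h k)) => [k|k|k|].
  - exact: normr_ge0.
  - by rewrite mulr_ge0 ?divr_ge0// ltW.
  - rewrite /= normrZ gtr0_norm// hS mulrC -mulrA (mulrC 2^-1) ler_wpM2r ?mulr_ge0 ?invr_ge0 ?(ltW (h0 _))//.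
    by have [] := pickC k (z k).
  - apply: is_cvg_geometric_series; rewrite gtr0_norm ?invr_gt0// invf_lt1// ltr1n//.
rewrite -zE => /cvg_ex[zz zcvg].
pose s j : R := 1 - h j.
have sS j : s j.+1 = s j + h j.+1 by rewrite /s hS; lra.
have s0 j : 0 <= s j.
  by elim: j => [|j IH]; [rewrite /s /h expr0 subrr|rewrite sS addr_ge0// ltW].
have s_cvg : s j @[j --> \oo] --> (1 : R).
  rewrite -[X in _ --> X]subr0; apply: cvgB; first exact: cvg_cst.
  by apply: cvg_expr; rewrite gtr0_norm ?invr_gt0// invf_lt1// ltr1n.
(* Rescaled blocks of the series: the weights in [P k j] add up to [s j], so the limit [v k] is an
   infinite convex combination of points of [C k]. *)
pose P k j := (h k)^-1 *: (z (k + j)%N - z k).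
have PS k j : P k j.+1 = P k j + h j.+1 *: w (k + j)%N.
  rewrite /P addnS zS addrAC scalerDr scalerA; congr (_ + _ *: _).
  by rewrite /h -addnS exprD mulrA mulVf ?mul1r// gt_eqF// h0.
have P0 k : P k 0%N = 0 by rewrite /P addn0 subrr scaler0.
pose v k := (h k)^-1 *: (zz - z k).
have P_cvg k : P k j @[j --> \oo] --> v k.
  apply: cvgZr; apply: cvgB; last exact: cvg_cst.
  rewrite (_ : (fun j => z (k + j)%N) = [sequence z (n + k)%N]_n); first by rewrite cvg_shiftn.
  by apply/funext => j; rewrite addnC.
clearbody P.
have Cv k : C k (v k).
  have wC j : C k (w (k + j)%N) by apply: Cmono (pickC _ _); exact: leq_addr.
  split.
  - apply: (cvgr_to_le (cvg_norm (P_cvg k))); apply: nearW => j.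
    suff : `|P k j| <= s j * M.
      by move=> /le_trans; apply; rewrite ler_piMl// /s lerBlDr lerDl ltW.
    elim: j => [|j IH]; first by rewrite P0 normr0 mulr_ge0.
    rewrite PS sS mulrDl; apply: (le_trans (ler_normD _ _)); apply: lerD => //.
    by rewrite normrZ gtr0_norm// ler_wpM2l ?(ltW (h0 _))//; have [] := wC j.
  - rewrite -[delta]mul1r.
    apply: (@cvg_le_filter _ nat \oo (fun j => s j * delta) (fun j => phi (P k j))).
    + exact: (cvgM s_cvg (@cvg_cst _ _ _ _ _)).
    + exact: (dual_cvg _ (P_cvg k)).
    apply: (@filterE _ \oo) => j; elim: j => [|j IH].
      by rewrite /= P0 dual0 /s /h expr0 subrr mul0r.
    rewrite /= PS sS mulrDl dualD dualZ; apply: lerD; first exact: IH.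
    by rewrite ler_wpM2l ?(ltW (h0 _))//; have [] := wC j.
  - move=> b r Hr; rewrite -[r]mul1r.
    apply: (@cvg_le_filter _ nat \oo (fun j => b (P k j)) (fun j => s j * r)).
    + exact: (dual_cvg _ (P_cvg k)).
    + exact: (cvgM s_cvg (@cvg_cst _ _ _ _ _)).
    apply: (@filterE _ \oo) => j; elim: j => [|j IH].
      by rewrite /= P0 dual0 /s /h expr0 subrr mul0r.
    rewrite /= PS sS mulrDl dualD dualZ; apply: lerD; first exact: IH.
    by rewrite ler_wpM2l ?(ltW (h0 _))//; have [_ _] := wC j; apply.
(* With [v k] as competitor in the minimisation one reaches the midpoint of [z k] and [zz]. Hence
   the gap between the norms of [zz] and [z k] keeps at least half of itself per step, up to the
   tolerances, which [s k] collects. *)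
have key k : h k * (`|zz| - eps) <= `|zz| - `|z k|.
  suff : h k * (`|zz| - eps * s k) <= `|zz| - `|z k|.
    apply: le_trans; rewrite ler_wpM2l ?(ltW (h0 _))// lerB// ler_piMr ?(ltW eps0)//.
    by rewrite /s lerBlDr lerDl ltW.
  elim: k => [|k IH].
    by rewrite /s /h expr0 subrr mulr0 subr0 mul1r normr0 subr0.
  have : `|z k.+1| <= (`|z k| + `|zz|) / 2 + eps * h k.+1 * h k.+1.
    rewrite zS; apply: (le_trans (pick_min k (z k) _ (Cv k))); rewrite lerD2r.
    have -> : z k + h k.+1 *: v k = 2^-1 *: (z k + zz).
      rewrite /v scalerA hS mulrAC mulfV ?gt_eqF// mul1r.
      have Ez : z k = 2^-1 *: z k + 2^-1 *: z k.
        by rewrite -scalerDl (_ : 2^-1 + 2^-1 = 1 :> R) ?scale1r//; lra.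
      rewrite {1}Ez scalerBr scalerDr -addrA; congr (_ + _).
      by rewrite addrCA subrr addr0.
    rewrite normrZ gtr0_norm ?invr_gt0// mulrC ler_wpM2r ?invr_ge0//.
    exact: ler_normD.
  move: IH; rewrite sS !hS; move: (h k) (s k) => a c; nra.
have [b [bz ble bn]] := attain zz.
have /(_ _ eps0) := bn; move=> [N _ HN].
have [_ _ /(_ b (eta + eps)) bv] := Cv N.
have {}bv : b (v N) <= eta + eps by apply: bv => n Nn; exact: HN.
(* Since [b] attains the norm at [zz] and is at most the norm at [z N], the gap estimate bounds
   [b (v N)] from below. *)
have zb : `|zz| - eps <= eta + eps.
  apply: le_trans bv; rewrite /v dualZ ler_pdivlMl// dualB bz.
  by apply: (le_trans (key N)); rewrite lerB.
have [_ phiv _] := Cv 0%N.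
have v0 : v 0%N = zz by rewrite /v /h expr0 invr1 scale1r subr0.
move: phiv; rewrite v0 => /le_trans; apply.
apply: (le_trans (ler_norm _)); apply: (le_trans (dual_norm_le _ _)).
by rewrite ler_wpM2l//; lra.
Qed.

End Simons.

(** * Extension of functionals to V; meshes of zeros *)

Section SequencesInV0.
Context {R : realType} {X : normedModType R} (e : symmetric_basis X).
Hypothesis HX : reflexive_space X.

Lemma bounded_pointwise_limit (y : nat -> V0_space e) (K : R -> R) (M eta delta : R)
    (phi : dual (V0_space e)) :
  (forall n, `|y n| <= M) -> (forall x, 0 <= x <= 1 -> ext (y n) x @[n --> \oo] --> K x) ->
  Vle e K eta -> (forall n, delta <= phi (y n)) -> delta <= `|phi| * eta.
Proof.
move=> yM yK HK yd; apply: (simons yM yd) => z.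
have [b [bz ble bn]] := attaining_functional HX z.
by exists b; split => // eps; exact: bn yM yK HK eps.
Qed.

Lemma refining_ultrafilter (T : eqType) : exists U : set_system (seq T), UltraFilter U /\
  forall S : seq T, U [set D : seq T | {subset S <= D}].
Proof.
pose F : set_system (seq T) := filter_from setT (fun S : seq T => [set D : seq T | {subset S <= D}]).
have PF : ProperFilter F.
  apply: filter_from_proper; last by move=> S _; exists S => /=.
  apply: filter_from_filter; first by exists [::].
  move=> S S' _ _; exists (S ++ S') => // D /= H; split=> x xS; apply: H;
    by rewrite mem_cat xS ?orbT.
have [U [UU FU]] := ultraFilterLemma PF.
by exists U; split => // S; apply: FU; exists S.
Qed.

(* [T G phi] is the limit of [phi] on the interpolants of [G] along an ultrafilter of
   finite sets of nodes. *)
Lemma bidual_extension : exists T : V_space e -> dual (dual (V0_space e)),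
  [/\ forall a G H, T (a *: G + H) = a *: T G + T H, forall G, `|T G| <= `|G|,
      forall G t, T G (delta e t) = G t &
      forall (phi : dual (V0_space e)) (S : seq R) G eps, 0 < eps -> exists D, {subset S <= D} /\
        `|phi (interpV0 HX D G) - T G phi| <= eps].
Proof.
have [U [UU US]] := refining_ultrafilter R.
have PU : ProperFilter U by exact: ultra_proper.
have /choice[T HT] : forall G : V_space e, exists Phi : dual (dual (V0_space e)), `|Phi| <= `|G| /\
    forall phi : dual (V0_space e), phi (interpV0 HX D G) @[D --> U] --> Phi phi.
  by move=> G; apply: ultra_bidual => D; exact: interpV0_norm.
exists T; split.
- move=> a G H; apply: dual_ext => phi; rewrite dual_addE dual_scaleE.
  apply: (cvg_unique (@Rhausdorff R) ((HT _).2 phi)).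
  rewrite (_ : (fun D => phi _) = fun D => a * phi (interpV0 HX D G) + phi (interpV0 HX D H)).
    by apply: cvgD; [apply: cvgMr; exact: (HT G).2|exact: (HT H).2].
  by apply/funext => D; rewrite interpV0_linear dualD dualZ.
- by move=> G; exact: (HT G).1.
- move=> G t; apply: (cvg_unique (@Rhausdorff R) ((HT G).2 (delta e t))).
  apply: cvg_near_cst; apply: filterS (US [:: \val t]) => D /(_ (\val t)) tD.
  by rewrite -[LHS]/(interpV0 HX D G t) interpV0_node// tD// inE.
- move=> phi S G eps eps0; have /cvgrPdist_le/(_ _ eps0) H := (HT G).2 phi.
  have [D [SD HD]] := filter_ex (filterI (US S) H).
  by exists D; split => //; rewrite distrC.
Qed.

Lemma max_exists (Q : nat -> Prop) N : Q 0%N -> (forall n, Q n -> (n <= N)%N) ->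
  exists n, Q n /\ ~ Q n.+1.
Proof.
move=> Q0 QN; apply: contrapT => /forallNP H.
have QS n : Q n -> Q n.+1 by move=> Qn; apply: contrapT => nQ; apply: (H n).
have : Q N.+1 by elim: N.+1 => // n; exact: QS.
by move/QN; rewrite ltnn.
Qed.

Lemma finite_if_bounded (T : eqType) (P : T -> Prop) N :
  (forall l, uniq l -> (forall x, x \in l -> P x) -> (size l <= N)%N) ->
  exists l : seq T, (forall x, P x -> x \in l).
Proof.
move=> PN; have [||n [[l [ul szl lP]] nQ]] := @max_exists (fun n => exists l : seq T,
  [/\ uniq l, size l = n & forall x, x \in l -> P x]) N.
- by exists [::].
- by move=> n [l [ul <- lP]]; exact: PN.
exists l => x Px; apply: contrapT => /negP xl; apply: nQ; exists (x :: l).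
split; rewrite /= ?xl ?szl// => y; rewrite inE => /predU1P[->//|]; exact: lP.
Qed.

Lemma filter_seq_forall (I : Type) (T : eqType) (F : set_system I) (P : T -> I -> Prop) (l : seq T) :
  Filter F -> (forall x, x \in l -> \forall i \near F, P x i) ->
  \forall i \near F, forall x, x \in l -> P x i.
Proof.
move=> FF; elim: l => [_|x l IH H]; first by apply: nearW.
have H1 : \forall i \near F, P x i by apply: H; rewrite mem_head.
have H2 : \forall i \near F, forall x, x \in l -> P x i.
  by apply: IH => y yl; apply: H; rewrite inE yl orbT.
by apply: filterS2 H1 H2 => i Hx Hl y; rewrite inE => /predU1P[->|/Hl].
Qed.

Definition mesh_points (i : nat) : seq R := [seq j%:R / i.+1%:R | j <- iota 0 i.+2].

Lemma mesh_points_itv i d : d \in mesh_points i -> 0 <= d <= 1.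
Proof.
move=> /mapP[j]; rewrite mem_iota add0n ltnS => /andP[_ ji] ->.
by rewrite divr_ge0//= ler_pdivrMr// mul1r ler_nat.
Qed.

Lemma mesh_points_between i x y : 0 <= x -> y <= 1 -> i.+1%:R^-1 < y - x ->
  exists2 d, d \in mesh_points i & x < d < y.
Proof.
move=> x0 y1 ixy; have i0 : 0 < (i.+1%:R : R) by rewrite ltr0n.
have xi0 : 0 <= x * i.+1%:R by rewrite mulr_ge0// ltW.
have /andP[k1 k2] := truncn_itv xi0.
set k := Num.truncn _ in k1 k2.
have xd : x < k.+1%:R / i.+1%:R by rewrite ltr_pdivlMr.
have dy : k.+1%:R / i.+1%:R < y.
  have aux (u w : R) : u <= x -> w < y - x -> u + w < y by lra.
  by rewrite -[k.+1%:R]natr1 mulrDl mul1r; apply: aux ixy; rewrite ler_pdivrMr.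
exists (k.+1%:R / i.+1%:R); last by rewrite xd dy.
apply/mapP; exists k.+1 => //; rewrite mem_iota /= add0n ltnS.
rewrite -(ler_nat R); have : k.+1%:R / i.+1%:R <= 1 :> R by exact: ltW (lt_le_trans dy y1).
by rewrite ler_pdivrMr// mul1r.
Qed.

Lemma near_mesh (d : R) : 0 < d -> \forall i \near \oo, i.+1%:R^-1 < d.
Proof.
move=> d0; have : (i.+1%:R^-1 : R) @[i --> \oo] --> (0 : R) by exact: cvg_harmonic.
move=> /cvgrPdist_lt/(_ _ d0); apply: filterS => i.
by rewrite sub0r normrN ger0_norm.
Qed.

Lemma pairs_gap (x : R) t p y : path <%R x t -> p \in pairs x t -> y \in x :: t -> y <= p.1 \/ p.2 <= y.
Proof.
elim: t x => // z t IH x /= /andP[xz pz]; rewrite pairs_cons inE => /predU1P[->|pp] /=.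
  rewrite !inE => /or3P[/eqP ->|/eqP ->|/(path_lt_le pz)/ltW yz]; by [left|right|right].
have [zp1 _ _ _] := pairs_mem pz pp.
rewrite inE => /predU1P[->|]; last exact: IH.
by left; apply: (le_trans (ltW xz)).
Qed.

Lemma grid_mesh (D : seq R) i p : {subset mesh_points i <= D} -> p \in pairs 0 (grid D) ->
  p.2 - p.1 <= i.+1%:R^-1.
Proof.
move=> sD pp; rewrite leNgt; apply/negP => Hp.
have pg := grid_path D; have [p0 p12 _ p2] := pairs_mem pg pp.
have /andP[_ p21] : 0 < p.2 <= 1 by move: p2; rewrite mem_grid => /andP[].
have [d dm /andP[pd dp]] := mesh_points_between p0 p21 Hp.
have dg : d \in 0 :: grid D.
  rewrite inE mem_grid (sD _ dm) orbT andbT (le_lt_trans p0 pd)/=.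
  by have /andP[_ ->] := mesh_points_itv dm; rewrite orbT.
by have [] := pairs_gap pg pp dg; rewrite leNgt ?pd ?dp.
Qed.

(** The interpolant at [x] depends only on the two neighbouring nodes, and the mesh points among the
    nodes keep these close to [x]. *)
Lemma interpV0_eq0 D i (G : V_space e) x : {subset mesh_points i <= D} -> 0 <= x <= 1 ->
  (forall y, 0 <= y <= 1 -> `|x - y| <= i.+1%:R^-1 -> ext G y = 0) ->
  ext (interpV0 HX D G) x = 0.
Proof.
move=> sD /andP[x0 x1] G0; rewrite ext_interpV0 ?x0//.
move: x0; rewrite le_eqVlt => /predU1P[<-|x0]; first by rewrite interp_left ?V_at0// grid_path.
have [|p [pp /andP[p1x xp2] ->]] := interp_local (grid_path D) (s := x).
  by rewrite x0 grid_last.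
have mp := grid_mesh sD pp.
have [p0 p12 _ p2] := pairs_mem (grid_path D) pp.
have /andP[p20 p21] : 0 < p.2 <= 1 by move: p2; rewrite mem_grid => /andP[].
rewrite !G0 ?subrr ?mul0r ?addr0//.
- by rewrite ltW.
- by rewrite distrC ger0_norm ?subr_ge0//; apply: le_trans mp; rewrite lerB.
- by rewrite p0 (le_trans _ p21)// ltW.
- by rewrite ger0_norm ?subr_ge0//; apply: le_trans mp; rewrite lerB.
Qed.

Lemma snorm_zero_mesh F C l : F 0 = 0 -> Vle e F C -> uniq l ->
  (forall x, x \in l -> 0 <= x <= 1) ->
  (forall x y, x \in l -> y \in l -> x < y -> exists i, i.+1%:R^-1 < y - x /\
    forall d, d \in mesh_points i -> F d = 0) ->
  snorm e (map F l) <= C.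
Proof.
move=> F0 HF ul l01 H; apply: (snorm_separated F0 HF ul l01) => x y xl yl xy.
have [i [ixy Fd]] := H x y xl yl xy.
have /andP[x0 _] := l01 _ xl; have /andP[_ y1] := l01 _ yl.
have [d dm /andP[xd dy]] := mesh_points_between x0 y1 ixy.
by exists d; [rewrite !ltW|exact: Fd].
Qed.

End SequencesInV0.

(** * Helly-type selection *)

Section Rich.
Context {R : realType} {X : normedModType R} (e : symmetric_basis X).
Hypothesis HX : reflexive_space X.
Variable D : nat -> seq R.
Hypothesis meshD : forall i, {subset @mesh_points R i <= D i}.

Definition vanish (k : nat) (F : V0_space e) :=
  forall i, (i <= k)%N -> forall t : unit_interval R, \val t \in D i -> F t = 0.

Lemma vanish_le k l F : (k <= l)%N -> vanish l F -> vanish k F.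
Proof. by move=> kl H i ik; apply: H; exact: leq_trans kl. Qed.

(* A rich set contains functions vanishing on arbitrarily many of the [D i]; this
   replaces passing to subsequences in the Helly-type selection. *)
Definition rich (A : set (V0_space e)) := forall k, exists F, A F /\ vanish k F.

Lemma vanish_mesh k F i d : vanish k F -> (i <= k)%N -> d \in mesh_points i -> ext F d = 0.
Proof.
move=> vF ik dm; have d01 := mesh_points_itv dm.
by rewrite /ext; apply: (vF i) => //; rewrite clampE//; exact: meshD.
Qed.

(** Richness provides a member vanishing on a mesh finer than the gaps of [T], so its values on [T]
    have X-norm at most 1 while all of them exceed [eps]. This bounds the fundamental function at
    the size of [T], uniformly in [A]. *)
Lemma rich_level_size eps : 0 < eps -> exists N, forall (A : set (V0_space e)) (T : seq R),
  (forall F, A F -> `|F| <= 1) -> uniq T -> (forall x, x \in T -> 0 <= x <= 1) ->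
  rich [set F | A F /\ forall x, x \in T -> eps < `|ext F x|] -> (size T <= N)%N.
Proof.
move=> eps0; have [N HN] := fnorm_ones_unbounded e HX eps^-1.
exists N => A T A1 uT T01 rT.
have H : \forall k \near \oo, forall x, x \in T -> forall y, y \in T -> x < y -> k.+1%:R^-1 < y - x.
  apply: filter_seq_forall => x _; apply: filter_seq_forall => y _.
  have [xy|yx] := ltP x y; last by apply: nearW.
  have := near_mesh (d := y - x); rewrite subr_gt0 => /(_ xy).
  by apply: filterS => i Hi _.
have [k Hk] := filter_ex H.
have [F [[AF FT] vF]] := rT k.
have : snorm e (map (ext F) T) <= 1.
  apply: snorm_zero_mesh => //.
  - exact: V0_at0.
  - exact: Vle_trans (A1 F AF) (V0_Vle F).
  - move=> x y xT yT xy; exists k; split; first exact: Hk.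
    by move=> d; exact: vanish_mesh vF (leqnn k).
have : eps * ones e (size T) <= snorm e (map (ext F) T).
  have -> : eps * ones e (size T) = snorm e (map (fun=> eps) T).
    rewrite -[eps in LHS]ger0_norm ?(ltW eps0)// /ones.
    rewrite (_ : nseq _ _ = map (fun=> 1) T); last by elim: (T) => //= x s ->.
    by rewrite -snorm_mapZ; congr snorm; apply: eq_map => x; rewrite mulr1.
  apply: snorm_map_le => x xT; rewrite gtr0_norm//; exact/ltW/FT.
move=> /le_trans H1 /H1; rewrite -ler_pdivlMl// mulr1 => H2.
rewrite leqNgt; apply/negP => NT; have := ones_le e (ltnW NT).
by move: HN; rewrite -ones_fnorm => HN H3; have := lt_le_trans HN (le_trans H3 H2); rewrite ltxx.
Qed.

(* Take a maximal [T] such that the members of [A] larger than [eps / 2] on [T] are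
   still rich: off [T] they are eventually small, and on the finite set [T] their
   values can be made to converge. *)
Lemma rich_step (A : set (V0_space e)) eps : 0 < eps -> rich A ->
  (forall F, A F -> `|F| <= 1) ->
  exists A', [/\ A' `<=` A, rich A' & forall t : unit_interval R, exists k, forall F F',
    A' F -> A' F' -> vanish k F -> vanish k F' -> `|F t - F' t| <= eps].
Proof.
move=> eps0 rA A1; have eps2 : 0 < eps / 2 by rewrite divr_gt0.
pose lev (T : seq R) := [set F | A F /\ forall x, x \in T -> eps / 2 < `|ext F x|].
have [N HN] := rich_level_size eps2.
have [||n [[T [uT szT T01 rT]] nQ]] := @max_exists (fun n => exists T : seq R,
  [/\ uniq T, size T = n, forall x, x \in T -> 0 <= x <= 1 & rich (lev T)]) N.
- exists [::]; split => // k; have [F [AF vF]] := rA k.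
  by exists F; split => //; split.
- by move=> n [T [uT <- T01 rT]]; exact: HN A1 uT T01 rT.
have [F HF] := choice rT.
have [U [UU Uoo]] := infty_ultrafilter.
have PU : ProperFilter U by exact: ultra_proper.
have F1 k : `|F k| <= 1 by apply: A1; have [[]] := HF k.
have c0 := basis_norm_gt0 e.
have /choice[r Hr] : forall x : R, exists l : R, ext (F k) x @[k --> U] --> l.
  move=> x; apply: (@ultra_bounded_cvg _ _ _ _ (`|e 0%N|^-1)) => k.
  rewrite -[leRHS]mulr1 ler_pdivlMl// mulrC; apply: le_trans (F1 k).
  have /andP[x0 x1] := valP (clamp x).
  by have := Vle_point (V0_Vle (F k)) (lexx 0) x0 x1; rewrite V0_at0 subr0 ext_val.
exists [set G | lev T G /\ forall x, x \in T -> `|r x - ext G x| <= eps / 2]; split.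
- by move=> G [[]].
- move=> k; have : U [set n | (k <= n)%N /\ forall x, x \in T -> `|r x - ext (F n) x| <= eps / 2].
    apply: filterI; first by apply: Uoo; exact: nbhs_infty_ge.
    apply: filter_seq_forall => x _.
    by have /cvgrPdist_le/(_ _ eps2) := Hr x.
  move=> /filter_ex[m [km Hm]]; have [lF vF] := HF m.
  by exists (F m); split => //; exact: vanish_le vF.
- move=> t; have [tT|tT] := boolP (\val t \in T).
    exists 0%N => G G' [_ HG] [_ HG'] _ _.
    have := HG _ tT; have := HG' _ tT; rewrite !ext_val => h h'.
    rewrite -(subrK (r (\val t)) (G t)) -addrA (splitr eps).
    by apply: (le_trans (ler_normD _ _)); rewrite lerD// distrC.
  have [k Hk] : exists k, forall G, lev T G -> vanish k G -> `|G t| <= eps / 2.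
    apply: contrapT => /forallNP H; apply: nQ; exists (\val t :: T); split.
    - by rewrite /= tT.
    - by rewrite /= szT.
    - by move=> x; rewrite inE => /predU1P[->|/T01//]; exact: (valP t).
    move=> k; have /existsNP[G HG] := H k; exists G.
    move: HG => /not_implyP[lG /not_implyP[vG /negP]]; rewrite -ltNge => Gt.
    split => //; have [AG GT] := lG; split => // x; rewrite inE => /predU1P[->|/GT//].
    by rewrite ext_val.
  exists k => G G' [lG _] [lG' _] vG vG'; rewrite (splitr eps).
  by apply: (le_trans (ler_normB _ _)); apply: lerD; exact: Hk.
Qed.

(** Diagonal selection through a decreasing sequence of rich sets: the step from stage m reduces the
    oscillation at each point to 1/(m+1) among members with enough zeros, and [x k] is taken from
    the k-th set with the k-th level of zeros. *)
Lemma rich_sequence (A : set (V0_space e)) : rich A -> (forall F, A F -> `|F| <= 1) ->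
  exists (x : nat -> V0_space e) (G : unit_interval R -> R),
    (forall k, A (x k) /\ vanish k (x k)) /\ forall t, x k t @[k --> \oo] --> G t.
Proof.
move=> rA A1.
pose P (B : set (V0_space e)) := rich B /\ B `<=` A.
have /choice[next Hnext] : forall p : nat * {B | P B}, exists B' : {B | P B},
    sval B' `<=` sval p.2 /\ forall t : unit_interval R, exists k, forall F F',
    sval B' F -> sval B' F' -> vanish k F -> vanish k F' -> `|F t - F' t| <= p.1.+1%:R^-1.
  move=> [m [B [rB BA]]] /=.
  have m0 : 0 < (m.+1%:R^-1 : R) by rewrite invr_gt0.
  have [B' [B'B rB' HB']] := rich_step m0 rB (fun F BF => A1 F (BA F BF)).
  by exists (exist P B' (conj rB' (subset_trans B'B BA))).
pose S := fix S m := if m is m'.+1 then next (m', S m') else exist P A (conj rA (@subset_refl _ A)).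
have Smono m n : (m <= n)%N -> sval (S n) `<=` sval (S m).
  elim: n => [|n IH]; first by rewrite leqn0 => /eqP ->.
  rewrite leq_eqVlt => /predU1P[->//|mn].
  by apply: subset_trans (IH mn); have [] := Hnext (n, S n).
have HS k : exists y, sval (S k) y /\ vanish k y by have [rS _] := svalP (S k); exact: rS.
have [x Hx] := choice HS.
have /choice[G HG] : forall t, exists l : R, x k t @[k --> \oo] --> l.
  move=> t; apply/cvg_ex; apply: cauchy_cvg; apply/cauchy_exP => eps eps0.
  have [m Hm] := filter_ex (near_mesh eps0).
  have [_ /(_ t)[k Hk]] := Hnext (m, S m).
  exists (x (maxn m.+1 k) t); exists (maxn m.+1 k) => // n /= mkn; rewrite /ball/=.
  apply: le_lt_trans Hm.
  have [sx vx] := Hx (maxn m.+1 k); have [sn vn] := Hx n.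
  apply: Hk.
  - by apply: (Smono m.+1) sx; exact: leq_maxl.
  - by apply: (Smono m.+1) sn; exact: leq_trans (leq_maxl _ _) mkn.
  - by apply: vanish_le vx; exact: leq_maxr.
  - by apply: vanish_le vn; exact: leq_trans (leq_maxr _ _) mkn.
exists x, G; split => // k; have [sx vx] := Hx k; split => //.
by have [_ SA] := svalP (S k); exact: SA.
Qed.

End Rich.

(** * Atoms of a functional *)

Section Key.
Context {R : realType} {X : normedModType R} (e : symmetric_basis X).
Hypothesis HX : reflexive_space X.

(* Junk value 0 for [s = 0], where the indicator does not vanish at 0.  The numbers
   [T (indV s) phi] are the atoms of [phi]. *)
Definition indV (s : R) : V_space e := insubd (0 : V_space e) (res (fun x => (x == s)%:R)).

Lemma ext_indV s x : s != 0 -> 0 <= x <= 1 -> ext (indV s) x = (x == s)%:R.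
Proof.
move=> s0 x01; rewrite -[LHS]/(\val (insubd _ _) (clamp x)) val_insubd ifT.
  by rewrite /res clampE.
apply: (@V_predI _ _ _ _ (2 * snorm e (map (fun x => (x == s)%:R) [:: s]))).
  by rewrite eq_sym (negbTE s0).
apply: Vle_finite_support => // y; rewrite inE => /negbTE ->.
by [].
Qed.

Lemma ext_sum_indV (l : seq R) (a : R -> R) x : uniq l -> (forall s, s \in l -> s != 0) ->
  0 <= x <= 1 -> ext (\sum_(s <- l) a s *: indV s) x = if x \in l then a x else 0.
Proof.
move=> ul l0 x01.
have -> : ext (\sum_(s <- l) a s *: indV s) x = \sum_(s <- l) a s * ext (indV s) x.
  elim: (l) => [|s l' IH]; rewrite ?big_nil// !big_cons -IH//.
rewrite (eq_big_seq (fun s => if s == x then a x else 0)); last first.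
  move=> s sl; rewrite ext_indV ?l0// eq_sym; case: eqP => [->|_]; first by rewrite mulr1.
  by rewrite mulr0.
rewrite -big_mkcond/=; case: ifPn => [xl|xl].
  rewrite (big_rem x)//= eqxx big_seq_cond big1 ?addr0// => s /andP[+ /eqP sx].
  by rewrite sx mem_rem_uniqF.
by rewrite big_seq_cond big1// => s /andP[sl /eqP sx]; move: xl; rewrite -sx sl.
Qed.

Lemma sum_indV_norm (l : seq R) (a : R -> R) : uniq l -> (forall s, s \in l -> s != 0) ->
  `|\sum_(s <- l) a s *: indV s| <= 2 * snorm e (map a l).
Proof.
move=> ul l0; apply: V_norm_le.
have -> : snorm e (map a l) = snorm e (map (fun x => if x \in l then a x else 0) l).
  by congr snorm; apply/eq_in_map => x ->.
apply: (@eq_Vle _ _ _ (fun x => if x \in l then a x else 0)).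
  by move=> x x01; rewrite ext_sum_indV.
by apply: Vle_finite_support => // x /negbTE ->.
Qed.

Variable T : V_space e -> dual (dual (V0_space e)).
Hypothesis T_linear : forall a G H, T (a *: G + H) = a *: T G + T H.
Hypothesis T_norm : forall G, `|T G| <= `|G|.

Lemma T_sum (l : seq R) (a : R -> R) phi :
  T (\sum_(s <- l) a s *: indV s) phi = \sum_(s <- l) a s * T (indV s) phi.
Proof.
elim: l => [|s l IH]; last by rewrite !big_cons T_linear dual_addE dual_scaleE IH.
rewrite !big_nil; have := T_linear (-1) 0 0; rewrite scaleN1r oppr0 addr0 scaleN1r addNr.
by move=> ->.
Qed.

(** A signed sum of n indicators has norm at most [2 * ones n], whereas n large atoms give the
    extended functional a value of at least [kappa * n] on it. As [ones] is o(n), this bounds n; the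
    factor 4 in the slope lets the linear term absorb at most half of [kappa * n]. *)
Lemma atoms_finite (phi : dual (V0_space e)) (kappa : R) : 0 < kappa ->
  exists l : seq R, forall s, 0 < s <= 1 /\ kappa < `|T (indV s) phi| -> s \in l.
Proof.
move=> k0; have p1 : 0 < 4 * (`|phi| + 1) by rewrite mulr_gt0// ltr_wpDl.
have [C C0 HC] := ones_sublinear e HX (divr_gt0 k0 p1).
pose N := (Num.truncn (4 * `|phi| * C / kappa)).+1.
apply: (@finite_if_bounded _ _ N) => l ul lP.
have l0 s : s \in l -> s != 0 by move=> /lP[/andP[s0 _] _]; rewrite gt_eqF.
pose a s := Num.sg (T (indV s) phi).
have H1 : kappa * (size l)%:R <= \sum_(s <- l) a s * T (indV s) phi.
  rewrite big_seq (eq_bigr (fun s => `|T (indV s) phi|)); last by move=> s _; rewrite normrEsg.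
  rewrite -big_seq mulr_natr; elim: (l) lP => [|s l' IH] H; first by rewrite big_nil.
  rewrite big_cons /= mulrS lerD//; first by have [_ /ltW] := H s (mem_head _ _).
  by apply: IH => x xl; apply: H; rewrite inE xl orbT.
have H2 : \sum_(s <- l) a s * T (indV s) phi <= 2 * ones e (size l) * `|phi|.
  rewrite -T_sum; apply: (le_trans (ler_norm _)); apply: (le_trans (dual_norm_le _ _)).
  rewrite ler_wpM2r//; apply: (le_trans (T_norm _)); apply: (le_trans (sum_indV_norm _ ul l0)).
  rewrite ler_wpM2l// /ones (_ : nseq _ _ = map (fun=> 1) l).
    apply: snorm_map_le => s _; rewrite normr1 /a normr_sg.
    by case: eqP => _; rewrite ?ler01.
  by elim: (l) => //= x s ->.
have Hn := HC (size l).
have E : kappa / (4 * (`|phi| + 1)) * (4 * (`|phi| + 1)) = kappa by rewrite divfK// gt_eqF.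
have d0 : 0 <= kappa / (4 * (`|phi| + 1)) by rewrite ltW// divr_gt0.
have H3 : kappa * (size l)%:R <= 4 * `|phi| * C.
  have aux (p n o d c : R) : 0 <= p -> 0 <= n -> 0 <= d -> d * (4 * (p + 1)) * n <= 2 * o * p ->
      o <= c + d * n -> d * (4 * (p + 1)) * n <= 4 * p * c.
    move=> p0 n0 d0' h1 h2.
    have h3 : o * p <= (c + d * n) * p by rewrite ler_wpM2r.
    have h4 : 0 <= d * n by rewrite mulr_ge0.
    by nra.
  rewrite -{1}E; apply: (aux _ _ (ones e (size l))) => //.
  by rewrite E; exact: le_trans H1 H2.
rewrite /N -(ler_nat R) ltW//; apply: le_lt_trans (truncnS_gt _).
by rewrite ler_pdivlMr// mulrC.
Qed.

End Key.

(** * Smallness of functionals on functions with many zeros *)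

Section KeyTheorem.
Context {R : realType} {X : normedModType R} (e : symmetric_basis X).
Hypothesis HX : reflexive_space X.

Theorem small_on_finite_zeros (phi : dual (V0_space e)) (delta : R) : 0 < delta ->
  exists D : seq R, forall F : V0_space e, `|F| <= 1 ->
    (forall t : unit_interval R, \val t \in D -> F t = 0) -> `|phi F| <= delta.
Proof.
move=> delta0; apply: contrapT => /forallNP H.
have [T [T_linear T_norm T_delta T_approx]] := bidual_extension e HX.
(* Together the lists [C i] contain every point of (0, 1] that carries a nonzero atom. *)
have /choice[C HC] : forall i : nat, exists l : seq R, forall s,
    0 < s <= 1 /\ i.+1%:R^-1 < `|T (indV e s) phi| -> s \in l.
  by move=> i; apply: (atoms_finite HX T_linear T_norm phi); rewrite invr_gt0.
pose D i := mesh_points i ++ C i.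
have meshD i : {subset @mesh_points R i <= D i} by move=> x xm; rewrite mem_cat xm.
pose A : set (V0_space e) := [set F | `|F| <= 1 /\ delta <= phi F].
have rA : rich D A.
  move=> k; have /existsNP[F] := H (flatten [seq D i | i <- iota 0 k.+1]).
  move=> /not_implyP[F1 /not_implyP[FD /negP]]; rewrite -ltNge => dF.
  have vF : vanish D k F.
    move=> i ik t ti; apply: FD; apply/flattenP; exists (D i) => //.
    by apply/mapP; exists i => //; rewrite mem_iota add0n.
  (* The sign is normalised because Simons' inequality needs values of [phi] bounded below. *)
  have [phi0|phi0] := leP 0 (phi F).
    by exists F; split => //; split => //; rewrite ltW// -(ger0_norm phi0).
  exists (- F); split.
    by split; rewrite ?normrN// dualN ltW// -(ltr0_norm phi0).
  by move=> i ik t ti; rewrite -[LHS]/(- (F t)) (vF i)// oppr0.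
have [x [G [Hx HG]]] := rich_sequence HX meshD rA (fun F => @proj1 _ _).
have x1 k : `|x k| <= 1 by have [[]] := Hx k.
have VG : Vle e (ext G) 1.
  apply: (@Vle_lim _ _ _ _ \oo (fun k => ext (x k))) => [y _|]; first exact: HG.
  by apply: nearW => k; apply: Vle_trans (V0_Vle (x k)).
have GD i t : \val t \in D i -> G t = 0.
  move=> ti; apply: (cvg_unique (@Rhausdorff R) (HG t)).
  apply: cvg_near_cst; near=> k; have [_ vx] := Hx k; apply: (vx i) => //.
  by near: k; exact: nbhs_infty_ge.
have G0 : ext G 0 = 0.
  rewrite /ext; apply: (GD 0%N); rewrite clampE ?lexx ?ler01//; apply: meshD.
  by apply/mapP; exists 0%N => //; rewrite mul0r.
have Gmesh i d : d \in mesh_points i -> ext G d = 0.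
  move=> dm; have d01 := mesh_points_itv dm.
  by rewrite /ext; apply: (GD i); rewrite clampE//; exact: meshD.
have GN l : uniq l -> (forall s, s \in l -> 0 <= s <= 1) -> snorm e (map (ext G) l) <= 1.
  move=> ul l01; apply: (snorm_zero_mesh G0 VG ul l01) => y z _ _ yz.
  have := near_mesh (d := z - y); rewrite subr_gt0 => /(_ yz)/filter_ex[i Hi].
  by exists i; split => // d; exact: Gmesh.
have p1 : 0 < 8 * (`|phi| + 1) by rewrite mulr_gt0// ltr_wpDl.
(* Makes [2 * eta] times the norm of [phi] smaller than [delta / 2], which is the final
   contradiction. *)
pose eta := delta / (8 * (`|phi| + 1)).
have eta0 : 0 < eta by exact: divr_gt0.
have [l0 [ul0 l001 Hl0]] := summable_tail HX eta0 GN.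
pose l := [seq s <- l0 | s != 0].
have ul : uniq l by exact: filter_uniq.
have ln0 s : s \in l -> s != 0 by rewrite mem_filter => /andP[].
have l01 s : s \in l -> 0 <= s <= 1 by rewrite mem_filter => /andP[_ /l001].
(* The large part of [G]. It lies in V but in general not in V^0, so only its interpolants can be
   subtracted from [x k]. *)
pose g := \sum_(s <- l) ext G s *: indV e s.
have gE y : 0 <= y <= 1 -> ext g y = if y \in l then ext G y else 0.
  by move=> y01; rewrite /g ext_sum_indV.
(* A point where [G] does not vanish lies outside every [D i], hence carries no atom. *)
have Tg : T g phi = 0.
  rewrite /g T_sum// big_seq big1// => s sl.
  have [->|Gs] := eqVneq (ext G s) 0; first by rewrite mul0r.
  have s01 := l01 _ sl.
  have s0 : 0 < s by have /andP[s0 _] := s01; rewrite lt_neqAle eq_sym ln0.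
  have cs i : `|T (indV e s) phi| <= i.+1%:R^-1.
    rewrite leNgt; apply/negP => Hs; move/eqP: Gs; apply.
    rewrite /ext; apply: (GD i); rewrite clampE// mem_cat; apply/orP; right; apply: HC.
    by split => //; have /andP[_ ->] := s01; rewrite s0.
  have : `|T (indV e s) phi| <= 0.
    apply/ler_addgt0Pl => d d0; rewrite addr0; have [i Hi] := filter_ex (near_mesh d0).
    exact: le_trans (cs i) (ltW Hi).
  by rewrite normr_le0 => /eqP ->; rewrite mulr0.
pose K y := ext G y - ext g y.
(* Off [l] the function [K] equals [G], whose values there form a tail of norm at most [eta];
   passing from values to increments doubles the bound. *)
have VK : Vle e K (2 * eta).
  apply: Vle_points => s us s01.
  rewrite -(@snorm_map_filter _ _ e _ (fun y => y \notin l)); last first.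
    by move=> y ys; rewrite negbK => yl; rewrite /K gE ?s01// yl subrr.
  have -> : [seq K i | i <- [seq y <- s | y \notin l]] = [seq ext G i | i <- [seq y <- s | y \notin l]].
    apply/eq_in_map => y; rewrite mem_filter => /andP[/negbTE yl ys].
    by rewrite /K gE ?s01// yl subr0.
  rewrite -(@snorm_map_filter _ _ e _ (fun y => y != 0)); last first.
    by move=> y _; rewrite negbK => /eqP ->.
  apply: Hl0; first by rewrite !filter_uniq.
  move=> y; rewrite !mem_filter negb_and negbK => /andP[/negbTE -> /andP[/= yl0 ys]].
  by split => //; exact: s01.
have /choice[E HE] : forall k : nat, exists E : seq R, {subset mesh_points k ++ l <= E} /\
    `|phi (interpV0 HX E g) - T g phi| <= delta / 2.
  by move=> k; apply: T_approx; rewrite divr_gt0.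
pose y k := x k - interpV0 HX (E k) g.
have y1 k : `|y k| <= 1 + `|g|.
  apply: (le_trans (ler_normB _ _)); apply: lerD => //; exact: interpV0_norm.
(* The interpolants of [g] are exact on [l], and they vanish at any other point once the mesh is
   finer than its distance to [l]. *)
have yK s : 0 <= s <= 1 -> ext (y k) s @[k --> \oo] --> K s.
  move=> s01.
  have Hcvg : ext (interpV0 HX (E k) g) s @[k --> \oo] --> ext g s.
    apply: cvg_near_cst; rewrite gE//; case: ifPn => sl.
      apply: nearW => k; rewrite -[ext G s](_ : ext g s = _); last by rewrite gE// sl.
      rewrite /ext; apply: interpV0_node; rewrite clampE//.
      by have [sE _] := HE k; apply: sE; rewrite mem_cat sl orbT.
    have H1 : \forall k \near \oo, forall r, r \in l -> k.+1%:R^-1 < `|s - r|.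
      apply: filter_seq_forall => r rl; apply: near_mesh.
      by rewrite normr_gt0 subr_eq0; apply: contraNneq sl => ->.
    apply: filterS H1 => k Hk; apply: (@interpV0_eq0 _ _ _ _ _ k) => //.
      by move=> d dm; have [sE _] := HE k; apply: sE; rewrite mem_cat dm.
    move=> r r01 sr; rewrite gE// ifF//; apply/negbTE/negP => /Hk.
    by rewrite ltNge sr.
  exact: (cvgB (HG (clamp s)) Hcvg).
have phiy k : delta / 2 <= phi (y k).
  have [_] := HE k; rewrite Tg subr0 => /(le_trans (ler_norm _)) Hphi.
  have [[_ dx] _] := Hx k; rewrite dualB; move: dx Hphi.
  by move: (phi (x k)) (phi (interpV0 HX (E k) g)) => u v; lra.
have := bounded_pointwise_limit HX y1 yK VK phiy.
have Eeta : eta * (8 * (`|phi| + 1)) = delta by rewrite /eta divfK// gt_eqF.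
apply/negP; rewrite -ltNge -Eeta.
have aux (p u : R) : 0 <= p -> 0 < u -> p * (2 * u) < u * (8 * (p + 1)) / 2.
  by move=> p0 u0; nra.
exact: aux.
Unshelve. all: by end_near. Qed.

End KeyTheorem.

(** * Primitives of integrable functions *)

Section Primitive.
Context {R : realType}.
Local Notation mu := (@lebesgue_measure R).
Implicit Types f g : R -> R.

Definition prim f (x : R) : R := \int[mu]_(y in `]0, x[) f y.

Lemma L1_itv f (a b : R) : L1 f -> 0 <= a -> b <= 1 -> mu.-integrable `]a, b[ (EFin \o f).
Proof.
move=> Lf a0 b1; apply: (integrableS _ _ _ Lf) => //.
by apply: subset_itv; rewrite bnd_simp.
Qed.

Lemma prim0 f : prim f 0 = 0.
Proof. by rewrite /prim set_itv_ge ?Rintegral_set0// bnd_simp ltxx. Qed.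

Lemma prim_incr f a b : L1 f -> 0 <= a -> a <= b -> b <= 1 ->
  \int[mu]_(x in `]a, b[) f x = prim f b - prim f a.
Proof.
move=> Lf a0; rewrite le_eqVlt => /predU1P[-> _|ab b1].
  by rewrite subrr set_itv_ge ?Rintegral_set0// bnd_simp ltxx.
rewrite /prim (@Rintegral_itv_bndo_bndc _ (BRight 0) a); last first.
  by apply: L1_itv => //; exact: le_trans (ltW ab) b1.
rewrite Rintegral_itvB//; first exact: L1_itv.
Qed.

Lemma L1_lin a f g : L1 f -> L1 g -> L1 (fun x => a * f x + g x).
Proof.
move=> Lf Lg; have := fun m => integrableD m (integrableZl m a Lf) Lg.
move=> /(_ (measurable_itv _)); apply: eq_integrable => // x _ /=; rewrite EFinD EFinM.
Qed.

Lemma prim_lin a f g x : L1 f -> L1 g -> 0 <= x <= 1 ->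
  prim (fun y => a * f y + g y) x = a * prim f x + prim g x.
Proof.
move=> Lf Lg /andP[x0 x1]; have If := L1_itv Lf (lexx 0) x1; have Ig := L1_itv Lg (lexx 0) x1.
rewrite /prim RintegralD//; last first.
  have := fun m => integrableZl m a If.
  move=> /(_ (measurable_itv _)); apply: eq_integrable => // y _ /=; rewrite EFinM.
by rewrite RintegralZl.
Qed.

Lemma L1_norm f : L1 f -> L1 (fun x => `|f x|).
Proof. by move=> Lf; exact: (integrable_norm Lf). Qed.

Lemma prim_norm_incr f a b : L1 f -> 0 <= a -> a <= b -> b <= 1 ->
  `|prim f b - prim f a| <= prim (fun x => `|f x|) b - prim (fun x => `|f x|) a.
Proof.
move=> Lf a0 ab b1; rewrite -prim_incr// -(prim_incr (L1_norm Lf))//.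
by apply: le_normr_Rintegral => //; exact: L1_itv.
Qed.

Lemma prim_norm_le f x y : L1 f -> 0 <= x -> x <= y -> y <= 1 ->
  prim (fun x => `|f x|) x <= prim (fun x => `|f x|) y.
Proof.
move=> Lf x0 xy y1; rewrite -subr_ge0; apply: le_trans (prim_norm_incr Lf x0 xy y1).
exact: normr_ge0.
Qed.

Lemma prim_abs_continuous f eta : L1 f -> 0 < eta -> exists2 eps, 0 < eps &
  forall x y, 0 <= x -> x <= y -> y <= 1 -> y - x <= eps -> `|prim f y - prim f x| <= eta.
Proof.
move=> Lf eta0; pose h := f \_ `]0, 1[.
have Ih : mu.-integrable setT (EFin \o h).
  rewrite -restrict_EFin; apply/integrable_restrict => //=.
  by rewrite setTI.
have [d [d0 Hd]] := integral_normr_continuous Ih eta0.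
exists (d / 2); first by rewrite divr_gt0.
move=> x y x0 xy y1 yx; rewrite -prim_incr//.
apply: (le_trans (le_normr_Rintegral _ _)) => //; first exact: L1_itv.
have -> : \int[mu]_(t in `]x, y[) `|f t| = \int[mu]_(t in `]x, y[) `|h t|.
  apply: eq_Rintegral => t; rewrite inE/= in_itv/= => /andP[xt ty].
  by rewrite /h patchE ifT// inE/= in_itv/= (le_lt_trans x0 xt) (lt_le_trans ty y1).
apply/ltW/Hd => //; suff : (lebesgue_measure (`]x, y[%classic : set R) < d%:E)%E by [].
rewrite lebesgue_measure_itv/= lte_fin.
case: ifPn => [xy'|_]; last by rewrite lte_fin.
by rewrite -EFinD lte_fin (le_lt_trans yx)// ltr_pdivrMr// mulr_natr mulr2n ltrDl.
Qed.

(** Normalised so that its primitive is [ramp p.1 p.2], which realises interpolants as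
    primitives. *)
Definition unit_bump (p : R * R) : R -> R := fun x => (p.2 - p.1)^-1 * \1_(`]p.1, p.2[%classic : set R) x.

Lemma L1_bump p : L1 (unit_bump p).
Proof.
rewrite /L1 /=.
have I1 : mu.-integrable `]0, 1[ (EFin \o \1_(`]p.1, p.2[%classic : set R)).
  by apply: (integrableS _ _ _ (integrable_indic_itv p.1 p.2 false true)).
have := fun m => integrableZl m (p.2 - p.1)^-1 I1.
move=> /(_ (measurable_itv _)); apply: eq_integrable => // x _ /=; rewrite EFinM.
Qed.

Lemma prim_bump p x : 0 <= p.1 -> p.1 < p.2 -> 0 <= x <= 1 ->
  prim (unit_bump p) x = ramp p.1 p.2 x.
Proof.
move=> p0 p12 /andP[x0 x1].
have I1 : mu.-integrable `]0, x[ (EFin \o \1_(`]p.1, p.2[%classic : set R)).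
  by apply: (integrableS _ _ _ (integrable_indic_itv p.1 p.2 false true)).
rewrite /prim /unit_bump RintegralZl// /Rintegral integral_indic//.
have -> : (`]p.1, p.2[%classic `&` `]0, x[%classic : set R) = `]p.1, Num.min x p.2[%classic.
  apply/seteqP; split=> y; rewrite /= !in_itv/= lt_min.
    by move=> [/andP[-> ->]] /andP[_ ->].
  by move=> /and3P[py -> ->]; rewrite py (le_lt_trans p0 py).
rewrite -[X in fine X]/(lebesgue_measure (`]p.1, Num.min x p.2[%classic : set R)).
rewrite lebesgue_measure_itv/= lte_fin lt_min p12 andbT.
case: ifPn => [px|]; last by rewrite -leNgt => xp /=; rewrite mulr0 ramp_left.
rewrite -EFinD /= mulrC; have [xp2|p2x] := leP x p.2.
  by rewrite ramp_mid// (ltW px) xp2.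
by rewrite mulfV ?ramp_right ?(ltW p2x)// subr_eq0 gt_eqF.
Qed.

End Primitive.

Section JFNorm.
Context {R : realType} {X : normedModType R} (e : symmetric_basis X).
Local Notation mu := (@lebesgue_measure R).

(** Integrals over intervals are increments of the primitive, so both suprema run over the same
    vectors; only indexed open intervals and lists of endpoints have to be matched. *)
Lemma JF_norm_le f C : L1 f -> (JF_norm e f <= C%:E)%E <-> Vle e (prim f) C.
Proof.
move=> Lf; split=> [H L fL|H].
  rewrite -snorm_incr_nondegenerate//.
  set L1 := [seq p <- L | p.1 < p.2].
  have fL1 : itv_family L1 by apply: family_subseq fL; exact: seq.filter_subseq.
  pose a (j : 'I_(size L1)) := (nth (0, 0) L1 j).1.
  pose b (j : 'I_(size L1)) := (nth (0, 0) L1 j).2.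
  have memj (j : 'I_(size L1)) : nth (0, 0) L1 j \in L1 by exact: mem_nth.
  have abj j : [/\ 0 <= a j, a j < b j & b j <= 1].
    have := memj j; rewrite mem_filter => /andP[ab _].
    by have [] := family_itv01 fL1 (memj j).
  rewrite -lee_fin; apply: le_trans H; apply: ereal_sup_ubound.
  exists (size L1), a, b; split.
  - move=> j; have [a0 ab b1] := abj j; split => //.
    by apply: subset_itv; rewrite bnd_simp.
  - apply/trivIsetP => i j _ _ ij; apply/seteqP; split => // x [].
    rewrite /= !in_itv/= => /andP[aix xbi] /andP[ajx xbj].
    have nov i' j' : (i' < j')%N -> nonoverlap (nth (0, 0) L1 i') (nth (0, 0) L1 j') \/
        (size L1 <= j')%N.
      move=> ij'; have [jL|jL] := ltnP j' (size L1); last by right.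
      by left; apply: (pairwiseP (0, 0) (andP fL1).2) => //; rewrite inE (ltn_trans ij').
    have nij : nonoverlap (nth (0, 0) L1 i) (nth (0, 0) L1 j).
      have [ij'|ij'|/val_inj eij] := ltngtP i j.
      + by have [//|] := nov _ _ ij'; rewrite leqNgt ltn_ord.
      + by rewrite nonoverlapC; have [//|] := nov _ _ ij'; rewrite leqNgt ltn_ord.
      + by move: ij; rewrite eij eqxx.
    case/orP: nij => h.
      by have := lt_trans ajx xbi; rewrite ltNge => /negP; apply.
    by have := lt_trans aix xbj; rewrite ltNge => /negP; apply.
  - congr (_%:E); rewrite /snorm size_map /fnorm; congr `|_|; apply: eq_bigr => j _.
    rewrite (nth_map (0, 0))//; have [a0 ab b1] := abj j.
    by rewrite (prim_incr Lf a0 (ltW ab) b1).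
apply: ge_ereal_sup => _ [m [a [b [ab tab ->]]]]; rewrite lee_fin.
have ab01 j : 0 <= a j /\ b j <= 1.
  have [abj sub] := ab j; split; rewrite leNgt; apply/negP => h.
    (* If [a j] were negative, this would be a negative point of the interval; the mirrored choice
       serves at 1. *)
    have : `]a j, b j[%classic ((a j + Num.min 0 (b j)) / 2).
      by rewrite /= in_itv/=; case: (leP 0 (b j)) => hb; rewrite ?min_l ?min_r ?(ltW hb)//; lra.
    move=> /sub; rewrite /= in_itv/= => /andP[+ _].
    by case: (leP 0 (b j)) => hb; rewrite ?min_l ?min_r ?(ltW hb)//; lra.
  have : `]a j, b j[%classic ((Num.max 1 (a j) + b j) / 2).
    by rewrite /= in_itv/=; case: (leP 1 (a j)) => hb; rewrite ?max_r ?max_l ?(ltW hb)//; lra.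
  move=> /sub; rewrite /= in_itv/= => /andP[_ +].
  by case: (leP 1 (a j)) => hb; rewrite ?max_r ?max_l ?(ltW hb)//; lra.
have fL : itv_family [seq (a j, b j) | j <- enum 'I_m].
  apply/andP; split.
    apply/allP => p /mapP[j _ ->]; have [abj _] := ab j; have [a0 b1] := ab01 j.
    by rewrite /itv01 /= a0 b1 ltW.
  rewrite pairwise_map; have : uniq (enum 'I_m) by exact: enum_uniq.
  rewrite uniq_pairwise; apply: sub_pairwise => i j /= ij.
  rewrite /nonoverlap /= leNgt [X in _ || X]leNgt -negb_and; apply/negP => /andP[h1 h2].
  have [abi _] := ab i; have [abj _] := ab j.
  move/trivIsetP: tab => /(_ i j I I ij)/seteqP[+ _].
  move=> /(_ ((Num.max (a i) (a j) + Num.min (b i) (b j)) / 2)); apply.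
  have lt1 : Num.max (a i) (a j) < Num.min (b i) (b j).
    by rewrite lt_min !gt_max abi abj h1 h2.
  have m1 : a i <= Num.max (a i) (a j) by rewrite le_max lexx.
  have m2 : a j <= Num.max (a i) (a j) by rewrite le_max lexx orbT.
  have m3 : Num.min (b i) (b j) <= b i by rewrite ge_min lexx.
  have m4 : Num.min (b i) (b j) <= b j by rewrite ge_min lexx orbT.
  move: lt1 m1 m2 m3 m4; move: (Num.max _ _) (Num.min _ _) => u v lt1 m1 m2 m3 m4.
  by split; rewrite /= in_itv/=; apply/andP; split; lra.
have := H _ fL; rewrite -map_comp; apply: le_trans.
rewrite le_eqVlt; apply/orP; left; apply/eqP.
rewrite /snorm size_map size_enum_ord /fnorm; congr `|_|; apply: eq_bigr => j _.
rewrite (nth_map j) ?size_enum_ord// nth_ord_enum /= /incr /=.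
have [abj _] := ab j; have [a0 b1] := ab01 j.
by rewrite (prim_incr Lf a0 (ltW abj) b1).
Qed.

Hypothesis HX : reflexive_space X.

(** The increments are dominated by those of the monotone primitive of the modulus of [f], so the
    variation is finite, and absolute continuity of the integral makes them uniformly small. *)
Lemma prim_in_V0 f : L1 f -> res (prim f) \in V0_pred e.
Proof.
move=> Lf.
have BV L : itv_family L -> \sum_(p <- L) `|incr (prim f) p| <= prim (fun x => `|f x|) 1.
  move=> fL; have -> : prim (fun x => `|f x|) 1 = prim (fun x => `|f x|) 1 - prim (fun x => `|f x|) 0.
    by rewrite prim0 subr0.
  apply: le_trans (@family_sum_le R (prim (fun x => `|f x|)) L _ fL); last first.
    by move=> x y; exact: prim_norm_le.
  rewrite big_seq [X in _ <= X]big_seq; apply: ler_sum => p /(family_itv01 fL)[p0 p12 p1].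
  exact: prim_norm_incr.
apply: (V0_predI (prim0 f)); first exact: Vle_bounded_variation BV.
apply: (@Vsmall_bounded_variation _ _ e HX _ _ _ BV) => eta eta0.
exact: prim_abs_continuous.
Qed.

Definition primV0 f : V0_space e := insubd (0 : V0_space e) (res (prim f)).

Lemma primV0E f (t : unit_interval R) : L1 f -> primV0 f t = prim f (\val t).
Proof. by move=> Lf; rewrite -[LHS]/(\val (insubd _ _) t) val_insubd prim_in_V0. Qed.

Lemma ext_primV0 f x : L1 f -> 0 <= x <= 1 -> ext (primV0 f) x = prim f x.
Proof. by move=> Lf x01; rewrite /ext primV0E// clampE. Qed.

Lemma primV0_lin a f g : L1 f -> L1 g ->
  primV0 (fun x => a * f x + g x) = a *: primV0 f + primV0 g.
Proof.
move=> Lf Lg; apply/val_inj/funext => t.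
rewrite -[RHS]/(a * primV0 f t + primV0 g t) -[LHS]/(primV0 _ t) !primV0E//.
  by rewrite prim_lin// (valP t).
exact: L1_lin.
Qed.

Lemma primV0_norm f (r : R) : L1 f -> JF_norm e f = r%:E -> `|primV0 f| = r.
Proof.
move=> Lf fr; apply/eqP; rewrite eq_le; apply/andP; split.
  apply: V0_norm_le; have /(JF_norm_le r Lf) : (JF_norm e f <= r%:E)%E by rewrite fr.
  by apply: eq_Vle => x x01; rewrite ext_primV0.
rewrite -lee_fin -fr; apply/(JF_norm_le _ Lf).
by apply: eq_Vle (V0_Vle (primV0 f)) => x x01; rewrite ext_primV0.
Qed.

Lemma interpV0_primV0 D (G : V_space e) : exists2 f, L1 f & interpV0 HX D G = primV0 f.
Proof.
rewrite interpV0E.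
have : forall p, p \in pairs 0 (grid D) -> 0 <= p.1 /\ p.1 < p.2.
  by move=> p /(pairs_mem (grid_path D))[].
elim: (pairs 0 (grid D)) => [_|p s IH H].
  (* The zero function is written as a combination of bumps, so that linearity of [primV0] alone
     gives the value 0. *)
  exists (fun x => -1 * unit_bump (0, 1) x + unit_bump (0, 1) x).
    by apply: L1_lin; exact: L1_bump.
  by rewrite big_nil primV0_lin ?scaleN1r ?addNr//; exact: L1_bump.
have [|f Lf E] := IH; first by move=> q qs; apply: H; rewrite inE qs orbT.
have [p0 p12] := H p (mem_head _ _).
exists (fun x => incr (ext G) p * unit_bump p x + f x).
  by apply: L1_lin => //; exact: L1_bump.
rewrite primV0_lin//; last exact: L1_bump.
rewrite big_cons E; congr (_ *: _ + _); apply/val_inj/funext => t.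
rewrite -[LHS]/(rampV0 e p t) -[RHS]/(primV0 _ t) rampV0E// primV0E; last exact: L1_bump.
by rewrite prim_bump// (valP t).
Qed.

End JFNorm.

(** * Isometries and topologies *)

Section Isometries.
Context {R : realType}.

(** Norm preservation, applied to differences, makes the relation single-valued and injective, so
    only its graph has to be described in the applications. *)
Lemma isometric_of_relation (E F : normedModType R) (Rel : E -> F -> Prop) :
  (forall a x y x' y', Rel x y -> Rel x' y' -> Rel (a *: x + x') (a *: y + y')) ->
  (forall x y, Rel x y -> `|x| = `|y|) ->
  (forall x, exists y, Rel x y) -> (forall y, exists x, Rel x y) -> isometric_spaces E F.
Proof.
move=> lin iso totl totr.
have [T HT] := choice totl; have [S HS] := choice totr.
have funct x y y' : Rel x y -> Rel x y' -> y = y'.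
  move=> xy xy'; have := iso _ _ (lin (-1) _ _ _ _ xy xy').
  rewrite scaleN1r addNr normr0 => /esym/eqP; rewrite normr_eq0 scaleN1r addrC subr_eq0.
  by move/eqP.
have inj x x' y : Rel x y -> Rel x' y -> x = x'.
  move=> xy xy'; have := iso _ _ (lin (-1) _ _ _ _ xy xy').
  rewrite [in RHS]scaleN1r addNr normr0 => /eqP; rewrite normr_eq0 scaleN1r addrC subr_eq0.
  by move/eqP.
have lT : linear T by move=> a x x'; apply: funct (HT _) _; exact: lin.
pose T' := GRing.isLinear.Build R E F *:%R T lT.
pose TL : {linear E -> F} := HB.pack T T'.
exists TL; split; last by move=> x; rewrite (iso _ _ (HT x)).
exists S => x; first by apply: inj (HS _) (HT x).
by apply: funct (HT _) (HS x).
Qed.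

Lemma isometric_trans (E F G : normedModType R) :
  isometric_spaces E F -> isometric_spaces F G -> isometric_spaces E G.
Proof.
move=> [S [[S' SK S'K] isoS]] [T [[T' TK T'K] isoT]].
apply: (@isometric_of_relation _ _ (fun x y => T (S x) = y)).
- by move=> a x y x' y' <- <-; rewrite !linearP.
- by move=> x y <-; rewrite isoT isoS.
- by move=> x; exists (T (S x)).
- by move=> y; exists (S' (T' y)); rewrite S'K T'K.
Qed.

Lemma isometric_dual (E F : normedModType R) :
  isometric_spaces E F -> isometric_spaces (dual F) (dual E).
Proof.
move=> [T [[T' TK T'K] isoT]].
have isoT' y : `|T' y| = `|y| by rewrite -isoT T'K.
have linT' a x y : T' (a *: x + y) = a *: T' x + T' y.
  by apply: (can_inj TK); rewrite linearP !T'K.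
apply: (@isometric_of_relation _ _ (fun (phi : dual F) (psi : dual E) => forall x, psi x = phi (T x))).
- by move=> a phi psi phi' psi' H H' x; rewrite !dual_addE !dual_scaleE H H'.
- move=> phi psi H; apply/eqP; rewrite eq_le; apply/andP; split.
    apply: le_dual_norm => // y; rewrite -(T'K y) -H T'K -isoT'; exact: dual_norm_le.
  apply: le_dual_norm => // x; rewrite H -(isoT x); exact: dual_norm_le.
- move=> phi.
  have lpsi : linear (fun x => phi (T x) : R^o) by move=> a x y; rewrite linearP dualD dualZ.
  have bpsi x : `|phi (T x)| <= `|phi| * `|x| by rewrite -(isoT x); exact: dual_norm_le.
  by exists (Dual (bounded_linear_dual lpsi bpsi)).
- move=> psi.
  have lphi : linear (fun y => psi (T' y) : R^o) by move=> a x y; rewrite linT' dualD dualZ.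
  have bphi y : `|psi (T' y)| <= `|psi| * `|y| by rewrite -(isoT' y); exact: dual_norm_le.
  by exists (Dual (bounded_linear_dual lphi bphi)) => x /=; rewrite TK.
Qed.

Lemma total_completion (T : Type) (A : T -> Prop) (E : normedModType R) (F : completeNormedModType R)
    (u : T -> E) (v : T -> F) :
  (forall f g, A f -> A g -> `|u f - u g| = `|v f - v g|) ->
  (forall x eps, 0 < eps -> exists2 f, A f & `|x - u f| <= eps) ->
  forall x, exists y, forall eps, 0 < eps ->
    exists f, [/\ A f, `|x - u f| <= eps & `|y - v f| <= eps].
Proof.
move=> uv du x.
have H n : exists f, A f /\ `|x - u f| <= n.+1%:R^-1.
  have n0 : 0 < (n.+1%:R^-1 : R) by rewrite invr_gt0 ltr0n.
  by have [f Af xf] := du x _ n0; exists f.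
have [f Hf] := choice H.
have Af n : A (f n) := (Hf n).1.
have xf n : `|x - u (f n)| <= n.+1%:R^-1 := (Hf n).2.
have : cvg (v (f n) @[n --> \oo]).
  apply: cauchy_cvg; apply/cauchy_exP => eps eps0.
  have [N _ HN] := near_mesh (divr_gt0 eps0 (ltr0Sn R 1)).
  exists (v (f N)); exists N => // n Nn; rewrite -ball_normE /= -uv//.
  rewrite -(subrK x (u (f N))) -addrA (splitr eps).
  apply: (le_lt_trans (ler_normD _ _)); rewrite distrC; apply: ltrD.
    by apply: (le_lt_trans (xf N)); exact: (HN _ (leqnn N)).
  by apply: (le_lt_trans (xf n)); exact: (HN _ Nn).
move=> /cvg_ex[y yv]; exists y => eps eps0.
have H1 : \forall n \near \oo, n.+1%:R^-1 < eps := near_mesh eps0.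
move/cvgrPdist_le : yv => /(_ _ eps0) H2.
have [n [h1 h2]] := filter_ex (filterI H1 H2).
by exists (f n); split => //; apply: (le_trans (xf n)); exact: ltW.
Qed.

(** Uniqueness of completions, for a bare type with a combination operation because integrable
    functions are given by a predicate on functions. Two points correspond when the same elements of
    [A] approximate both. *)
Lemma isometric_completion (T : Type) (A : T -> Prop) (comb : R -> T -> T -> T)
    (E F : completeNormedModType R) (u : T -> E) (v : T -> F) :
  (forall a f g, A f -> A g -> A (comb a f g)) ->
  (forall a f g, A f -> A g -> u (comb a f g) = a *: u f + u g) ->
  (forall a f g, A f -> A g -> v (comb a f g) = a *: v f + v g) ->
  (forall f, A f -> `|u f| = `|v f|) ->
  (forall x eps, 0 < eps -> exists2 f, A f & `|x - u f| <= eps) ->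
  (forall y eps, 0 < eps -> exists2 f, A f & `|y - v f| <= eps) ->
  isometric_spaces E F.
Proof.
move=> Ac uc vc uv du dv.
have uvB f g : A f -> A g -> `|u f - u g| = `|v f - v g|.
  move=> Af Ag; have := uv _ (Ac (-1) g f Ag Af); rewrite uc// vc// !scaleN1r.
  by rewrite ![- _ + _]addrC.
apply: (@isometric_of_relation _ _ (fun x y => forall eps, 0 < eps ->
    exists f, [/\ A f, `|x - u f| <= eps & `|y - v f| <= eps])).
- move=> a x y x' y' H H' eps eps0.
  have a1 : 0 < `|a| + 1 by rewrite ltr_wpDl.
  have [f [Af xf yf]] := H _ (divr_gt0 eps0 a1).
  have e2 : 0 < eps / 2 by rewrite divr_gt0.
  have [{}f [{}Af {}xf {}yf]] := H _ (divr_gt0 e2 a1).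
  have [g [Ag xg yg]] := H' _ e2.
  have main (V : normedModType R) (p q p' q' : V) : `|p - q| <= eps / 2 / (`|a| + 1) ->
      `|p' - q'| <= eps / 2 -> `|a *: p + p' - (a *: q + q')| <= eps.
    move=> pq pq'; rewrite opprD addrACA -scalerBr (splitr eps).
    apply: (le_trans (ler_normD _ _)); apply: lerD => //.
    move: pq; rewrite ler_pdivlMr// => /(le_trans _); apply.
    by rewrite normrZ mulrC ler_wpM2l// lerDl.
  exists (comb a f g); split; first exact: Ac.
    by rewrite uc//; exact: main.
  by rewrite vc//; exact: main.
- move=> x y H; apply/eqP; rewrite -subr_eq0 -normr_le0; apply/ler_addgt0Pl => eps eps0.
  rewrite addr0; have [f [Af xf yf]] := H _ (divr_gt0 eps0 (ltr0Sn R 1)).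
  have -> : `|x| - `|y| = (`|x| - `|u f|) - (`|y| - `|v f|) by rewrite uv//; lra.
  apply: (le_trans (ler_normB _ _)); rewrite (splitr eps); apply: lerD.
    exact: le_trans (ler_dist_dist _ _) xf.
  exact: le_trans (ler_dist_dist _ _) yf.
- by move=> x; exact: total_completion uvB du x.
- move=> y; have vuB f g : A f -> A g -> `|v f - v g| = `|u f - u g|.
    by move=> Af Ag; rewrite uvB.
  have [x Hx] := total_completion vuB dv y.
  by exists x => eps /Hx[f [Af yf xf]]; exists f.
Qed.

(** The distance to [Z] is sublinear and dominated by the norm; Hahn-Banach gives a functional below
    it with the same value at [x0]. Being nonpositive on the subspace [Z], it vanishes there. *)
Lemma distance_functional (E : normedModType R) (Z : E -> Prop) (x0 : E) :
  Z 0 -> (forall a x y, Z x -> Z y -> Z (a *: x + y)) ->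
  exists f : dual E, (forall z, Z z -> f z = 0) /\
    forall eps, 0 < eps -> exists2 z, Z z & `|x0 - z| <= f x0 + eps.
Proof.
move=> Z0 Zlin; pose S x := [set `|x - z| | z in [set z | Z z]].
have Sinf x : has_inf (S x).
  split; first by exists `|x - 0|, 0.
  by exists 0 => _ [z _ <-].
pose d x := inf (S x).
have dle x z : Z z -> d x <= `|x - z| by move=> Zz; apply: ge_inf; [exact: (Sinf x).2|exists z].
have led x c : (forall z, Z z -> c <= `|x - z|) -> c <= d x.
  by move=> H; apply: lb_le_inf; [exact: (Sinf x).1|move=> _ [z Zz <-]; exact: H].
have ZN a x : Z x -> Z (a *: x) by move=> Zx; have := Zlin a _ _ Zx Z0; rewrite addr0.
have ZD x y : Z x -> Z y -> Z (x + y) by move=> Zx Zy; have := Zlin 1 _ _ Zx Zy; rewrite scale1r.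
have dZ a x : 0 < a -> d (a *: x) <= a * d x.
  move=> a0; rewrite -ler_pdivrMl//; apply: (led) => z Zz; rewrite ler_pdivrMl//.
  apply: (le_trans (dle _ _ (ZN a z Zz))).
  by rewrite -scalerBr normrZ gtr0_norm.
have sd : sublinear d.
  split=> [x y|a x].
    rewrite -lerBlDl; apply: (led) => z Zz; rewrite lerBlDl -lerBlDr; apply: (led) => z' Zz'.
    rewrite lerBlDr; apply: (le_trans (dle _ _ (ZD _ _ Zz' Zz))).
    by rewrite opprD addrACA; exact: ler_normD.
  rewrite le_eqVlt => /predU1P[<-|a0].
    rewrite scale0r mul0r; apply/eqP; rewrite eq_le; apply/andP; split.
      by have := dle 0 0 Z0; rewrite subrr normr0.
    by apply: (led) => z _.
  apply/eqP; rewrite eq_le dZ//=.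
  have a'0 : 0 < a^-1 by rewrite invr_gt0.
  by have := dZ _ (a *: x) a'0; rewrite scalerA mulVf ?gt_eqF// scale1r ler_pdivlMl.
have [|f [fd fx0]] := @sublinear_functional R E d x0 1 sd.
  by move=> x; rewrite mul1r; have := dle x 0 Z0; rewrite subr0.
have fle z : Z z -> f z <= 0.
  move=> Zz; apply: (le_trans (fd z)); have := dle z z Zz; by rewrite subrr normr0.
exists f; split.
  move=> z Zz; apply/eqP; rewrite eq_le fle//=.
  have := fle _ (ZN (-1) z Zz); rewrite scaleN1r dualN; lra.
move=> eps eps0; have [_ [z Zz <-] Hz] := inf_adherent eps0 (Sinf x0).
by exists z => //; rewrite fx0; exact: ltW.
Qed.

End Isometries.

(** * Density of the point evaluations, the completion and the bidual *)

Section Consequences.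
Context {R : realType} {X : normedModType R} (e : symmetric_basis X).
Hypothesis HX : reflexive_space X.

Lemma small_on_finite_zeros_scaled (phi : dual (V0_space e)) (delta : R) : 0 < delta ->
  exists D : seq R, forall F : V0_space e,
    (forall t : unit_interval R, \val t \in D -> F t = 0) -> `|phi F| <= delta * `|F|.
Proof.
move=> d0; have [D HD] := small_on_finite_zeros HX phi d0.
exists D => F FD; have [->|F0] := eqVneq F 0; first by rewrite dual0 !normr0 mulr0.
have nF : 0 < `|F| by rewrite normr_gt0.
have := HD (`|F|^-1 *: F); rewrite normrZ normfV normr_id mulVf ?gt_eqF// => /(_ (lexx _)).
rewrite dualZ normrM normfV normr_id mulrC ler_pdivrMr//; apply => t tD.
by rewrite -[LHS]/(`|F|^-1 * F t) FD// mulr0.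
Qed.

Lemma interp_remainder_zero D (F : V0_space e) (t : unit_interval R) : \val t \in D ->
  (F - interpV0 HX D (V0_to_V F)) t = 0.
Proof.
by move=> tD; rewrite -[LHS]/(F t - interpV0 HX D (V0_to_V F) t) interpV0_node// subrr.
Qed.

Lemma interp_remainder_norm D (F : V0_space e) : `|F - interpV0 HX D (V0_to_V F)| <= 2 * `|F|.
Proof.
apply: (le_trans (ler_normB _ _)); have := interpV0_norm HX D (V0_to_V F).
by rewrite -[`|V0_to_V F|]/(`|F|); lra.
Qed.

(** The remainder of interpolation at [D] vanishes on [D] and has at most twice the norm of the
    function. This is the norm density of the span of the point evaluations in the dual. *)
Lemma interp_dual_close (phi : dual (V0_space e)) (delta : R) : 0 < delta ->
  exists D, forall F, `|phi F - interp_dual D phi F| <= delta * `|F|.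
Proof.
move=> d0; have [D HD] := small_on_finite_zeros_scaled phi (divr_gt0 d0 (ltr0Sn R 1)).
exists D => F; rewrite (interp_dualE HX) -dualB.
apply: (le_trans (HD _ _)); first exact: interp_remainder_zero.
have d2 : 0 <= delta / 2 by rewrite ltW// divr_gt0.
apply: (le_trans (ler_wpM2l d2 (interp_remainder_norm D F))).
by rewrite mulrA divfK.
Qed.

(* A functional vanishing on the primitives vanishes on all interpolants, hence is
   arbitrarily small by [interp_dual_close]. *)
Lemma primV0_dense (G : V0_space e) eps : 0 < eps ->
  exists2 f : R -> R, L1 f & `|G - primV0 e f| <= eps.
Proof.
move=> eps0; pose Z (z : V0_space e) := exists2 f : R -> R, L1 f & z = primV0 e f.
have Zlin a x y : Z x -> Z y -> Z (a *: x + y).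
  move=> [f Lf ->] [g Lg ->]; exists (fun t => a * f t + g t); first exact: L1_lin.
  by rewrite primV0_lin.
have Zx : Z (primV0 e (unit_bump (0, 1))) by exists (unit_bump (0, 1)) => //; exact: L1_bump.
have Z0 : Z 0 by have := Zlin (-1) _ _ Zx Zx; rewrite scaleN1r addNr.
have [phi [phiZ phiG]] := distance_functional G Z0 Zlin.
have phiG0 : phi G = 0.
  apply/eqP; rewrite -normr_le0; apply/ler_addgt0Pl => d d0; rewrite addr0.
  have g1 : 0 < `|G| + 1 by rewrite ltr_wpDl.
  have [D HD] := interp_dual_close phi (divr_gt0 d0 g1).
  have := HD G; rewrite (interp_dualE HX).
  have [f Lf ->] := interpV0_primV0 HX D (V0_to_V G).
  rewrite (phiZ (primV0 e f)); last by exists f.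
  rewrite subr0 => /le_trans; apply.
  by rewrite mulrAC ler_pdivrMr// ler_wpM2l ?(ltW d0)// lerDl.
have [z [f Lf ->]] := phiG _ eps0.
by rewrite phiG0 add0r; exists f.
Qed.

Lemma JF_isometric_V0 (JF : completeNormedModType R) (i : (R -> R) -> JF) :
  JF_completion e i -> isometric_spaces JF (V0_space e).
Proof.
move=> [ilin iiso idense].
apply: (@isometric_completion R (R -> R) (fun f => L1 f) (fun a f g x => a * f x + g x) JF
  (V0_space e) i (primV0 e)).
- exact: L1_lin.
- exact: ilin.
- by move=> a f g Lf Lg; rewrite primV0_lin.
- by move=> f Lf; rewrite (primV0_norm HX Lf (esym (iiso _ Lf))).
- move=> x eps eps0.
  have nb : (ball x eps)^° !=set0 by exists x; exact: nbhsx_ballx.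
  have [y [xb [f Lf fy]]] := idense _ nb (@open_interior _ _).
  by exists f => //; have := interior_subset xb; rewrite -fy -ball_normE /= => /ltW.
- exact: primV0_dense.
Qed.

(** A functional of norm at most 1 on X, composed with the increments along [L], is a combination of
    point evaluations of norm at most 1. [Phi] is tested on it, with the functional on X chosen to
    norm the vector at hand. *)
Lemma bidual_Vle (Phi : dual (dual (V0_space e))) :
  Vle e (ext (fun t => Phi (delta e t))) `|Phi|.
Proof.
move=> L fL.
pose v : X := \sum_(k < size L) nth 0 (map (incr (ext (fun t => Phi (delta e t)))) L) k *: e k.
have -> : snorm e (map (incr (ext (fun t => Phi (delta e t)))) L) = `|v|.
  by rewrite /snorm /fnorm size_map.
have [psi [psi1 <-]] := norming_functional v.
pose q k := nth (0, 0) L k.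
pose w : dual (V0_space e) := \sum_(k < size L) psi (e k) *: (delta e (clamp (q k).2) - delta e (clamp (q k).1)).
have -> : psi v = Phi w.
  rewrite /v /w !dual_sum; apply: eq_bigr => k _.
  by rewrite !dualZ (nth_map (0, 0))// dualB mulrC.
apply: (le_trans (ler_norm _)); apply: (le_trans (dual_norm_le _ _)).
rewrite ler_piMr//; apply: le_dual_norm => // F; rewrite mul1r.
pose u : X := \sum_(k < size L) nth 0 (map (incr (ext F)) L) k *: e k.
have -> : w F = psi u.
  rewrite /w /u dual_sumE dual_sum; apply: eq_bigr => k _.
  by rewrite dualZ (nth_map (0, 0))// mulrC.
apply: (le_trans (dual_norm_le _ _)); rewrite -[leRHS]mul1r ler_pM//.
have := V0_Vle F fL; rewrite /snorm /fnorm size_map; exact.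
Qed.

Lemma delta0 : delta e I0 = 0.
Proof. by apply: dual_ext => F; rewrite -[LHS]/(F I0) -(ext_val F) /= V0_at0. Qed.

Lemma bidual_delta_eq0 (Psi : dual (dual (V0_space e))) : (forall t, Psi (delta e t) = 0) -> Psi = 0.
Proof.
move=> H; apply: dual_ext => phi; rewrite -[RHS]/(0 : R).
apply/eqP; rewrite -normr_le0; apply/ler_addgt0Pl => d d0; rewrite addr0.
have p1 : 0 < `|Psi| + 1 by rewrite ltr_wpDl.
have [D HD] := interp_dual_close phi (divr_gt0 d0 p1).
have Psi0 : Psi (interp_dual D phi) = 0.
  by rewrite dual_sum big1// => p _; rewrite dualZ dualB !H subrr mulr0.
rewrite -[Psi phi]subr0 -Psi0 -dualB; apply: (le_trans (dual_norm_le _ _)).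
have : `|phi - interp_dual D phi| <= d / (`|Psi| + 1).
  by apply: le_dual_norm => //; rewrite ltW// divr_gt0.
move=> /(ler_wpM2l (normr_ge0 Psi))/le_trans; apply.
by rewrite mulrCA -[leRHS]mulr1 ler_wpM2l ?(ltW d0)// ler_pdivrMr// mul1r lerDl.
Qed.

(** One norm inequality is [bidual_Vle]. For the other, Phi and [T G] agree on the point
    evaluations, hence coincide by density, and T does not increase norms; T also gives
    surjectivity. *)
Lemma bidual_isometric_V : isometric_spaces (dual (dual (V0_space e))) (V_space e).
Proof.
have [T [T_linear T_norm T_delta _]] := bidual_extension e HX.
apply: (@isometric_of_relation R _ _ (fun (Phi : dual (dual (V0_space e))) (G : V_space e) =>
  forall t, Phi (delta e t) = G t)).
- by move=> a Phi G Phi' G' H H' t; rewrite dual_addE dual_scaleE H H'.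
- move=> Phi G H; apply/eqP; rewrite eq_le; apply/andP; split.
    have -> : Phi = T G.
      apply/eqP; rewrite -subr_eq0; apply/eqP/bidual_delta_eq0 => t.
      by rewrite -[LHS]/(Phi (delta e t) - T G (delta e t)) H T_delta subrr.
    exact: T_norm.
  apply: V_norm_le; apply: eq_Vle (bidual_Vle Phi) => x _.
  exact: H.
- move=> Phi; have VP : (fun t => Phi (delta e t) : R^o) \in V_pred e.
    apply/V_predP; split; first by rewrite delta0 dual0.
    by exists `|Phi|; exact: bidual_Vle.
  by exists (VSpace VP).
- by move=> G; exists (T G).
Qed.

End Consequences.

Lemma cvg_initial_topology (S : choiceType) (T : topologicalType) (w : S -> T)
    (F : set_system S) (s : S) : Filter F ->
  w @ F --> w s -> F --> (s : initial_topology w).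
Proof.
move=> FF ws U [V /= [[W oW <-]] Wws /filterS]; apply; apply: ws.
exact: open_nbhs_nbhs.
Qed.

Lemma ptws_cvgP (U : Type) (V : topologicalType) (F : set_system (U -> V)) (f : U -> V) :
  Filter F -> {ptws, F --> f} <-> forall t, g t @[g --> F] --> f t.
Proof.
move=> FF; split=> [/cvg_sup H t|H].
  have := @initial_continuous _ _ (fun g : U -> V => g t) f.
  exact: (cvg_comp _ _ (H t)).
apply/cvg_sup => t; apply: cvg_initial_topology; exact: H.
Qed.

(** * Weak and pointwise topologies on bounded sets *)

Section WeakPointwise.
Context {R : realType} {X : normedModType R} (e : symmetric_basis X).
Hypothesis HX : reflexive_space X.

Lemma weak_cvg (f : V0_space e) (phi : dual (V0_space e)) :
  phi g @[g --> nbhs (f : weak_space (V0_space e))] --> phi f.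
Proof.
have : {ptws, (fun (g : V0_space e) (psi : dual (V0_space e)) => psi g : R) @
    nbhs (f : weak_space (V0_space e)) --> (fun psi : dual (V0_space e) => psi f : R)}.
  exact: (@initial_continuous _ _ (fun (g : V0_space e) => (fun psi => psi g) : {ptws dual (V0_space e) -> R})).
by move=> /ptws_cvgP/(_ phi).
Qed.

Lemma pointwise_cvg (f : V0_space e) (t : unit_interval R) :
  (g : V0_space e) t @[g --> nbhs (f : V0_pointwise e)] --> (f t : R).
Proof.
have : {ptws, (fun (g : V0_space e) (t : unit_interval R) => g t : R) @
    nbhs (f : V0_pointwise e) --> (fun t : unit_interval R => f t : R)}.
  exact: (@initial_continuous _ _ ((fun g : V0_space e => V0_fun g) : _ -> {ptws unit_interval R -> R})).
by move=> /ptws_cvgP/(_ t).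
Qed.

Lemma pointwise_le_weak (f : V0_space e) :
  nbhs (f : weak_space (V0_space e)) --> (f : V0_pointwise e).
Proof.
apply: cvg_initial_topology; apply/ptws_cvgP => t.
by have := @weak_cvg f (delta e t).
Qed.

(** On a bounded set [phi] is uniformly close to a finite combination of point evaluations; the
    tolerance is divided by [M] plus the norm of [f] to cover the errors at [g] and at [f]
    together. *)
Lemma weak_le_pointwise_bounded (B : set (V0_space e)) (f : V0_space e) :
  bounded_set B -> within B (nbhs (f : V0_pointwise e)) --> (f : weak_space (V0_space e)).
Proof.
move=> [M0 [_ HM0]]; have [M MB M1] : exists2 M : R, (forall g, B g -> `|g| <= M) & 0 < M.
  exists (Num.max 1 (M0 + 1)); last by rewrite lt_max ltr01.
  by apply: HM0; rewrite lt_max ltrDl ltr01 orbT.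
apply: cvg_initial_topology; apply/ptws_cvgP => phi.
apply/cvgrPdist_le => eps eps0.
have f1 : 0 < M + `|f| by rewrite ltr_pwDl.
have eps2 : 0 < eps / 2 by rewrite divr_gt0.
have [D HD] := interp_dual_close HX phi (divr_gt0 eps2 f1).
have E (g : V0_space e) : interp_dual D phi g =
    \sum_(p <- pairs 0 (grid D)) phi (rampV0 e p) * (g (clamp p.2) - g (clamp p.1)).
  by rewrite /interp_dual dual_sumE.
have sum_cvg (s : seq (R * R)) :
    \sum_(p <- s) phi (rampV0 e p) * (g (clamp p.2) - g (clamp p.1))
      @[g --> nbhs (f : V0_pointwise e)] -->
    (\sum_(p <- s) phi (rampV0 e p) * (f (clamp p.2) - f (clamp p.1)) : R).
  elim: s => [|p s IH].
    rewrite big_nil; apply: cvg_near_cst; apply: nearW => g.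
    by rewrite big_nil.
  rewrite big_cons; under eq_cvg do rewrite big_cons.
  by apply: cvgD IH; apply: cvgMr; apply: cvgB; exact: pointwise_cvg.
have : interp_dual D phi g @[g --> nbhs (f : V0_pointwise e)] --> (interp_dual D phi f : R).
  by rewrite E; under eq_cvg do rewrite E; exact: sum_cvg.
move=> /cvgrPdist_le/(_ _ eps2) H.
rewrite /within /=; apply: filterS H => g Hg Bg.
have Hf := HD f; have {}HD := HD g.
have gM := MB g Bg.
set k := eps / 2 / (M + `|f|) in HD Hf.
have k0 : 0 <= k by rewrite /k ltW// divr_gt0.
have Ek : k * (M + `|f|) = eps / 2 by rewrite /k divfK// gt_eqF.
have Hk := ler_wpM2l k0 gM.
suff : `|phi f - phi g| <= eps by [].
have -> : phi f - phi g = (phi f - interp_dual D phi f) +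
  (interp_dual D phi f - interp_dual D phi g) - (phi g - interp_dual D phi g) by lra.
apply: (le_trans (ler_normB _ _)).
apply: (le_trans (lerD (le_trans (ler_normD _ _) (lerD Hf Hg)) HD)).
move: Ek Hk; rewrite mulrDr; move: (k * `|f|) (k * M) (k * `|g|) => a b c; lra.
Qed.

End WeakPointwise.

Theorem theoremE (R : realType) (X : completeNormedModType R)
    (e : symmetric_basis X) (HX : reflexive_space X) :
  (forall (JF : completeNormedModType R) (i : (R -> R) -> JF),
     JF_completion e i ->
     isometric_spaces JF (V0_space e) /\
     isometric_spaces (dual (dual JF)) (V_space e)) /\
  (forall B : set (V0_space e), bounded_set B ->
     forall A : set (V0_space e),
       (exists2 U : set (weak_space (V0_space e)), open U & A = B `&` U) <->
       (exists2 U : set (V0_pointwise e), open U & A = B `&` U)).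
Proof.
split=> [JF i JFi|B bB A].
  have iso := JF_isometric_V0 HX JFi; split => //.
  apply: isometric_trans (bidual_isometric_V e HX).
  exact/isometric_dual/isometric_dual.
split=> -[U oU ->].
  (* The implication turns a relative neighbourhood into an absolute one: points of [B] in [U] are
     interior to [W] for pointwise convergence, and [W] meets [B] only inside [U]. *)
  pose W : set (V0_pointwise e) := [set g : V0_space e | B g -> U g].
  exists (W^°); first exact: open_interior.
  apply/seteqP; split=> g [Bg Ug]; split => //.
    by apply: (weak_le_pointwise_bounded HX (f := g) bB); exact: open_nbhs_nbhs.
  by have := interior_subset Ug; exact.
exists U => //.
rewrite openE => g Ug; apply: (@pointwise_le_weak _ _ e g).
exact: open_nbhs_nbhs.
Qed.
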